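(* Let $n \geq 1$ and $k > 1$ be integers. Suppose that $\mu$ is a Borel measure on $\mathbb{R}^n_{+}$ with density $\exp(-\varphi)$ (with respect to Lebesgue measure), where $\varphi: \mathbb{R}^n_{+} \rightarrow (-\infty, \infty]$ is $p$-convex for $p=1/k$. Assume that $f: \mathbb{R}^n_+ \rightarrow \mathbb{R}$ is a $\mu$-integrable, locally Lipschitz function with $\int f \, d\mu = 0$. Then $$\int_{\mathbb{R}^n_{+}} f^2 \, d\mu \leq \frac{k^2}{k-1} \sum_{i=1}^n \int_{\mathbb{R}^n_{+}} x_i^{2} \left| \partial^i f(x) \right|^2 d\mu(x).$$
   Context: $\mathbb{R}^n_+$ denotes the set of all $x \in \mathbb{R}^n$ with positive coordinates. A function $\varphi: \mathbb{R}^n_{+} \rightarrow (-\infty, \infty]$ is called $p$-convex, for $0 < p \leq 1$, if the function $(x_1,\ldots,x_n) \mapsto \varphi(x_1^{1/p},\ldots,x_n^{1/p})$ is convex on $\mathbb{R}^n_+$. $\partial^i f = \partial f/\partial x_i$ (defined almost everywhere, as $f$ is locally Lipschitz). No boundary conditions are imposed on $f$. The right-hand side may be $+\infty$, and $e^{-\infty}=0$. *)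

(* Defs.v *)
From HB Require Import structures.
From mathcomp Require Import all_boot all_order all_algebra.
From mathcomp Require Import all_classical all_reals all_analysis.
From mathcomp Require Import measurable_realfun.

Set Implicit Arguments.
Unset Strict Implicit.
Unset Printing Implicit Defensive.

Import Order.TTheory GRing.Theory Num.Theory.
Import numFieldNormedType.Exports.

Local Open Scope classical_set_scope.
Local Open Scope ring_scope.

Section borel_rV.
Context {R : realType} {n : nat}.

Definition borel_rV : set (set 'rV[R]_n) := <<s @open 'rV[R]_n >>.

Let borel_rV0 : borel_rV set0.
Proof. exact: sigma_algebra0. Qed.

Let borel_rVC A : borel_rV A -> borel_rV (~` A).
Proof. exact: sigma_algebraC. Qed.

Let borel_rV_bigcup (F : (set 'rV[R]_n)^nat) :
  (forall i, borel_rV (F i)) -> borel_rV (\bigcup_i F i).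
Proof. exact: sigma_algebra_bigcup. Qed.

HB.instance Definition _ := @isMeasurable.Build default_measure_display
  'rV[R]_n borel_rV borel_rV0 borel_rVC borel_rV_bigcup.

End borel_rV.

Section measurable_rV.
Context {R : realType}.

Lemma open_measurable_rV n (U : set 'rV[R]_n) : open U -> measurable U.
Proof. by move=> oU; exact: sub_sigma_algebra. Qed.

Lemma measurable_coord n (i : 'I_n) :
  measurable_fun setT (fun x : 'rV[R]_n => x ord0 i).
Proof.
apply: (measurability _ (RGenOpens.measurableE R)).
move=> _ [_ [a [b ->]] <-]; rewrite setTI; apply: open_measurable_rV.
apply: open_comp; last exact: interval_open.
by move=> x _; exact: coord_continuous.
Qed.

Lemma rV_bigcup_ratball n (U : set 'rV[R]_n) : open U ->
  U = \bigcup_(p in [set p : 'rV[rat]_n * nat |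
        ball (map_mx ratr p.1 : 'rV[R]_n) p.2.+1%:R^-1 `<=` U])
      ball (map_mx ratr p.1 : 'rV[R]_n) p.2.+1%:R^-1.
Proof.
move=> oU; apply/seteqP; split => [x Ux|x [p /= +]]; last by apply.
have /nbhs_ballP[e /= e0 xeU] : nbhs x U by exact: open_nbhs_nbhs.
have [k ke] : exists k : nat, k.+1%:R^-1 < e / 2.
  have [k _ /(_ k (leqnn k))] := near_infty_natSinv_lt (PosNum (divr_gt0 e0 (ltr0Sn R 1))).
  by exists k.
have k0 : 0 < k.+1%:R^-1 :> R by rewrite invr_gt0.
have qP (i : 'I_n) : exists q : rat, ball (x ord0 i) k.+1%:R^-1 (ratr q : R).
  have [||y [yx [q _ qy]]] := @dense_rat R (ball (x ord0 i) k.+1%:R^-1).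
  - by exists (x ord0 i); exact: ballxx.
  - exact: ball_open.
  by exists q; rewrite qy.
pose q : 'rV[rat]_n := \row_i projT1 (cid (qP i)).
have xq : ball x k.+1%:R^-1 (map_mx ratr q : 'rV[R]_n).
  split=> // i j; rewrite !ord1 !mxE; exact: (projT2 (cid (qP j))).
exists (q, k) => /=; last exact: ball_sym.
move=> y qy; apply: xeU; rewrite (splitr e).
by apply: ball_triangle; [exact: (le_ball (ltW ke) xq)|exact: (le_ball (ltW ke) qy)].
Qed.

Lemma measurable_fun_rVP d (T : measurableType d) n (f : T -> 'rV[R]_n) :
  (forall i, measurable_fun setT (fun x => f x ord0 i)) -> measurable_fun setT f.
Proof.
move=> mf.
have mball (q : 'rV[R]_n) (e : R) : measurable (f @^-1` ball q e).
  have [e0|e0] := ltP 0 e; last first.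
    rewrite (_ : _ @^-1` _ = set0)//; apply/seteqP; split => // x [].
    by rewrite ltNge e0.
  rewrite (_ : _ @^-1` _ =
      \bigcap_(i in [set: 'I_n]) ((fun x => f x ord0 i) @^-1` ball (q ord0 i) e)).
    apply: fin_bigcap_measurable => [|i _]; first exact: finite_finset.
    rewrite -[X in measurable X]setTI; apply: mf => //.
    exact: measurable_ball.
  apply/seteqP; split => x /=.
    by move=> [_ xe] i _; exact: xe.
  by move=> xe; split=> // j i; rewrite (ord1 j); exact: xe.
apply: (@measurability _ _ _ _ _ f open) => // _ [U oU <-]; rewrite setTI.
rewrite (rV_bigcup_ratball oU) preimage_bigcup bigcup_mkcond.
apply: countable_bigcupT_measurable => [|p]; first exact: countableP.
by case: ifPn.
Qed.

End measurable_rV.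

Section rV_cons.
Context {R : realType} {n : nat}.

Definition rV_cons (p : measurableTypeR R * 'rV[R]_n) : 'rV[R]_n.+1 :=
  \row_i (if unlift ord0 i is Some j then p.2 ord0 j else p.1).

Lemma rV_cons0 p : rV_cons p ord0 ord0 = p.1.
Proof. by rewrite mxE unlift_none. Qed.

Lemma rV_consS p j : rV_cons p ord0 (lift ord0 j) = p.2 ord0 j.
Proof. by rewrite mxE liftK. Qed.

Lemma measurable_rV_cons : measurable_fun setT rV_cons.
Proof.
apply: measurable_fun_rVP => i; case: (unliftP ord0 i) => [j|] ->.
  under eq_fun do rewrite rV_consS.
  exact: (measurableT_comp (measurable_coord j)).
by under eq_fun do rewrite rV_cons0; exact: measurable_fst.
Qed.

Definition rV_uncons (x : 'rV[R]_n.+1) : measurableTypeR R * 'rV[R]_n :=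
  (x ord0 ord0, \row_j x ord0 (lift ord0 j)).

Lemma rV_consK : cancel rV_cons rV_uncons.
Proof.
move=> [a v]; congr pair; first exact: rV_cons0.
by apply/rowP => j; rewrite mxE rV_consS.
Qed.

Lemma rV_unconsK : cancel rV_uncons rV_cons.
Proof.
move=> x; apply/rowP => i; case: (unliftP ord0 i) => [j|] ->.
  by rewrite rV_consS mxE.
by rewrite rV_cons0.
Qed.

Lemma measurable_rV_uncons : measurable_fun setT rV_uncons.
Proof.
apply/measurable_fun_pairP; split; first exact: (measurable_coord ord0).
apply: measurable_fun_rVP => j.
by under eq_fun do rewrite /= mxE; exact: measurable_coord.
Qed.

End rV_cons.

Section pushforward_rV_cons.
Local Open Scope ereal_scope.
Context {R : realType} {n : nat}.
Variable mu : {sigma_finite_measure set 'rV[R]_n -> \bar R}.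

Definition lebesgue_cons : set 'rV[R]_n.+1 -> \bar R :=
  pushforward (lebesgue_measure \x mu) rV_cons.

Let pushforward_cons : {measure set 'rV[R]_n.+1 -> \bar R} :=
  measure_function_pushforward__canonical__measure_function_Measure
    (lebesgue_measure \x mu) measurable_rV_cons.

HB.instance Definition _ := isMeasure.Build _ _ _ lebesgue_cons
  (measure0 pushforward_cons) (measure_ge0 pushforward_cons)
  (@measure_semi_sigma_additive _ _ _ pushforward_cons).

Let sigma_finite_lebesgue_cons : sigma_finite setT lebesgue_cons.
Proof.
have /sigma_finiteP[F [TF ndF Foo]] := sigma_finiteT (@lebesgue_measure R).
have /sigma_finiteP[G [TG ndG Goo]] := sigma_finiteT mu.
exists (fun k => rV_uncons @^-1` (F k `*` G k)).
  apply/esym; rewrite -subTset => x _.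
  have [k _ Fk] : (\bigcup_k F k) (x ord0 ord0) by rewrite -TF.
  have [l _ Gl] : (\bigcup_k G k) (rV_uncons x).2 by rewrite -TG.
  exists (maxn k l) => //; split => /=.
  - by move: Fk; exact/subsetPset/ndF/leq_maxl.
  - by move: Gl; exact/subsetPset/ndG/leq_maxr.
move=> k; have [mF Fk] := Foo k; have [mG Gk] := Goo k; split.
  rewrite -[X in measurable X]setTI; apply: measurable_rV_uncons => //.
  exact: measurableX.
rewrite /lebesgue_cons /pushforward -comp_preimage.
rewrite (_ : _ \o _ = id); last by apply/funext; exact: rV_consK.
by rewrite preimage_id product_measure1E// lte_mul_pinfty// ge0_fin_numE.
Qed.

HB.instance Definition _ := Measure_isSigmaFinite.Build _ _ _ lebesgue_cons
  sigma_finite_lebesgue_cons.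

End pushforward_rV_cons.

(* The n-fold product of [lebesgue_measure]. Being sigma-finite, it is          *)
(* determined by the values on boxes computed in [lebesgue_rV_box].            *)
Fixpoint lebesgue_rV_rec (R : realType) (n : nat) :
    {sigma_finite_measure set 'rV[R]_n -> \bar R} :=
  if n is m.+1 then lebesgue_cons (lebesgue_rV_rec R m) else \d_(0 : 'rV[R]_0).

Definition lebesgue_rV {R : realType} {n : nat} : set 'rV[R]_n -> \bar R :=
  lebesgue_rV_rec R n.

HB.instance Definition _ (R : realType) (n : nat) :=
  SigmaFiniteMeasure.on (@lebesgue_rV R n).

Lemma lebesgue_rV_box (R : realType) (n : nat)
    (A : 'I_n -> set (measurableTypeR R)) : (forall i, measurable (A i)) ->
  lebesgue_rV [set x : 'rV[R]_n | forall i, A i (x ord0 i)] =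
  (\prod_(i < n) lebesgue_measure (A i))%E.
Proof.
elim: n => [|n ih] in A *; move=> mA.
  by rewrite big_ord0 /lebesgue_rV /= diracE mem_set// => -[].
have mbox : measurable [set x : 'rV[R]_n | forall i, A (lift ord0 i) (x ord0 i)].
  have -> : [set x : 'rV[R]_n | forall i, A (lift ord0 i) (x ord0 i)] =
      \bigcap_(i in [set: 'I_n])
        ((fun x : 'rV[R]_n => x ord0 i) @^-1` A (lift ord0 i)).
    by apply/seteqP; split => x /= h i; [move=> _; exact: h|exact: h].
  apply: fin_bigcap_measurable => [|i _]; first exact: finite_finset.
  by rewrite -[X in measurable X]setTI; exact: (measurable_coord i measurableT (mA (lift ord0 i))).
rewrite big_ord_recl -ih// /lebesgue_rV.
rewrite -(product_measure1E lebesgue_measure (lebesgue_rV_rec R n) (mA ord0) mbox).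
rewrite /= /lebesgue_cons /pushforward; congr (_ _).
apply/seteqP; split => [[a v] /= h|[a v] /= [h0 h] i].
  split=> [|i]; first by have := h ord0; rewrite rV_cons0.
  by have := h (lift ord0 i); rewrite rV_consS.
by case: (unliftP ord0 i) => [j|] ->; rewrite ?rV_cons0 ?rV_consS.
Qed.

Section poincare_definitions.
Context {R : realType} {n : nat}.
Implicit Types (A : set 'rV[R]_n) (phi : 'rV[R]_n -> \bar R).

Definition orthant : set 'rV[R]_n := [set x | forall i, 0 < x ord0 i].

(* In \bar R, 0 * +oo = 0, so the inequality is trivial for t = 0 and t = 1. *)
Definition econvex_on A phi := forall (x y : 'rV[R]_n) (t : R),
  A x -> A y -> 0 <= t <= 1 ->
  (phi (t *: x + (1 - t) *: y)%R <= t%:E * phi x + (1 - t)%:E * phi y)%E.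

Definition p_convex (p : R) phi := econvex_on orthant
  (fun x => phi (\row_i (x ord0 i `^ p^-1))).

Definition locally_lipschitz_on A (f : 'rV[R]_n -> R) :=
  forall x, A x -> exists2 U, nbhs x U & [lipschitz f y | y in U `&` A].

(* [rho] need not be Borel. The integral of a nonnegative function is the      *)
(* supremum of the integrals of the Borel simple functions below it, which is  *)
(* its Lebesgue integral as soon as it is Lebesgue measurable; exp(- phi) is   *)
(* so when phi is p-convex.                                                    *)
Definition has_density_on A (mu : {measure set 'rV[R]_n -> \bar R})
    (rho : 'rV[R]_n -> \bar R) :=
  forall B, measurable B -> B `<=` A ->
    mu B = (\int[lebesgue_rV]_(x in B) rho x)%E.

(* Where the limit does not exist 'D_ is a default value; for locally Lipschitz *)
(* f this happens only on a Lebesgue-null set.                                 *)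
Definition partial (i : 'I_n) (f : 'rV[R]_n -> R) (x : 'rV[R]_n) : R :=
  'D_(delta_mx ord0 i) f x.

End poincare_definitions.

Arguments orthant : clear implicits.

(* Main.v *)
(* Put x_i = y_i^k. By p-convexity y |-> exp (- phi (y^k)) is log-concave, and the Jacobian
   satisfies, with m the midpoint of y and y' and a_i = (y_i - y'_i) / (y_i + y'_i),
     \prod_i (y_i y'_i)^(k-1) <= \prod_i m_i^(2(k-1)) exp (- (k-1) \sum_i a_i^2).
   This Gaussian gain absorbs a first-order change of the weights: with x = y^k, x' = y'^k and z = m^k,
     F x - F x' = \sum_i 2 k z_i (partial_i F)(z) a_i + O(|a|^2),
   so the Prekopa-Leindler inequality in y applies to rho exp (d F), rho exp (- d F) and rho exp Q,
   where rho = exp (- phi) and Q = d^2 k^2 \sum_i z_i^2 (partial_i F)^2 / (2 (k - 1 - O(d))).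
   The terms of order d^2 as d -> 0 are the variance inequality.

   It is obtained first for truncations of rho on boxes and for cube averages of a Lipschitz F, whose
   quadratic Taylor estimate follows from the almost everywhere differentiability of F along lines.
   Then the cubes shrink and the boxes exhaust the orthant. A p-concave density is continuous off a
   null set: its discontinuities lie on faces of superlevel sets, and the translates of a face along
   a diagonal are pairwise disjoint. *)
Require Import Defs.
From HB Require Import structures.
From mathcomp Require Import all_boot all_order all_algebra.
From mathcomp Require Import all_classical all_reals all_analysis.
From mathcomp Require Import measurable_realfun ring lra.
Set Implicit Arguments.
Unset Strict Implicit.
Unset Printing Implicit Defensive.
Import Order.TTheory GRing.Theory Num.Theory.
Import numFieldNormedType.Exports.
Local Open Scope classical_set_scope.
Local Open Scope ring_scope.

(** * Fubini and translation invariance in R^n *)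

(** The constant comes from completing a square in each coordinate. With P_i = k z_i (partial_i
    F)(z), the exponent to be absorbed at the midpoint is at most the sum of 2 d P_i a_i - (k - 1 -
    O(d)) a_i^2, hence of d^2 P_i^2 / (k - 1 - O(d)). The midpoint function occurs twice in
    Prekopa-Leindler, so each copy carries half of it. For F of mean zero both outer integrals are
    at least I + d^2 S / 2 - O(d^3), where I is the mass and S the second moment, and the d^2 terms
    give (k - 1) S <= sum of the integrals of P_i^2. Cutting rho off outside a box keeps its
    concavity in y, so boundary terms never arise. The price is that F loses its mean zero under the
    truncated weight: the inequality is therefore carried as a variance bound, whose correction
    (mean term squared over mass) tends to 0. The other obstacle is measurability, since phi need
    not be Borel. Integrals are taken against Borel weights equal to the truncated densities off a
    Borel null set that contains their discontinuities. The continuity also yields the L1-continuity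
    of translations by which the averages are removed. *)

#[local] Instance rV_nbhs_filter (R : realType) (n : nat) (x : 'rV[R]_n) :
  ProperFilter (nbhs x) := nbhs_pfilter x.

Section lebesgue_shift.
Context {R : realType}.
Local Open Scope ereal_scope.
Local Notation mu := (@lebesgue_measure R).

Lemma lebesgue_measure_shift (c : R) (A : set (measurableTypeR R)) :
  measurable A -> pushforward mu (fun x : measurableTypeR R => x + c : measurableTypeR R)%R A = mu A.
Proof.
have mf : measurable_fun setT (fun x : measurableTypeR R => x + c : measurableTypeR R)%R.
  by apply: measurable_funD.
move=> mA; apply/esym.
apply: (lebesgue_measure_unique (mu := measure_function_pushforward__canonical__measure_function_Measure mu mf)) => //= _ [[a b]] _ <-.
rewrite /pushforward.
rewrite (_ : _ @^-1` _ = `]a - c, b - c]%classic)%R; last first.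
  by apply/seteqP; split => x /=; rewrite !in_itv/= ltrBlDr lerBrDr.
by rewrite !lebesgue_measure_itv/= !lte_fin ltrD2r -!EFinB opprB addrA subrK.
Qed.

Lemma ge0_integral_shift (c : R) (h : R -> \bar R) :
  measurable_fun setT h -> (forall x, 0 <= h x) ->
  \int[mu]_x h (x + c)%R = \int[mu]_x h x.
Proof.
move=> mh h0.
have mf : measurable_fun setT (fun x : measurableTypeR R => x + c : measurableTypeR R)%R.
  by apply: measurable_funD.
transitivity (\int[pushforward mu (fun x : measurableTypeR R => x + c : measurableTypeR R)%R]_x h x).
  by rewrite (ge0_integral_pushforward mf).
apply: eq_measure_integral => A mA _; exact: lebesgue_measure_shift.
Qed.
End lebesgue_shift.

Section lebesgue_rV_fubini.
Context {R : realType}.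
Local Open Scope ereal_scope.

Lemma measurable_rV_cons_snd n (t : measurableTypeR R) :
  measurable_fun setT (fun x : 'rV[R]_n => rV_cons (t, x)).
Proof.
by apply: (measurableT_comp measurable_rV_cons); exact: pair1_measurable.
Qed.

Section tonelli.
Variables (n : nat) (h : 'rV[R]_n.+1 -> \bar R).
Hypotheses (mh : measurable_fun setT h) (h0 : forall x, 0 <= h x).

Let mhc : measurable_fun setT (h \o rV_cons).
Proof. by apply: measurableT_comp => //; exact: measurable_rV_cons. Qed.

Lemma ge0_integral_rV_cons :
  \int[lebesgue_rV]_x h x =
  \int[lebesgue_measure]_t \int[lebesgue_rV]_x h (rV_cons (t, x)).
Proof.
transitivity (\int[pushforward (lebesgue_measure \x lebesgue_rV_rec R n) rV_cons]_x h x).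
  by [].
rewrite (ge0_integral_pushforward measurable_rV_cons) //.
by rewrite preimage_setT fubini_tonelli1 // => x; exact: h0.
Qed.

Lemma ge0_integral_rV_cons_swap :
  \int[lebesgue_rV]_x h x =
  \int[lebesgue_rV]_x \int[lebesgue_measure]_t h (rV_cons (t, x)).
Proof.
rewrite ge0_integral_rV_cons.
by apply: (@fubini_tonelli _ _ _ _ _ lebesgue_measure (lebesgue_rV_rec R n) (h \o rV_cons)) => // x; exact: h0.
Qed.

Lemma measurable_integral_rV_cons :
  measurable_fun setT (fun t : measurableTypeR R => \int[lebesgue_rV]_x h (rV_cons (t, x))).
Proof.
by apply: (@measurable_fun_fubini_tonelli_F _ _ _ _ _ (lebesgue_rV_rec R n) (h \o rV_cons)) => // x; exact: h0.
Qed.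

End tonelli.

Lemma measurable_rV_shift n (z : 'rV[R]_n) : measurable_fun setT (fun x : 'rV[R]_n => x + z)%R.
Proof.
apply: measurable_fun_rVP => i.
under eq_fun do rewrite mxE.
by apply: measurable_funD => //; exact: measurable_coord.
Qed.

(** Induction on the dimension: Tonelli splits off the first coordinate, which the one-dimensional
    invariance handles, and the slices are shifted by the induction hypothesis. *)
Lemma ge0_integral_rV_shift n (z : 'rV[R]_n) (h : 'rV[R]_n -> \bar R) :
  measurable_fun setT h -> (forall x, 0 <= h x) ->
  \int[lebesgue_rV]_x h (x + z)%R = \int[lebesgue_rV]_x h x.
Proof.
elim: n z h => [|n ih] z h mh h0.
  by apply: eq_integral => x _; rewrite [x](thinmx0) [z]thinmx0 addr0.
have mhz : measurable_fun setT (fun x : 'rV[R]_n.+1 => h (x + z)%R).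
  by apply: (measurableT_comp mh); exact: measurable_rV_shift.
have h0z : forall x : 'rV[R]_n.+1, 0 <= h (x + z)%R by [].
rewrite (ge0_integral_rV_cons mhz h0z) (ge0_integral_rV_cons mh h0).
rewrite -(@ge0_integral_shift R (z ord0 ord0) _ (measurable_integral_rV_cons mh h0)); last first.
  by move=> t; apply: integral_ge0.
apply: eq_integral => t _.
rewrite -[RHS](ih (rV_uncons z).2)//; last first.
  by apply: (measurableT_comp mh); exact: measurable_rV_cons_snd.
apply: eq_integral => x _; congr h.
apply/rowP => i; rewrite mxE.
by case: (unliftP ord0 i) => [j|] ->; rewrite ?rV_cons0 ?rV_consS ?mxE.
Qed.

Lemma lebesgue_rV_shift n (z : 'rV[R]_n) (A : set 'rV[R]_n) : measurable A ->
  lebesgue_rV ((fun x => x + z)%R @^-1` A) = lebesgue_rV A.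
Proof.
move=> mA; rewrite -[A in RHS]setIT -integral_indic// -(ge0_integral_rV_shift z) => [||x]; last 2 first.
- by apply/measurable_EFinP.
- by rewrite lee_fin.
transitivity (\int[lebesgue_rV]_x (\1_((fun x => x + z)%R @^-1` A) x)%:E).
  rewrite integral_indic ?setIT//.
  by rewrite -[X in measurable X]setTI; exact: measurable_rV_shift.
by apply: eq_integral => x _; rewrite !indicE.
Qed.

End lebesgue_rV_fubini.

(** * Continuity of p-concave functions off a null set *)

Section null_sets.
Context d (T : measurableType d) {R : realType}.
Variable mu : {measure set T -> \bar R}.
Local Open Scope ereal_scope.

Lemma measure_countable_bigcup0 (I : countType) (F : I -> set T) :
  (forall i, measurable (F i)) -> (forall i, mu (F i) = 0) ->
  measurable (\bigcup_i F i) /\ mu (\bigcup_i F i) = 0.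
Proof.
move=> mF F0.
pose G n := if unpickle n is Some i then F i else set0.
have FG : \bigcup_i F i = \bigcup_n G n.
  apply/seteqP; split => x [i _ Fx].
    by exists (pickle i) => //; rewrite /G pickleK.
  by move: Fx; rewrite /G; case: unpickle => // j Fx; exists j.
have mG n : measurable (G n) by rewrite /G; case: unpickle.
have mbG : measurable (\bigcup_n G n) by exact: bigcupT_measurable.
rewrite FG; split => //; apply: measure_negligible => //.
apply: negligible_bigcup => n; apply/negligibleP => //.
by rewrite /G; case: unpickle.
Qed.

End null_sets.

Section rV_boxes.
Context {R : realType} {n : nat}.

(** One interval serves all coordinates: this covers both the exhausting boxes [1/(j+1), j+1]^n and
    the cubes [0, eta]^n of the averages. *)
Definition cbox (a b : R) : set 'rV[R]_n := [set x | forall i, a <= x ord0 i <= b].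

Lemma closed_cbox a b : closed (cbox a b).
Proof.
rewrite (_ : cbox a b = \bigcap_(i in [set: 'I_n])
    ((fun x : 'rV[R]_n => x ord0 i) @^-1` `[a, b]%classic)); last first.
  apply/seteqP; split => x /=.
    by move=> h i _; rewrite /= in_itv/=; exact: h.
  by move=> h i; have := h i Logic.I; rewrite /= in_itv.
apply: closed_bigI => i _; apply: closed_comp; last exact: interval_closed.
by move=> x _; exact: coord_continuous.
Qed.

Lemma closed_measurable_rV (A : set 'rV[R]_n) : closed A -> measurable A.
Proof.
by move=> cA; rewrite -[A]setCK; apply: measurableC; apply: open_measurable_rV; exact: closed_openC.
Qed.

Lemma measurable_cbox a b : measurable (cbox a b).
Proof. by apply: closed_measurable_rV; exact: closed_cbox. Qed.

Lemma lebesgue_rV_cbox a b : lebesgue_rV (cbox a b) = (\prod_(i < n) lebesgue_measure `[a, b]%classic)%E.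
Proof.
by rewrite -(@lebesgue_rV_box R n (fun=> `[a, b]%classic)).
Qed.

Lemma lebesgue_rV_cbox_fin a b : lebesgue_rV (cbox a b) \is a fin_num.
Proof.
rewrite lebesgue_rV_cbox; apply: prode_fin_num => i _.
by rewrite lebesgue_measure_itv; case: ifP.
Qed.

Lemma lebesgue_rV_cbox_lty a b : (lebesgue_rV (cbox a b) < +oo)%E.
Proof. by rewrite ltey_eq lebesgue_rV_cbox_fin. Qed.

End rV_boxes.

(** * Faces of a set in the 2^n coordinate directions *)

Section faces.
Context {R : realType} {n : nat}.
Implicit Types (s : {ffun 'I_n -> bool}) (D : set 'rV[R]_n).

(** The sign vector [s] selects one of the 2^n open coordinate cones with apex [q], and [c] lies in
    that cone. *)
Definition beyond s (q c : 'rV[R]_n) :=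
  forall i, if s i then q ord0 i < c ord0 i else c ord0 i < q ord0 i.

Lemma near_beyondl s q c : beyond s q c -> \forall q' \near q, beyond s q' c.
Proof.
move=> qc.
apply: (@filter_forall _ 'I_n (fun i (q' : 'rV[R]_n) =>
  is_true (if s i then q' ord0 i < c ord0 i else c ord0 i < q' ord0 i)) (nbhs q) (nbhs_filter q)) => i; have := qc i; case: (s i) => qci.
- by apply: (@coord_continuous _ _ _ ord0 i q [set y | y < c ord0 i]); exact: lt_nbhsl.
- by apply: (@coord_continuous _ _ _ ord0 i q [set y | c ord0 i < y]); exact: lt_nbhsr.
Qed.

Lemma near_beyondr s q c : beyond s q c -> \forall c' \near c, beyond s q c'.
Proof.
move=> qc.
apply: (@filter_forall _ 'I_n (fun i (c' : 'rV[R]_n) =>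
  is_true (if s i then q ord0 i < c' ord0 i else c' ord0 i < q ord0 i)) (nbhs c) (nbhs_filter c)) => i; have := qc i; case: (s i) => qci.
- by apply: (@coord_continuous _ _ _ ord0 i c [set y | q ord0 i < y]); exact: lt_nbhsr.
- by apply: (@coord_continuous _ _ _ ord0 i c [set y | y < q ord0 i]); exact: lt_nbhsl.
Qed.

(** For a set that is convex after a coordinatewise increasing change of variables, a closure point
    that lies on no face is interior. So the 2^n faces cover the boundary. *)
Definition face s D := closure D `&` [set q | forall c, D c -> ~ beyond s q c].

Lemma closed_face s D : closed (face s D).
Proof.
apply: closedI; first exact: closed_closure.
rewrite -[X in closed X]setCK; apply: open_closedC; rewrite openE => q /= /existsNP[c].
move=> /not_implyP[Dc /contrapT qc].
apply: filterS (near_beyondl qc) => q' q'c /(_ _ Dc); exact.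
Qed.

Let dir s : 'rV[R]_n := \row_i (if s i then 1 else -1).

(** If t < t', then [q] lies strictly beyond [q'] in direction [s]. As [q] is in the closure of [D],
    some point of [D] is beyond [q'] as well, which is forbidden for a face point. *)
Lemma face_trans s D (q q' : 'rV[R]_n) (t t' : R) :
  face s D q -> face s D q' -> q + t *: dir s = q' + t' *: dir s -> t' <= t.
Proof.
move=> [Dq _] [_ nq'] qq'; rewrite leNgt; apply/negP => tt'.
have q'q : beyond s q' q.
  move=> i; have /rowP/(_ i) := qq'; rewrite !mxE; case: (s i); lra.
by have [c [Dc]] := Dq _ (near_beyondr q'q); exact: nq'.
Qed.

(* The translates of a face along the diagonal direction it is exposed in are
   pairwise disjoint, so infinitely many of them fit into a bounded box. *)
Lemma lebesgue_rV_face s D : lebesgue_rV (face s D) = 0%E.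
Proof.
pose N m := face s D `&` cbox (- m%:R) m%:R.
have mN m : measurable (N m).
  by apply: measurableI; [by apply: closed_measurable_rV; exact: closed_face|exact: measurable_cbox].
have -> : face s D = \bigcup_m N m.
  apply/seteqP; split => [x Dx|x [m _ []]//].
  have [m xm] : exists m, forall i, `|x ord0 i| <= m%:R.
    exists (\max_(i < n) Num.bound `|x ord0 i|)%N => i.
    apply: (@le_trans _ _ (Num.bound `|x ord0 i|)%:R); first by apply/ltW; exact: archi_boundP.
    by rewrite ler_nat; apply: (@leq_bigmax _ (fun i => Num.bound `|x ord0 i|)).
  by exists m => //; split=> // i; rewrite -ler_norml.
suff N0 m : lebesgue_rV (N m) = 0%E by have [] := measure_countable_bigcup0 mN N0.
(* The parameters are distinct and at most 1, so all the translates stay in the box enlarged by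
   1. *)
pose t (j : nat) : R := j.+1%:R^-1.
have t01 j : 0 <= t j <= 1 by rewrite /t invr_ge0 ler0n invf_le1 ?ler1n.
pose A (j : nat) := (fun x : 'rV[R]_n => x - t j *: dir s) @^-1` N m.
have mA j : measurable (A j).
  by rewrite -[X in measurable X]setTI; exact: measurable_rV_shift.
have trA : trivIset setT A.
  apply/trivIsetP => i j _ _ ij; apply/seteqP; split => // x [/= [Ni _] [Nj _]].
  have tij : t i = t j.
    apply/eqP; rewrite eq_le.
    rewrite (face_trans Nj Ni) ?subrK//=.
    by rewrite (face_trans Ni Nj) ?subrK//=.
  by move/eqP: ij; apply; move/invr_inj/eqP: tij; rewrite eqr_nat eqSS => /eqP.
have AB : \bigcup_j A j `<=` cbox (- (m%:R + 1)) (m%:R + 1).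
  move=> x [j _ [_ /= xm]] i; have := xm i; have := t01 j; rewrite !mxE; case: (s i); lra.
have Nfin : lebesgue_rV (N m) \is a fin_num.
  rewrite ge0_fin_numE//; apply: le_lt_trans (lebesgue_rV_cbox_lty (- m%:R) m%:R).
  by apply: le_measure; rewrite ?inE//; [exact: measurable_cbox|exact: subIsetr].
have sumN J : (J%:R * fine (lebesgue_rV (N m)) <= fine (lebesgue_rV (cbox (- (m%:R + 1)) (m%:R + 1) : set 'rV[R]_n))).
  rewrite -lee_fin fineK ?lebesgue_rV_cbox_fin//.
  apply: (@le_trans _ _ (lebesgue_rV (\big[setU/set0]_(j < J) A j))); last first.
    apply: le_measure; rewrite ?inE; [exact: bigsetU_measurable|exact: measurable_cbox|].
    by apply: subset_trans AB; rewrite -bigcup_mkord => x [j _ Aj]; exists j.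
  rewrite measure_bigsetU_ord//; last first.
    by move=> i j _ _ Aij; apply/val_inj; exact: (trA i j).
  rewrite (eq_bigr (fun=> lebesgue_rV (N m))); last by move=> j _; exact: lebesgue_rV_shift.
  by rewrite -(fineK Nfin) sumEFin sumr_const card_ord mulr_natl.
apply/eqP; rewrite -(fineK Nfin) eqe; apply/eqP.
apply: contrapT => /eqP N0.
have Npos : 0 < fine (lebesgue_rV (N m)) by rewrite lt_neqAle eq_sym N0 fine_ge0.
set B := fine (lebesgue_rV (cbox _ _)) in sumN.
have := archi_boundP (_ : 0 <= B / fine (lebesgue_rV (N m))).
rewrite divr_ge0 ?fine_ge0// => /(_ isT).
by rewrite ltr_pdivrMr// ltNge sumN.
Qed.

End faces.

Section convex_interior.
Context {R : realType} {n : nat}.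

Lemma lt_conv (a x y t : R) : a < x -> a < y -> 0 <= t <= 1 -> a < t * x + (1 - t) * y.
Proof.
move=> ax ay /andP[t0 t1]; have [xy|/ltW yx] := leP x y.
  by apply: (lt_le_trans ax); nra.
by apply: (lt_le_trans ay); nra.
Qed.

Lemma conv_lt (a x y t : R) : x < a -> y < a -> 0 <= t <= 1 -> t * x + (1 - t) * y < a.
Proof.
move=> xa ya t01; rewrite -ltrN2 opprD -!mulrN.
by apply: lt_conv; rewrite ?ltrN2.
Qed.

Definition convex_set (D : set 'rV[R]_n) := forall x y (t : R),
  D x -> D y -> 0 <= t <= 1 -> D (t *: x + (1 - t) *: y).

(* A point strictly inside the coordinatewise hull of D in all 2^n directions is
   reached by correcting the coordinates one after the other. *)
Lemma convex_set_beyond (D : set 'rV[R]_n) q : convex_set D ->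
  (forall s, exists2 c, D c & beyond s q c) -> D q.
Proof.
move=> cD Dq.
have H (j : nat) : (j <= n)%N -> forall s : {ffun 'I_n -> bool}, exists2 c, D c &
    forall i : 'I_n, if (i < j)%N then c ord0 i = q ord0 i else
      if s i then q ord0 i < c ord0 i else c ord0 i < q ord0 i.
  elim: j => [|j ih] jn s; first by have [c Dc cq] := Dq s; exists c.
  pose o := Ordinal jn.
  (* Two points on opposite sides of [q] in coordinate [o]: their convex combination with weight [t]
     hits [q] there, while the coordinates already corrected and the remaining strict inequalities
     survive. *)
  have [cp Dp Hp] := ih (ltnW jn) [ffun i => if i == o then true else s i].
  have [cm Dm Hm] := ih (ltnW jn) [ffun i => if i == o then false else s i].
  have := Hp o; have := Hm o; rewrite /= ltnn !ffunE eqxx => mq qp.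
  pose t := (q ord0 o - cm ord0 o) / (cp ord0 o - cm ord0 o).
  have d0 : 0 < cp ord0 o - cm ord0 o by lra.
  have t01 : 0 <= t <= 1.
    by apply/andP; split; [apply: divr_ge0; lra|rewrite ler_pdivrMr//; lra].
  exists (t *: cp + (1 - t) *: cm); first exact: cD.
  move=> i; rewrite !mxE ltnS leq_eqVlt.
  have [io|io] := eqVneq i o.
    rewrite io /= eqxx /=.
    have tE : t * (cp ord0 o - cm ord0 o) = q ord0 o - cm ord0 o.
      by rewrite /t divfK// gt_eqF.
    by rewrite mulrBl mul1r addrCA -mulrBr tE addrC subrK.
  have -> : (nat_of_ord i == j) = false by apply: contra_neqF io => /eqP ij; exact: val_inj.
  move: (Hp i) (Hm i); rewrite !ffunE (negbTE io) /=.
  case: ifP => _; first by move=> -> ->; ring.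
  by case: (s i) => h1 h2; [exact: lt_conv|exact: conv_lt].
have [c Dc cq] := H n (leqnn n) [ffun=> true].
rewrite (_ : q = c)//; apply/rowP => i.
by have := cq i; rewrite ltn_ord.
Qed.

End convex_interior.

(** * Discontinuities of functions that are quasi-concave in the roots x_i^(1/k) *)

Section power_convex.
Context {R : realType} {n : nat}.
Variable k : nat.
Hypothesis k0 : (0 < k)%N.

Definition vpow (y : 'rV[R]_n) : 'rV[R]_n := \row_i (y ord0 i ^+ k).

Definition vroot (x : 'rV[R]_n) : 'rV[R]_n := \row_i (x ord0 i `^ k%:R^-1).

Lemma vrootK x : orthant R n x -> vpow (vroot x) = x.
Proof.
move=> x0; apply/rowP => i; rewrite !mxE -powR_mulrn ?powR_ge0// -powRrM.
by rewrite mulVf ?powRr1 ?ltW ?x0// pnatr_eq0 -lt0n.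
Qed.

Lemma vroot_orthant x : orthant R n x -> orthant R n (vroot x).
Proof. by move=> x0 i; rewrite mxE powR_gt0. Qed.

Lemma vpow_orthant y : orthant R n y -> orthant R n (vpow y).
Proof. by move=> y0 i; rewrite mxE exprn_gt0. Qed.

Lemma orthant_convex (y y' : 'rV[R]_n) (t : R) : orthant R n y -> orthant R n y' ->
  0 <= t <= 1 -> orthant R n (t *: y + (1 - t) *: y').
Proof. by move=> y0 y'0 t01 i; rewrite !mxE; have := y0 i; have := y'0 i; nra. Qed.

(** Superlevel sets in the orthant are convex in the variable y with x = y^k. *)
Definition quasi_pconcave (rho : 'rV[R]_n -> R) := forall y y' (t : R),
  orthant R n y -> orthant R n y' -> 0 <= t <= 1 ->
  Num.min (rho (vpow y)) (rho (vpow y')) <= rho (vpow (t *: y + (1 - t) *: y')).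

(** The faces live in the variable x, where Lebesgue measure is taken, although convexity holds in
    y: [beyond] only compares coordinates, so the increasing root map preserves it. Rational levels
    keep the union countable. *)
Definition bad_set (rho : 'rV[R]_n -> R) : set 'rV[R]_n :=
  \bigcup_(p : rat * {ffun 'I_n -> bool})
    face p.2 [set x | orthant R n x /\ ratr p.1 < rho x].

Lemma measurable_bad_set rho : measurable (bad_set rho).
Proof.
by apply: (measure_countable_bigcup0 (mu := lebesgue_rV) _ _).1 => i;
  [apply: closed_measurable_rV; exact: closed_face|exact: lebesgue_rV_face].
Qed.

Lemma lebesgue_bad_set rho : lebesgue_rV (bad_set rho) = 0%E.
Proof.
by apply: (measure_countable_bigcup0 (mu := lebesgue_rV) _ _).2 => i;
  [apply: closed_measurable_rV; exact: closed_face|exact: lebesgue_rV_face].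
Qed.

(** Off the faces, each of the 2^n cones at [q] contains a point of the superlevel set. These
    finitely many open conditions persist for [q'] near [q], and [convex_set_beyond], applied to the
    roots, puts [q'] in the set. *)
Lemma pconcave_interior rho (r : rat) q : quasi_pconcave rho -> ~ bad_set rho q ->
  closure [set x | orthant R n x /\ ratr r < rho x] q ->
  \forall q' \near q, orthant R n q' /\ ratr r < rho q'.
Proof.
move=> qc nbq clq.
have Dq (s : {ffun 'I_n -> bool}) : exists c, (orthant R n c /\ ratr r < rho c) /\ beyond s q c.
  apply: contrapT => /forallNP nc; apply: nbq; exists (r, s) => //=.
  by split => //= c Dc qb; apply: (nc c).
pose c s := projT1 (cid (Dq s)).
have cP s : (orthant R n (c s) /\ ratr r < rho (c s)) /\ beyond s q (c s) by exact: projT2 (cid (Dq s)).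
have : \forall q' \near q, forall s, beyond s q' (c s).
  apply: (@filter_forall _ _ (fun s (q' : 'rV[R]_n) => beyond s q' (c s)) (nbhs q) (nbhs_filter q)) => s.
  exact: near_beyondl (cP s).2.
apply: filterS => q' q'c.
(* The cone of the constant sign [false] supplies a point of the orthant lying below [q'] in every
   coordinate. *)
have oq' : orthant R n q'.
  move=> i; have [[oc _] _] := cP [ffun=> false].
  by have := q'c [ffun=> false] i; rewrite ffunE; apply: lt_trans; exact: oc.
split => //; rewrite -(vrootK oq').
apply: (@convex_set_beyond _ _ [set y | orthant R n y /\ ratr r < rho (vpow y)] _ _ _).2.
  move=> y y' t [oy ry] [oy' ry'] t01; split; first exact: orthant_convex.
  by apply: lt_le_trans (qc _ _ _ oy oy' t01); rewrite lt_min ry.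
move=> s; exists (vroot (c s)).
  have [[oc rc] _] := cP s.
  by split; [exact: vroot_orthant|rewrite vrootK].
move=> i; have := q'c s i; have [[oc _] _] := cP s; rewrite !mxE.
have kp : 0 < k%:R^-1 :> R by rewrite invr_gt0 ltr0n.
by case: (s i) => h; apply: gt0_ltr_powR => //; rewrite ?nnegrE ltW.
Qed.

(** Take a rational level r in ]rho q, rho q + e[. Then [q] is not in the closure of {rho > r},
    since otherwise it would be interior and r < rho q; this bounds [rho] from above near [q]. A
    level in ]rho q - e, rho q[ gives the lower bound directly. *)
Lemma pconcave_continuous rho : quasi_pconcave rho -> (forall x, 0 <= rho x) ->
  (forall x, ~ orthant R n x -> rho x = 0) ->
  forall q, ~ bad_set rho q -> {for q, continuous rho}.
Proof.
move=> qc rho0 rhoN q nbq; apply/(@cvgrPdist_lt _ _ _ _ (nbhs_filter q)) => e e0.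
have up : \forall x \near q, rho x < rho q + e.
  have qe : rho q < rho q + e by rewrite ltrDl.
  have [r] := rat_in_itvoo qe.
  rewrite in_itv/= => /andP[qr re].
  have [clq|] := pselect (closure [set x | orthant R n x /\ ratr r < rho x] q).
    have [_] := nbhs_singleton (pconcave_interior qc nbq clq).
    by move/(lt_trans qr); rewrite ltxx.
  move=> /existsNP[B] /not_implyP[qB] /set0P/negP/negPn/eqP B0.
  apply: filterS qB => x Bx; apply: le_lt_trans re; rewrite leNgt; apply/negP => rx.
  have [ox|/rhoN x0] := pselect (orthant R n x).
    by have : ([set x | orthant R n x /\ ratr r < rho x] `&` B) x by []; rewrite B0.
  by move: rx; rewrite x0 ltNge (ltW (le_lt_trans (rho0 q) qr)).
have dn : \forall x \near q, rho q - e < rho x.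
  have [qe|qe] := ltP (rho q - e) 0.
    by near=> x; exact: lt_le_trans (rho0 x).
  have oq : orthant R n q by apply: contrapT => /rhoN q0; move: qe; rewrite q0; lra.
  have eq : rho q - e < rho q by rewrite ltrBlDr ltrDl.
  have [r] := rat_in_itvoo eq.
  rewrite in_itv/= => /andP[er rq].
  have : closure [set x | orthant R n x /\ ratr r < rho x] q by apply: subset_closure.
  by move/(pconcave_interior qc nbq); apply: filterS => x [_]; exact: lt_trans.
near=> x; rewrite ltr_distlC; apply/andP; split; near: x; first exact: dn.
exact: up.
Unshelve. all: by end_near. Qed.

End power_convex.

(** * The change of variables x = y^k and the Prekopa-Leindler inequality *)

Section density.
Context d (T : measurableType d) {R : realType}.
Variable mu : {measure set T -> \bar R}.
Local Open Scope ereal_scope.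

Import HBNNSimple.

Lemma ge0_integral_nnsfunM (nu : {measure set T -> \bar R}) (D : set T) (h : {nnsfun T >-> R})
    (w : T -> \bar R) :
  measurable D -> measurable_fun D w -> (forall x, 0 <= w x) ->
  \int[nu]_(x in D) ((h x)%:E * w x) =
  \sum_(y \in range h) (y%:E * \int[nu]_(x in D `&` h @^-1` [set y]) w x).
Proof.
move=> mD mw w0.
have mwh y : measurable_fun D (w \_ (h @^-1` [set y])).
  exact/(measurable_restrict _ _ _).1/(measurable_funS mD).
have wh0 y x : 0 <= (w \_ (h @^-1` [set y])) x by rewrite patchE; case: ifP.
have y0 y : range h y -> (0 <= y)%R by move=> [t _ <-].
(* The maximum with 0 makes the terms nonnegative for every [y], as the exchange of sum and integral
   requires; on the range of [h] it changes nothing. *)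
transitivity (\int[nu]_(x in D)
    \sum_(y \in range h) (Order.max y 0%R)%:E * (w \_ (h @^-1` [set y])) x).
  apply: eq_integral => x _.
  rewrite (fsbigD1 (h x)) //=; last by exists x.
  rewrite (max_idPl _) // patchE mem_set // fsbig1 ?adde0 // => y [_ /= yx].
  by rewrite patchE memNset ?mule0 //= => /esym.
rewrite ge0_integral_fsum //; last 2 first.
- by move=> y; apply: measurable_funeM.
- by move=> y x _; rewrite mule_ge0 // lee_fin le_max lexx orbT.
apply: eq_fsbigr => y; rewrite inE => /y0 yge0.
by rewrite (max_idPl yge0) ge0_integralZl // integral_mkcondr.
Qed.

(** [nu] is compared with the density only on measurable subsets of [D], which settles simple
    functions. Both sides then pass to the monotone limit by [h_cvg], used with weight [rho] under
    [mu] and weight 1 under [nu]. *)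
Lemma ge0_integral_density (nu : {measure set T -> \bar R}) (D : set T) (rho : T -> R)
    (F : T -> \bar R) :
  measurable D -> measurable_fun D rho -> (forall x, 0 <= rho x)%R ->
  (forall A, measurable A -> A `<=` D -> nu A = \int[mu]_(x in A) (rho x)%:E) ->
  measurable_fun D F -> (forall x, 0 <= F x) ->
  \int[nu]_(x in D) F x = \int[mu]_(x in D) (F x * (rho x)%:E).
Proof.
move=> mD mrho rho0 nuE mF F0.
have mErho : measurable_fun D (EFin \o rho) by exact/measurable_EFinP.
have rhoE0 x : 0 <= (rho x)%:E by rewrite lee_fin.
pose h := nnsfun_approx mD mF.
have h_cvg (m : {measure set T -> \bar R}) (w : T -> R) :
    measurable_fun D (EFin \o w) -> (forall x, 0 <= w x)%R ->
    \int[m]_(x in D) ((h n x)%:E * (w x)%:E) @[n --> \oo] -->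
    \int[m]_(x in D) (F x * (w x)%:E).
  move=> mw w0.
  have hw_cvg x : D x -> (h n x)%:E * (w x)%:E @[n --> \oo] --> F x * (w x)%:E.
    by move=> Dx; apply: cvgeZr => //; exact: cvg_nnsfun_approx.
  rewrite (@eq_integral _ _ _ m D (fun x => limn (fun n => (h n x)%:E * (w x)%:E))); last first.
    by move=> x /[!inE] /hw_cvg /cvg_lim ->.
  apply: cvg_monotone_convergence => //.
  - move=> n; apply: emeasurable_funM => //; apply/measurable_EFinP.
    exact: measurable_funTS.
  - by move=> n x _; rewrite mule_ge0 // lee_fin.
  - move=> x _ i j ij; rewrite lee_wpmul2r ?lee_fin //.
    exact/lefP/nd_nnsfun_approx.
have hE n : \int[nu]_(x in D) ((h n x)%:E * 1) = \int[mu]_(x in D) ((h n x)%:E * (rho x)%:E).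
  rewrite !ge0_integral_nnsfunM//.
  apply: eq_fsbigr => y _; congr (_ * _).
  have mDy : measurable (D `&` h n @^-1` [set y]) by exact: measurableI.
  by rewrite -nuE // integral_cst // mul1e.
rewrite -(cvg_lim _ (h_cvg mu rho mErho rho0)) // -(funext hE).
have -> : \int[nu]_(x in D) F x = \int[nu]_(x in D) (F x * 1).
  by apply: eq_integral => x _; rewrite mule1.
apply/esym/cvg_lim => //; apply: (h_cvg nu (cst 1%R)) => //.
exact: (measurable_cst (1 : \bar R)).
Qed.

Variable rho : T -> R.
Hypotheses (mrho : measurable_fun setT rho) (rho0 : forall x, (0 <= rho x)%R).

(** The two proofs are arguments so that a measure structure can be attached to this head symbol. *)
Definition density_measure of measurable_fun setT rho & (forall x, (0 <= rho x)%R) :=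
  fun A : set T => \int[mu]_(x in A) (rho x)%:E.

Local Notation dm := (density_measure mrho rho0).

Let dm0 : dm set0 = 0. Proof. exact: integral_set0. Qed.

Let dm_ge0 A : 0 <= dm A.
Proof. by apply: integral_ge0 => x _; rewrite lee_fin. Qed.

Let dm_sigma_additive : semi_sigma_additive dm.
Proof.
by apply: semi_sigma_additive_nng_induced; [exact/measurable_EFinP|move=> x; rewrite lee_fin].
Qed.

HB.instance Definition _ := isMeasure.Build _ _ _ dm dm0 dm_ge0 dm_sigma_additive.

End density.

(** * The substitution x = y^k on the half-line *)

Section power_substitution.
Context {R : realType}.
Variable k : nat.
Hypothesis k0 : (0 < k)%N.
Local Open Scope ereal_scope.
Local Notation leb := (@lebesgue_measure R).

(** Extended by 0 to the left, so that the measure it defines is carried by the half-line on which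
    y^k is injective. *)
Definition pow_jac (y : R) : R := if (0 < y)%R then (k%:R * y ^+ k.-1)%R else 0%R.

Lemma pow_jac_ge0 y : (0 <= pow_jac y)%R.
Proof. by rewrite /pow_jac; case: ifP => // y0; rewrite mulr_ge0// exprn_ge0// ltW. Qed.

Lemma measurable_pow_jac : measurable_fun setT pow_jac.
Proof.
apply: measurable_fun_if => //.
- exact: measurable_fun_ltr.
- by apply: measurable_funTS; apply: measurable_funM => //; exact: exprn_measurable.
Qed.

Let T (y : measurableTypeR R) : measurableTypeR R := (y ^+ k)%R.

Let mT : measurable_fun setT T.
Proof. exact: exprn_measurable. Qed.

Lemma integral_pow_jac (a b : R) : (0 <= a)%R -> (a < b)%R ->
  \int[leb]_(y in `]a, b]) (pow_jac y)%:E = (b ^+ k - a ^+ k)%:E.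
Proof.
move=> a0 ab.
transitivity (\int[leb]_(y in `]a, b]) (k%:R * y ^+ k.-1)%:E).
  apply: eq_integral => y; rewrite inE/= in_itv/= => /andP[ay _].
  by rewrite /pow_jac (le_lt_trans a0 ay).
have cf : continuous (fun y : R => k%:R * y ^+ k.-1)%R.
  by move=> y; apply: cvgM; [exact: cvg_cst|exact: exprn_continuous].
rewrite integral_itv_obnd_cbnd; last first.
  by apply/measurable_EFinP; apply: measurable_funTS; exact: continuous_measurable_fun.
rewrite (@continuous_FTC2 _ _ (fun y : R => y ^+ k)%R)//.
- exact: continuous_subspaceT.
- split; first by move=> y _; exact: exprn_derivable.
  + by apply: cvg_at_right_filter; exact: exprn_continuous.
  + by apply: cvg_at_left_filter; exact: exprn_continuous.
- by move=> y _; rewrite derive1E exp_derive /GRing.scale/= mulr1.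
Qed.

(** The image of the density [pow_jac] under y^k ([m1]) only sees the positive half-line. Adding
    Lebesgue measure of the nonpositive half ([m2]) gives a measure with the right value on every
    ]a, b], so that uniqueness of Lebesgue measure applies. *)
Lemma ge0_integral_pow (u : R -> \bar R) : measurable_fun setT u ->
  (forall x, 0 <= u x) -> (forall x, (x <= 0)%R -> u x = 0) ->
  \int[leb]_x u x = \int[leb]_y (u (y ^+ k)%R * (pow_jac y)%:E).
Proof.
move=> mu0 u0 uN.
pose dlt := density_measure leb measurable_pow_jac pow_jac_ge0.
pose m1 : {measure set (measurableTypeR R) -> \bar R} :=
  measure_function_pushforward__canonical__measure_function_Measure dlt mT.
have mN : measurable (`]-oo, 0%R]%classic : set (measurableTypeR R)) by exact: measurable_itv.
pose m2 : {measure set (measurableTypeR R) -> \bar R} := mrestr leb mN.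
have m1E A : m1 A = \int[leb]_(y in [set y | A (y ^+ k)%R]) (pow_jac y)%:E by [].
have rootK (x : R) : (0 <= x)%R -> ((x `^ k%:R^-1) ^+ k)%R = x.
  move=> x0; rewrite -powR_mulrn ?powR_ge0// -powRrM.
  by rewrite mulVf ?powRr1// pnatr_eq0 -lt0n.
have m1_oc (a b : R) : (0 <= a)%R -> (a < b)%R -> m1 `]a, b]%classic = (b - a)%:E.
  move=> a0 ab; rewrite m1E.
  have b0 : (0 <= b)%R by rewrite (le_trans a0) ?ltW.
  rewrite -{2}(rootK _ a0) -{2}(rootK _ b0) -integral_pow_jac ?powR_ge0//; last first.
    by apply: gt0_ltr_powR; rewrite ?nnegrE// invr_gt0 ltr0n.
  rewrite integral_mkcond [RHS]integral_mkcond; apply: eq_integral => y _.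
  rewrite !patchE; have [y0|y0] := ltP 0%R y; last first.
    by rewrite /pow_jac ltNge y0 /=; do 2 case: ifP.
  congr (if _ then _ else _); apply/idP/idP; rewrite !inE/= !in_itv/= => /andP[ay yb];
    apply/andP; split.
  - by rewrite -(ltr_pXn2r k0) ?nnegrE ?powR_ge0 ?(ltW y0)// rootK.
  - by rewrite -(ler_pXn2r k0) ?nnegrE ?powR_ge0 ?(ltW y0)// rootK.
  - by rewrite -(rootK _ a0) ltr_pXn2r ?nnegrE ?powR_ge0 ?(ltW y0).
  - by rewrite -(rootK _ b0) ler_pXn2r ?nnegrE ?powR_ge0 ?(ltW y0).
have m1_neg (A : set (measurableTypeR R)) : measurable A -> A `<=` `]-oo, 0%R]%classic -> m1 A = 0.
  move=> mA A0; rewrite m1E integral0_eq// => y /= /A0 /=; rewrite in_itv/= => yk.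
  by rewrite /pow_jac; case: ifP => // y0; move: yk; rewrite leNgt exprn_gt0.
have m2E A : m2 A = leb (A `&` `]-oo, 0%R]%classic) by [].
have mE A : measure_add m1 m2 A = m1 A + m2 A by exact: measure_addE.
have lebE : forall A, measurable A -> leb A = measure_add m1 m2 A.
  apply: (@lebesgue_measure_unique R (measure_add m1 m2)) => _ [[a b] _ <-].
  apply: (etrans _ (esym (mE _))); rewrite m2E [(a, b).1]/= [(a, b).2]/=.
  have [ba|ab] := leP b a.
    by rewrite set_itv_ge ?bnd_simp -?leNgt// set0I !measure0 adde0.
  have [b0|b0] := leP b 0%R.
    rewrite m1_neg//; last by move=> x /=; rewrite !in_itv/= => /andP[_ /le_trans]; exact.
    rewrite add0e setIidl//.
    by move=> x /=; rewrite !in_itv/= => /andP[_ /le_trans]; exact.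
  have [a0|a0] := leP 0%R a.
    rewrite m1_oc// (_ : _ `&` _ = set0); last first.
      by apply/seteqP; split => x //= []; rewrite !in_itv/=; lra.
    by rewrite measure0 adde0 lebesgue_measure_itv/= lte_fin ab -EFinB.
  have -> : `]a, b]%classic = `]a, 0%R] `|` `]0%R, b].
    apply/seteqP; split => x /=; rewrite !in_itv/=; last by lra.
    by have [] := leP x 0%R; [left|right]; lra.
  have disj : `]a, 0%R]%classic `&` `]0%R, b]%classic = set0 :> set (measurableTypeR R).
    by apply/seteqP; split => x //= []; rewrite !in_itv/=; lra.
  have -> : leb (`]a, 0%R] `|` `]0%R, b]) = leb `]a, 0%R]%classic + leb `]0%R, b]%classic.
    by rewrite measureU.
  have -> : m1 (`]a, 0%R] `|` `]0%R, b]) = m1 `]a, 0%R]%classic + m1 `]0%R, b]%classic.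
    by rewrite measureU.
  rewrite setIUl.
  rewrite [X in X `|` _]setIidl; last by move=> x /=; rewrite !in_itv/= => /andP[].
  rewrite [X in _ `|` X](_ : _ = set0) ?setU0; last first.
    by apply/seteqP; split => x //= []; rewrite !in_itv/=; lra.
  rewrite m1_neg//; last by move=> x /=; rewrite !in_itv/= => /andP[].
  by rewrite m1_oc// add0e addeC subr0; congr (_ + _); rewrite lebesgue_measure_itv/= lte_fin b0 oppr0 adde0.
pose D : set (measurableTypeR R) := `]0%R, +oo[%classic.
have mD : measurable D by exact: measurable_itv.
transitivity (\int[leb]_(x in D) u x).
  rewrite [RHS]integral_mkcond; apply: eq_integral => x _; rewrite patchE.
  by case: ifPn => //; rewrite notin_setE /D/= in_itv/= andbT => /negP; rewrite -leNgt => /uN.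
have lebm1 A : measurable A -> A `<=` D -> leb A = m1 A.
  move=> mA AD; apply: (etrans (lebE _ mA)); rewrite mE m2E.
  rewrite (_ : _ `&` _ = set0) ?measure0 ?adde0//.
  by apply/seteqP; split => x //= [/AD]; rewrite /D/= !in_itv/=; lra.
transitivity (\int[m1]_(x in D) u x).
  by apply: eq_measure_integral => A mA AD; exact: lebm1.
rewrite /m1 ge0_integral_pushforward//; last exact: measurable_funTS.
have mTD : measurable (T @^-1` D) by rewrite -[X in measurable X]setTI; exact: mT.
rewrite (@ge0_integral_density _ _ _ leb dlt _ pow_jac)//; last 4 first.
- by apply: measurable_funTS; exact: measurable_pow_jac.
- exact: pow_jac_ge0.
- by apply: measurable_funTS; exact: measurableT_comp.
- by move=> y; exact: u0.
rewrite integral_mkcond; apply: eq_integral => y _; rewrite patchE.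
case: ifPn => //; rewrite notin_setE /D/= in_itv/= andbT => /negP; rewrite -leNgt => /uN.
by rewrite /T => ->; rewrite mul0e.
Qed.

End power_substitution.

(** * The one-dimensional Brunn-Minkowski inequality *)

Section brunn_minkowski_1D.
Context {R : realType}.
Local Open Scope ereal_scope.
Local Notation leb := (@lebesgue_measure R).

Lemma lebesgue_measure_double (C : set (measurableTypeR R)) : measurable C ->
  leb [set z | C (z / 2)%R] = 2%:E * leb C.
Proof.
move=> mC.
pose T (z : measurableTypeR R) : measurableTypeR R := (z / 2)%R.
have mT : measurable_fun setT T by exact: measurable_funM.
have h2 : (0 <= 2^-1 :> R)%R by rewrite invr_ge0.
pose m1 : {measure set (measurableTypeR R) -> \bar R} :=
  mscale (NngNum h2) (measure_function_pushforward__canonical__measure_function_Measure leb mT).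
suff -> : leb C = m1 C.
  rewrite /m1/=/mscale/= muleA -EFinM divff//= mul1e//.
apply: lebesgue_measure_unique => //= _ [[a b] _ <-].
rewrite /m1/= /mscale/= /pushforward.
rewrite (_ : T @^-1` _ = `]2 * a, 2 * b]%classic)%R; last first.
  by apply/seteqP; split => x /=; rewrite !in_itv/= /T; lra.
rewrite !lebesgue_measure_itv/= !lte_fin ltr_pM2l//.
case: ifP => ab; last by rewrite mule0.
by rewrite -!EFinB -EFinM; congr (_%:E); lra.
Qed.

Let pre_shift (c : R) (A : set (measurableTypeR R)) : measurable A ->
  measurable [set z : measurableTypeR R | A (z + c)%R] /\ leb [set z | A (z + c)%R] = leb A.
Proof.
move=> mA; split; last exact: lebesgue_measure_shift.
have mf : measurable_fun setT (fun x : measurableTypeR R => x + c : measurableTypeR R)%R.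
  by apply: measurable_funD.
by rewrite -[X in measurable X]setTI; exact: mf.
Qed.

(* Translates of A and B meeting at a single point sit inside 2C. *)
Lemma brunn_minkowski_compact (A B C : set (measurableTypeR R)) :
  A !=set0 -> B !=set0 -> compact A -> compact B -> measurable C ->
  (forall a b, A a -> B b -> C ((a + b) / 2)%R) -> leb A + leb B <= 2%:E * leb C.
Proof.
move=> A0 B0 cA cB mC ABC.
have mA : measurable A by apply: closed_measurable; apply: compact_closed => //; exact: Rhausdorff.
have mB : measurable B by apply: closed_measurable; apply: compact_closed => //; exact: Rhausdorff.
have cid (K : set R) : {within K, continuous id} by apply: continuous_subspaceT => x; exact: cvg_id.
have [M /set_mem AM Mmax] := compact_EVT_max A0 cA (cid A).
have [m /set_mem Bm mmin] := compact_EVT_min B0 cB (cid B).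
(* A + m and B + M meet only at M + m, so removing [M] from [A] makes them disjoint without changing
   the measure. *)
pose A1 : set (measurableTypeR R) := A `\ M.
have mA1 : measurable A1 by exact: measurableD.
have A1E : leb A1 = leb A.
  rewrite -[in RHS](@setDUK _ [set M] A); last by move=> x ->.
  rewrite measureU//; last by rewrite setDE setIC -setIA setICl setI0.
  by rewrite [X in _ = X + _]lebesgue_measure_set1 add0e.
have [mA' A'E] := pre_shift (- m) mA1.
have [mB' B'E] := pre_shift (- M) mB.
have mC2 : measurable [set z : measurableTypeR R | C (z / 2)%R].
  have mT : measurable_fun setT (fun z : measurableTypeR R => (z / 2)%R : measurableTypeR R) by exact: measurable_funM.
  by rewrite -[X in measurable X]setTI; exact: mT.
rewrite -lebesgue_measure_double// -A1E -A'E -B'E -measureU//; last first.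
  apply/seteqP; split => // z [/= [Az zM] Bz].
  have := Mmax (z - m)%R (mem_set Az); have := mmin (z - M)%R (mem_set Bz) => h1 h2.
  by apply: zM; rewrite /=; lra.
apply: le_measure; rewrite ?inE//; first exact: measurableU.
move=> z [[/= Az _]|/= Bz].
- by have := ABC _ _ Az Bm; rewrite subrK.
- by have := ABC _ _ AM Bz; rewrite addrC subrK.
Qed.

(** Inner regularity replaces one set at a time, so that a finite measure is subtracted each
    time. *)
Lemma brunn_minkowski_1D (A B C : set (measurableTypeR R)) :
  A !=set0 -> B !=set0 -> measurable A -> measurable B -> measurable C ->
  (forall a b, A a -> B b -> C ((a + b) / 2)%R) -> leb A + leb B <= 2%:E * leb C.
Proof.
move=> [a0 Aa0] [b0 Bb0] mA mB mC ABC.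
have H (K L : set R) : compact K -> compact L -> K `<=` A -> L `<=` B ->
    leb K + leb L <= 2%:E * leb C.
  move=> cK cL KA LB.
  (* The added points keep the compact sets nonempty. *)
  have cK1 : compact (K `|` [set a0]) by apply: compactU => //; exact: compact_set1.
  have cL1 : compact (L `|` [set b0]) by apply: compactU => //; exact: compact_set1.
  have mcpt (V : set R) : compact V -> measurable (V : set (measurableTypeR R)).
    by move=> cV; apply: closed_measurable; apply: compact_closed => //; exact: Rhausdorff.
  apply: (@le_trans _ _ (leb (K `|` [set a0]) + leb (L `|` [set b0]))).
    by apply: leeD; apply: le_measure; rewrite ?inE; [exact: mcpt|exact: mcpt|exact: subsetUl|exact: mcpt|exact: mcpt|exact: subsetUl].
  apply: brunn_minkowski_compact => //; [by exists a0; right|by exists b0; right|].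
  by move=> a b [/KA Aa|->] [/LB Bb|->]; exact: ABC.
have HA (L : set R) : compact L -> L `<=` B -> leb A + leb L <= 2%:E * leb C.
  move=> cL LB; have Lfin : leb L \is a fin_num by rewrite ge0_fin_numE// compact_finite_measure.
  rewrite -leeBrDr// lebesgue_regularity_inner_sup//; apply: ge_ereal_sup => _ [K [cK KA] <-].
  by rewrite leeBrDr//; exact: H.
(* If [A] has infinite measure, the empty compact subset of [B] already forces [C] to have infinite
   measure. *)
have [Afin|] := boolP (leb A \is a fin_num); last first.
  rewrite ge0_fin_numE// -leNgt leye_eq => /eqP Aoo.
  have := HA set0 (@compact0 _) (@sub0set _ _).
  by rewrite measure0 adde0 Aoo leye_eq => /eqP ->; rewrite leey.
rewrite -leeBrDl// [X in X <= _]lebesgue_regularity_inner_sup//; apply: ge_ereal_sup => _ [K [cK KA] <-].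
by rewrite leeBrDl//; exact: HA.
Qed.

End brunn_minkowski_1D.

(** * The one-dimensional Prekopa-Leindler inequality *)

Section prekopa_leindler_1D.
Context {R : realType}.
Local Open Scope ereal_scope.
Local Notation leb := (@lebesgue_measure R).
Implicit Types u v h : R -> \bar R.

(** Tonelli for the region 0 < t < u x: its sections at fixed x have length u x, those at fixed t
    are the superlevel sets. *)
Lemma layer_cake u : measurable_fun setT u -> (forall x, 0 <= u x) ->
  \int[leb]_x u x = \int[leb]_(t in `]0%R, +oo[) leb [set x | t%:E < u x] /\
  measurable_fun setT (fun t : measurableTypeR R => leb [set x | t%:E < u x]).
Proof.
move=> mu0 u0.
pose A : set (measurableTypeR R * measurableTypeR R) := [set p | p.2%:E < u p.1].
pose B : set (measurableTypeR R * measurableTypeR R) := [set p | 0 < p.2]%R.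
have mA : measurable A.
  have := @measurable_lte _ _ R setT measurableT (fun p : measurableTypeR R * measurableTypeR R => p.2%:E) (fun p => u p.1).
  rewrite setTI; apply.
  - by apply/measurable_EFinP; exact: measurable_snd.
  - by apply: measurableT_comp => //; exact: measurable_fst.
have mB : measurable B.
  rewrite (_ : B = setT `&` (fun p => p.2) @^-1` `]0%R, +oo[%classic).
    by apply: measurable_snd => //; exact: measurable_itv.
  by rewrite setTI; apply/seteqP; split => p; rewrite /B/= in_itv/= andbT.
have yA t : ysection A t = [set x | t%:E < u x].
  by apply/seteqP; split => x; rewrite /ysection/= inE.
split; last first.
  have := measurable_fun_ysection leb mA.
  by apply: eq_measurable_fun => t _ /=; rewrite yA.
have mAB := measurableI _ _ mA mB.
have := indic_fubini_tonelli leb leb mAB.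
rewrite (indic_fubini_tonelli_FE leb mAB) (indic_fubini_tonelli_GE leb mAB) => H.
transitivity (\int[leb]_x (leb \o xsection (A `&` B)) x).
  apply: eq_integral => x _ /=.
  have := u0 x; case E : (u x) => [r| |]// r0.
    rewrite (_ : xsection _ _ = `]0%R, r[%classic); last first.
      apply/seteqP; split => t; rewrite /xsection/= inE /A/B/= in_itv/= E lte_fin.
        by move=> [-> ->].
      by move=> /andP[].
    rewrite lebesgue_measure_itv/= lte_fin; move: r0; rewrite lee_fin le_eqVlt.
    by case/predU1P => [<-|->]; rewrite ?ltxx// -EFinB subr0.
  rewrite (_ : xsection _ _ = `]0%R, +oo[%classic); first by rewrite lebesgue_measure_itv/= ltry.
  by apply/seteqP; split => t; rewrite /xsection/= inE /A/B/= in_itv/= E ltry andbT; [case|].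
rewrite H [RHS]integral_mkcond; apply: eq_integral => t _ /=; rewrite patchE.
case: ifPn => [|]; rewrite ?notin_setE ?inE/= in_itv/= andbT => t0.
  by congr (leb _); rewrite -yA; apply/seteqP; split => x; rewrite /ysection/= !inE /=; [case|].
rewrite (_ : ysection _ _ = set0) ?measure0//.
by apply/seteqP; split => x//; rewrite /ysection/= inE /B/= => -[_ /= ?]; apply: t0.
Qed.

(** Both functions have essentially supremum 1, so for 0 < t < 1 both superlevel sets are nonempty
    and Brunn-Minkowski applies level by level. The layer-cake formula then gives an additive
    bound. *)
Lemma prekopa_leindler_normalized (u v : R -> R) h :
  measurable_fun setT u -> measurable_fun setT v -> measurable_fun setT h ->
  (forall x, 0 <= u x <= 1)%R -> (forall x, 0 <= v x <= 1)%R -> (forall x, 0 <= h x) ->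
  (forall t, 0 < t < 1 -> exists x, t < u x)%R ->
  (forall t, 0 < t < 1 -> exists x, t < v x)%R ->
  (forall x y, (u x * v y)%:E <= h ((x + y) / 2)%R * h ((x + y) / 2)%R) ->
  \int[leb]_x (u x)%:E + \int[leb]_x (v x)%:E <= 2%:E * \int[leb]_x h x.
Proof.
move=> mu mv mh u01 v01 h0 us vs uvh.
have mu' : measurable_fun setT (EFin \o u) by exact/measurable_EFinP.
have mv' : measurable_fun setT (EFin \o v) by exact/measurable_EFinP.
have [|-> mU] := layer_cake mu'; first by move=> x; rewrite lee_fin; case/andP: (u01 x).
have [|-> mV] := layer_cake mv'; first by move=> x; rewrite lee_fin; case/andP: (v01 x).
have [-> mH] := layer_cake mh h0.
have mD : measurable (`]0%R, +oo[%classic : set (measurableTypeR R)) by exact: measurable_itv.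
rewrite -ge0_integralD//; last 2 first.
- exact: measurable_funTS.
- exact: measurable_funTS.
rewrite -ge0_integralZl//; last exact: measurable_funTS.
apply: ge0_le_integral => //.
- by move=> t _; apply: adde_ge0.
- by apply: measurable_funTS; exact: emeasurable_funD.
- by apply: measurable_funTS; exact: measurable_funeM.
move=> t; rewrite /= in_itv/= andbT => t0.
have [t1|t1] := ltP t 1%R; last first.
  have E (w : R -> R) : (forall x, 0 <= w x <= 1)%R -> [set x : R | t%:E < (EFin \o w) x] = set0.
    move=> w01; apply/seteqP; split => // x /=; rewrite lte_fin.
    by case/andP: (w01 x) => _ w1 tw; have := lt_le_trans (le_lt_trans t1 tw) w1; rewrite ltxx.
  by rewrite !E// measure0 adde0 mule_ge0.
have t01 : (0 < t < 1)%R by rewrite t0.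
apply: brunn_minkowski_1D.
- by have [x ux] := us t t01; exists x; rewrite /= lte_fin.
- by have [x vx] := vs t t01; exists x; rewrite /= lte_fin.
- by have := emeasurable_fun_o_infty measurableT mu' t%:E; rewrite setTI.
- by have := emeasurable_fun_o_infty measurableT mv' t%:E; rewrite setTI.
- by have := emeasurable_fun_o_infty measurableT mh t%:E; rewrite setTI.
move=> a b /=; rewrite !lte_fin => ta tb.
have := uvh a b; have := h0 ((a + b) / 2)%R; case: (h _) => [r| |]//; last by rewrite ltry.
rewrite lee_fin lte_fin -EFinM lee_fin => r0 abr.
rewrite ltNge; apply/negP => rt.
have : (r * r <= t * t)%R by apply: ler_pM.
have : (t * t < u a * v b)%R by apply: ltr_pM => //; exact: ltW.
by move=> h1 h2; have := lt_le_trans h1 (le_trans abr h2); rewrite ltxx.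
Qed.

(** The arithmetic-geometric mean inequality in \bar R, which turns the additive bound into the
    multiplicative one. *)
Lemma mule_le_of_sum (a b c : \bar R) : 0 <= a -> 0 <= b -> 0 <= c ->
  a + b <= 2%:E * c -> a * b <= c * c.
Proof.
case: c => [c| |]//; last by move=> _ _ _ _; rewrite mulyy leey.
case: a => [a| |]//; case: b => [b| |]//.
rewrite !lee_fin => a0 b0 c0 h.
by have := sqr_ge0 (a - b); nra.
Qed.

Lemma prekopa_leindler_bounded (u v : R -> R) h (M : R) :
  measurable_fun setT u -> measurable_fun setT v -> measurable_fun setT h ->
  (forall x, 0 <= u x <= M)%R -> (forall x, 0 <= v x <= M)%R -> (forall x, 0 <= h x) ->
  (forall x y, (u x * v y)%:E <= h ((x + y) / 2)%R * h ((x + y) / 2)%R) ->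
  (\int[leb]_x (u x)%:E) * (\int[leb]_x (v x)%:E) <= (\int[leb]_x h x) * (\int[leb]_x h x).
Proof.
move=> mu mv mh uM vM h0 uvh.
have int0 : 0 <= \int[leb]_x h x by exact: integral_ge0.
have supP (w : R -> R) : (forall x, 0 <= w x <= M)%R -> has_sup (range w).
  by move=> wM; split; [exists (w 0%R), 0%R|exists M => _ [x _ <-]; case/andP: (wM x)].
have zero (w : R -> R) : (forall x, 0 <= w x <= M)%R -> (sup (range w) <= 0)%R ->
    \int[leb]_x (w x)%:E = 0.
  move=> wM sw; apply: integral0_eq => x _; congr (_%:E); apply/eqP; rewrite eq_le.
  case/andP: (wM x) => -> _; rewrite andbT; apply: le_trans sw.
  by apply: sup_upper_bound; [exact: supP|exists x].
have [a0|a0] := leP (sup (range u)) 0%R; first by rewrite zero// mul0e mule_ge0.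
have [b0|b0] := leP (sup (range v)) 0%R; first by rewrite (zero v)// mule0 mule_ge0.
set a := sup (range u) in a0; set b := sup (range v) in b0.
(* Dividing u by a, v by b and h by c preserves the pointwise hypothesis since c^2 = a b, and makes
   both suprema equal to 1. *)
pose c := Num.sqrt (a * b).
have c0 : (0 < c)%R by rewrite sqrtr_gt0 mulr_gt0.
have cc : (c * c = a * b)%R by rewrite -expr2 sqr_sqrtr// mulr_ge0 ?ltW.
have norm (w : R -> R) (s : R) : (forall x, 0 <= w x <= M)%R -> s = sup (range w) -> (0 < s)%R ->
    [/\ (forall x, 0 <= s^-1 * w x <= 1)%R,
        (forall t, 0 < t < 1 -> exists x, t < s^-1 * w x)%R &
        measurable_fun setT w ->
        \int[leb]_x (w x)%:E = s%:E * \int[leb]_x ((s^-1 * w x)%R)%:E].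
  move=> wM sE s0; split.
  - move=> x; rewrite mulr_ge0 ?invr_ge0 ?(ltW s0)//=; last by case/andP: (wM x).
    rewrite mulrC ler_pdivrMr// mul1r sE; apply: sup_upper_bound; [exact: supP|by exists x].
  - move=> t /andP[t0 t1].
    have ts : (0 < (1 - t) * s)%R by rewrite mulr_gt0// subr_gt0.
    have [_ [x _ <-] tw] := sup_adherent ts (supP _ wM).
    by exists x; rewrite mulrC ltr_pdivlMr//; move: tw; rewrite -sE; lra.
  - move=> mw; rewrite -ge0_integralZl//; last 3 first.
    + by apply/measurable_EFinP; exact: measurable_funM.
    + move=> x _; rewrite lee_fin mulr_ge0 ?invr_ge0 ?(ltW s0)//; by case/andP: (wM x).
    + by rewrite lee_fin ltW.
    apply: eq_integral => x _; rewrite -EFinM mulrA divff ?mul1r//; exact: lt0r_neq0.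
have [u1 us uE] := norm u a uM erefl a0.
have [v1 vs vE] := norm v b vM erefl b0.
have c1 : (0 <= c^-1)%R by rewrite invr_ge0 ltW.
rewrite uE// vE// muleACA -EFinM -cc.
have -> : \int[leb]_x h x = c%:E * \int[leb]_x ((c^-1)%:E * h x).
  by rewrite ge0_integralZl// muleA -EFinM divff ?mul1e// gt_eqF.
rewrite muleACA -EFinM; apply: lee_wpmul2l; first by rewrite lee_fin mulr_ge0// ltW.
apply: mule_le_of_sum.
- by apply: integral_ge0 => x _; rewrite lee_fin; case/andP: (u1 x).
- by apply: integral_ge0 => x _; rewrite lee_fin; case/andP: (v1 x).
- by apply: integral_ge0 => x _; rewrite mule_ge0// lee_fin.
apply: prekopa_leindler_normalized => //.
- exact: measurable_funM.
- exact: measurable_funM.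
- exact: measurable_funeM.
- by move=> x; rewrite mule_ge0// lee_fin.
move=> x y; rewrite mulrACA -invfM -cc invfM EFinM EFinM muleACA.
by apply: lee_wpmul2l => //; rewrite -EFinM lee_fin mulr_ge0.
Qed.

Lemma prekopa_leindler_1D u v h :
  measurable_fun setT u -> measurable_fun setT v -> measurable_fun setT h ->
  (forall x, 0 <= u x) -> (forall x, 0 <= v x) -> (forall x, 0 <= h x) ->
  (forall x y, u x * v y <= h ((x + y) / 2)%R * h ((x + y) / 2)%R) ->
  (\int[leb]_x u x) * (\int[leb]_x v x) <= (\int[leb]_x h x) * (\int[leb]_x h x).
Proof.
move=> mu mv mh u0 v0 h0 uvh.
(* Only u and v are cut off at height j: the left side of the hypothesis decreases while h is
   kept. *)
pose tr (w : R -> \bar R) (j : nat) x : R := fine (mine (w x) j%:R%:E).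
have trE w j x : 0 <= w x -> (tr w j x)%:E = mine (w x) j%:R%:E.
  move=> w0; rewrite fineK// ge0_fin_numE; last by rewrite le_min w0 lee_fin ler0n.
  by rewrite gt_min ltry orbT.
have tr0 w j x : 0 <= w x -> (0 <= tr w j x <= j%:R)%R.
  by move=> w0; rewrite -!lee_fin trE// le_min w0 lee_fin ler0n/= ge_min lexx orbT.
have mtr w j : measurable_fun setT w -> measurable_fun setT (tr w j).
  by move=> mw; apply: measurableT_comp => //; exact: measurable_mine.
have cvg w : measurable_fun setT w -> (forall x, 0 <= w x) ->
    \int[leb]_x (tr w j x)%:E @[j --> \oo] --> \int[leb]_x w x.
  move=> mw w0.
  have -> : \int[leb]_x w x = \int[leb]_x limn (fun j => (tr w j x)%:E).
    apply: eq_integral => x _; apply/esym/cvg_lim => //.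
    under eq_fun do rewrite trE//.
    have := w0 x; case: (w x) => [r| |]// r0.
      apply: cvg_near_cst; near=> j; apply/min_idPl; rewrite lee_fin.
      by near: j; exact: nbhs_infty_ger.
    under eq_fun do rewrite min_r ?leey//.
    by apply/cvgeryP; exact: cvgr_idn.
  apply: cvg_monotone_convergence => //.
  - by move=> j; apply/measurable_EFinP; exact: mtr.
  - by move=> j x _; rewrite lee_fin; case/andP: (tr0 w j x (w0 x)).
  - move=> x _ i j ij; rewrite !trE// le_min ge_min lexx/= ge_min.
    by rewrite lee_fin ler_nat ij orbT.
have bnd j : (\int[leb]_x (tr u j x)%:E) * (\int[leb]_x (tr v j x)%:E) <= (\int[leb]_x h x) * (\int[leb]_x h x).
  apply: (@prekopa_leindler_bounded _ _ _ j%:R); [exact: mtr|exact: mtr|by []|by move=> x; exact: tr0|by move=> x; exact: tr0|by []|].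
  move=> x y; apply: le_trans (uvh x y); rewrite EFinM !trE//.
  by apply: lee_pmul; rewrite ?le_min ?u0 ?v0 ?lee_fin ?ler0n// ge_min lexx.
have U0 : 0 <= \int[leb]_x u x by exact: integral_ge0.
have V0 : 0 <= \int[leb]_x v x by exact: integral_ge0.
have H0 : 0 <= \int[leb]_x h x by exact: integral_ge0.
(* Vanishing integrals are treated apart because the product of the limits must not be of the form 0
   times infinity. *)
have [->|Un0] := eqVneq (\int[leb]_x u x) 0; first by rewrite mul0e mule_ge0.
have [->|Vn0] := eqVneq (\int[leb]_x v x) 0; first by rewrite mule0 mule_ge0.
apply: (@cvge_to_le nat \oo _ R (fun j => (\int[leb]_x (tr u j x)%:E) * (\int[leb]_x (tr v j x)%:E))).
  by apply: cvgeM; [apply: neq0_mule_def; rewrite mule_eq0 negb_or Un0|exact: cvg|exact: cvg].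
by near=> j; exact: bnd.
Unshelve. all: by end_near. Qed.

End prekopa_leindler_1D.

Section power_prekopa_leindler.
Context {R : realType}.
Variable k : nat.
Hypothesis k0 : (0 < k)%N.
Local Open Scope ereal_scope.
Local Notation leb := (@lebesgue_measure R).

Lemma power_prekopa_leindler_1D (u v h : R -> \bar R) :
  measurable_fun setT u -> measurable_fun setT v -> measurable_fun setT h ->
  (forall x, 0 <= u x) -> (forall x, 0 <= v x) -> (forall x, 0 <= h x) ->
  (forall x, (x <= 0)%R -> u x = 0) -> (forall x, (x <= 0)%R -> v x = 0) ->
  (forall y y', (0 < y)%R -> (0 < y')%R -> let m := ((y + y') / 2)%R in
    u (y ^+ k)%R * v (y' ^+ k)%R * (y ^+ k.-1 * y' ^+ k.-1)%:E <=
    (h (m ^+ k)%R * (m ^+ k.-1)%:E) * (h (m ^+ k)%R * (m ^+ k.-1)%:E)) ->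
  (\int[leb]_x u x) * (\int[leb]_x v x) <= (\int[leb]_x h x) * (\int[leb]_x h x).
Proof.
move=> mu mv mh u0 v0 h0 uN vN uvh.
(* The substitution formula is for functions that vanish on the nonpositive half-line; cutting [h]
   there only lowers the right-hand side. *)
pose h' (x : R) : \bar R := if (0 < x)%R then h x else 0.
have h'0 x : 0 <= h' x by rewrite /h'; case: ifP.
have mh' : measurable_fun setT h'.
  by apply: measurable_fun_if => //; [exact: measurable_fun_ltr|exact: measurable_funTS].
apply: (@le_trans _ _ ((\int[leb]_x h' x) * (\int[leb]_x h' x))); last first.
  have hh' : \int[leb]_x h' x <= \int[leb]_x h x.
    by apply: ge0_le_integral => // x _; rewrite /h'; case: ifP.
  by apply: lee_pmul => //; exact: integral_ge0.
have mJ : measurable_fun setT (fun y : R => (pow_jac k y)%:E).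
  by apply/measurable_EFinP; exact: measurable_pow_jac.
have mP (w : R -> \bar R) : measurable_fun setT w ->
    measurable_fun setT (fun y : R => w (y ^+ k)%R * (pow_jac k y)%:E).
  by move=> mw; apply: emeasurable_funM => //; apply: measurableT_comp => //; exact: exprn_measurable.
have J0 (y : R) : 0 <= (pow_jac k y)%:E by rewrite lee_fin pow_jac_ge0.
rewrite (ge0_integral_pow k0 mu u0 uN) (ge0_integral_pow k0 mv v0 vN).
rewrite (ge0_integral_pow k0 mh' h'0); last by move=> x x0; rewrite /h' ltNge x0.
apply: prekopa_leindler_1D; [exact: mP|exact: mP|exact: mP|..].
- by move=> x; rewrite mule_ge0.
- by move=> x; rewrite mule_ge0.
- by move=> x; rewrite mule_ge0.
move=> y y'; have [y0|y0] := ltP 0%R y; last first.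
  by rewrite {1}/pow_jac ltNge y0/= mule0 mul0e !mule_ge0.
have [y'0|y'0] := ltP 0%R y'; last first.
  by rewrite {2}/pow_jac ltNge y'0/= mule0 mule0 !mule_ge0.
have m0 : (0 < (y + y') / 2)%R by rewrite divr_gt0// addr_gt0.
rewrite /pow_jac y0 y'0 m0 /h' exprn_gt0//.
set m := ((y + y') / 2)%R.
have -> : u (y ^+ k)%R * (k%:R * y ^+ k.-1)%:E * (v (y' ^+ k)%R * (k%:R * y' ^+ k.-1)%:E) =
    (k%:R * k%:R)%:E * (u (y ^+ k)%R * v (y' ^+ k)%R * (y ^+ k.-1 * y' ^+ k.-1)%:E).
  rewrite muleACA -EFinM [RHS]muleC -[RHS]muleA -EFinM; congr (_ * _%:E); ring.
have -> : h (m ^+ k)%R * (k%:R * m ^+ k.-1)%:E * (h (m ^+ k)%R * (k%:R * m ^+ k.-1)%:E) =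
    (k%:R * k%:R)%:E * ((h (m ^+ k)%R * (m ^+ k.-1)%:E) * (h (m ^+ k)%R * (m ^+ k.-1)%:E)).
  rewrite muleACA -EFinM [in RHS]muleACA -EFinM [RHS]muleC -[RHS]muleA -EFinM; congr (_ * _%:E); ring.
by apply: lee_wpmul2l; [rewrite lee_fin mulr_ge0|exact: uvh].
Qed.

(** The Jacobian of [vpow] without its factor k^n, which is the same on both sides of the
    inequality. *)
Definition vjac n (y : 'rV[R]_n) : R := (\prod_(i < n) y ord0 i ^+ k.-1)%R.

Lemma vjac_cons n (t : R) (y : 'rV[R]_n) : vjac (rV_cons (t, y)) = (t ^+ k.-1 * vjac y)%R.
Proof.
rewrite /vjac big_ord_recl rV_cons0; congr (_ * _)%R.
by apply: eq_bigr => i _; rewrite rV_consS.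
Qed.

Lemma vpow_cons n (t : R) (y : 'rV[R]_n) : vpow k (rV_cons (t, y)) = rV_cons ((t ^+ k)%R, vpow k y).
Proof.
apply/rowP => i; rewrite mxE.
by case: (unliftP ord0 i) => [j|] ->; rewrite ?rV_cons0 ?rV_consS ?mxE.
Qed.

Lemma orthant_cons n (t : R) (y : 'rV[R]_n) : (0 < t)%R -> orthant R n y ->
  orthant R n.+1 (rV_cons (t, y)).
Proof.
move=> t0 oy i; case: (unliftP ord0 i) => [j|] ->; rewrite ?rV_cons0 ?rV_consS//; exact: oy.
Qed.

Definition vmid n (y y' : 'rV[R]_n) : 'rV[R]_n := 2^-1 *: (y + y').

Lemma vmid_cons n (t t' : R) (y y' : 'rV[R]_n) :
  vmid (rV_cons (t, y)) (rV_cons (t', y')) = rV_cons (((t + t') / 2)%R, vmid y y').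
Proof.
apply/rowP => i; rewrite /vmid mxE mxE.
case: (unliftP ord0 i) => [j|] ->; first by rewrite !rV_consS !mxE.
by rewrite !rV_cons0 mulrC.
Qed.

(** Induction on the dimension: the induction hypothesis on slices is exactly the hypothesis of the
    one-dimensional inequality for the marginals in the first coordinate. *)
Lemma power_prekopa_leindler n (u v h : 'rV[R]_n -> \bar R) :
  measurable_fun setT u -> measurable_fun setT v -> measurable_fun setT h ->
  (forall x, 0 <= u x) -> (forall x, 0 <= v x) -> (forall x, 0 <= h x) ->
  (forall x, ~ orthant R n x -> u x = 0) -> (forall x, ~ orthant R n x -> v x = 0) ->
  (forall y y', orthant R n y -> orthant R n y' -> let m := vmid y y' in
    u (vpow k y) * v (vpow k y') * (vjac y * vjac y')%:E <=
    (h (vpow k m) * (vjac m)%:E) * (h (vpow k m) * (vjac m)%:E)) ->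
  (\int[lebesgue_rV]_x u x) * (\int[lebesgue_rV]_x v x) <=
  (\int[lebesgue_rV]_x h x) * (\int[lebesgue_rV]_x h x).
Proof.
elim: n u v h => [|n ih] u v h mu mv mh u0 v0 h0 uN vN uvh.
  have E (w : 'rV[R]_0 -> \bar R) : measurable_fun setT w -> \int[lebesgue_rV]_x w x = w 0%R.
    move=> mw; rewrite /lebesgue_rV/= integral_dirac// diracT mul1e//.
  rewrite !E//; have o0 : orthant R 0 (0 : 'rV[R]_0)%R by case.
  have := uvh _ _ o0 o0; rewrite /vjac !big_ord0 mulr1 !mule1.
  by rewrite ![vpow _ _]thinmx0.
have U0 (w : 'rV[R]_n.+1 -> \bar R) : (forall x, 0 <= w x) -> forall t, 0 <= \int[lebesgue_rV]_x w (rV_cons (t, x)).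
  by move=> w0 t; exact: integral_ge0.
have UN (w : 'rV[R]_n.+1 -> \bar R) : (forall x, ~ orthant R n.+1 x -> w x = 0) ->
    forall t, (t <= 0)%R -> \int[lebesgue_rV]_x w (rV_cons (t, x)) = 0.
  move=> wN t t0; apply: integral0_eq => x _; apply: wN => /(_ ord0).
  by rewrite rV_cons0 ltNge t0.
rewrite (ge0_integral_rV_cons mu u0) (ge0_integral_rV_cons mv v0) (ge0_integral_rV_cons mh h0).
apply: power_prekopa_leindler_1D; [exact: measurable_integral_rV_cons|
  exact: measurable_integral_rV_cons|exact: measurable_integral_rV_cons|exact: U0|exact: U0|
  exact: U0|exact: UN|exact: UN|].
move=> y0 y'0 y00 y'00 /=; set m0 := ((y0 + y'0) / 2)%R.
have m00 : (0 < m0)%R by rewrite divr_gt0// addr_gt0.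
have mS (w : 'rV[R]_n.+1 -> \bar R) t : measurable_fun setT w ->
    measurable_fun setT (fun x : 'rV[R]_n => w (rV_cons (t, x))).
  by move=> mw; apply: (measurableT_comp mw); exact: measurable_rV_cons_snd.
have sc (w : 'rV[R]_n.+1 -> \bar R) (t c : R) : measurable_fun setT w -> (forall x, 0 <= w x) -> (0 <= c)%R ->
    \int[lebesgue_rV]_x (w (rV_cons (t, x)) * c%:E) = (\int[lebesgue_rV]_x w (rV_cons (t, x))) * c%:E.
  by move=> mw w0 c0; rewrite ge0_integralZr//; exact: mS.
have mSc (w : 'rV[R]_n.+1 -> \bar R) (t c : R) : measurable_fun setT w ->
    measurable_fun setT (fun x : 'rV[R]_n => w (rV_cons (t, x)) * c%:E).
  by move=> mw; apply: emeasurable_funM => //; exact: mS.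
(* The Jacobian factors of the first coordinate are absorbed into the slices, so that the condition
   asked by [ih] is [uvh] at the extended points. *)
pose u1 x := u (rV_cons ((y0 ^+ k)%R, x)) * (y0 ^+ k.-1)%:E.
pose v1 x := v (rV_cons ((y'0 ^+ k)%R, x)) * (y'0 ^+ k.-1)%:E.
pose h1 x := h (rV_cons ((m0 ^+ k)%R, x)) * (m0 ^+ k.-1)%:E.
have H : (\int[lebesgue_rV]_x u1 x) * (\int[lebesgue_rV]_x v1 x) <=
    (\int[lebesgue_rV]_x h1 x) * (\int[lebesgue_rV]_x h1 x); last first.
  move: H; rewrite /u1 /v1 /h1 (sc u _ _ mu u0 (exprn_ge0 _ (ltW y00))).
  rewrite (sc v _ _ mv v0 (exprn_ge0 _ (ltW y'00))) (sc h _ _ mh h0 (exprn_ge0 _ (ltW m00))).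
  by rewrite [X in X <= _ -> _]muleACA -EFinM.
rewrite {}/u1 {}/v1 {}/h1.
apply: ih; [exact: mSc|exact: mSc|exact: mSc|..].
- by move=> x; rewrite mule_ge0// lee_fin exprn_ge0// ltW.
- by move=> x; rewrite mule_ge0// lee_fin exprn_ge0// ltW.
- by move=> x; rewrite mule_ge0// lee_fin exprn_ge0// ltW.
- move=> x nx; rewrite uN ?mul0e// => ox; apply: nx => i.
  by have := ox (lift ord0 i); rewrite rV_consS.
- move=> x nx; rewrite vN ?mul0e// => ox; apply: nx => i.
  by have := ox (lift ord0 i); rewrite rV_consS.
move=> y y' oy oy' /=; set m := vmid y y'.
have := uvh _ _ (orthant_cons y00 oy) (orthant_cons y'00 oy').
rewrite /= vmid_cons !vpow_cons !vjac_cons -/m -/m0 => le1.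
have e1 (p q : \bar R) (a b c d : R) :
    p * a%:E * (q * b%:E) * (c * d)%:E = p * q * ((a * c) * (b * d))%:E.
  rewrite (muleACA p) -(muleA (p * q)) -!EFinM; congr (_ * _%:E); ring.
have e2 (p : \bar R) (a b : R) : p * a%:E * b%:E = p * (a * b)%:E by rewrite -muleA -EFinM.
by rewrite e1 !e2.
Qed.

End power_prekopa_leindler.

(** * Almost everywhere differentiability of Lipschitz functions *)

Section monotone_lipschitz.
Context {R : realType}.
Local Notation leb := (@lebesgue_measure R).

(** Slopes in [0, 1]: both G and x - G x are nondecreasing and define Stieltjes measures. *)
Definition monotone_lipschitz (G : R -> R) := forall x y, x <= y -> 0 <= G y - G x <= y - x.

(** Carries the proof so that the [cumulative] structure can be attached to it. *)
Definition mlip (G : R -> R) of monotone_lipschitz G := G.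

Lemma mlip_nondecreasing G (mG : monotone_lipschitz G) : {homo mlip mG : x y / x <= y}.
Proof. by move=> x y /mG/andP[]; rewrite subr_ge0. Qed.

Lemma mlip_continuous G (mG : monotone_lipschitz G) : continuous (mlip mG).
Proof.
move=> x; apply/cvgrPdist_le => /= e e0; near=> y.
apply: (@le_trans _ _ `|x - y|); last by near: y; exact: cvgr_dist_le.
rewrite /mlip; have [xy|/ltW yx] := leP x y.
  have /andP[h1 h2] := mG _ _ xy.
  by rewrite distrC [`|x - _|]distrC (ger0_norm h1) ger0_norm ?subr_ge0.
have /andP[h1 h2] := mG _ _ yx.
by rewrite (ger0_norm h1) ger0_norm ?subr_ge0.
Unshelve. all: by end_near. Qed.

HB.instance Definition _ G (mG : monotone_lipschitz G) :=
  isCumulative.Build R _ R (mlip mG) (mlip_nondecreasing mG)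
    (right_continuousW (@mlip_continuous _ mG)).

Lemma lebesgue_stieltjes_oc (f : cumulative R R) (a b : R) : a <= b ->
  lebesgue_stieltjes_measure f `]a, b]%classic = (f b - f a)%:E.
Proof.
move=> ab; rewrite /lebesgue_stieltjes_measure /measure_extension measurable_mu_extE//; last first.
  by exists (a, b).
exact: (wlength_itv_bnd f false false ab).
Qed.

(** The Stieltjes measures of G and of x - G x add up to Lebesgue measure, by uniqueness on
    half-open intervals. *)
Lemma lebesgue_stieltjes_mlip_le G (mG : monotone_lipschitz G) (A : set (measurableTypeR R)) :
  measurable A -> (lebesgue_stieltjes_measure (mlip mG) A <= leb A)%E.
Proof.
have mG' : monotone_lipschitz (fun x => x - G x).
  move=> x y xy; have := mG x y xy; lra.
move=> mA.
pose m1 : {measure set (measurableTypeR R) -> \bar R} := lebesgue_stieltjes_measure (mlip mG).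
pose m2 : {measure set (measurableTypeR R) -> \bar R} := lebesgue_stieltjes_measure (mlip mG').
have mE B : measure_add m1 m2 B = (m1 B + m2 B)%E by exact: measure_addE.
have H : leb A = measure_add m1 m2 A.
  apply: (@lebesgue_measure_unique R (measure_add m1 m2)) => // _ [[a b] _ <-].
  apply: (etrans _ (esym (mE _))); rewrite [(a, b).1]/= [(a, b).2]/=.
  have [ba|/ltW ab] := leP b a; first by rewrite set_itv_ge ?bnd_simp -?leNgt// !measure0 adde0.
  rewrite (lebesgue_stieltjes_oc (mlip mG) ab : m1 `]a, b]%classic = _).
  rewrite (lebesgue_stieltjes_oc (mlip mG') ab : m2 `]a, b]%classic = _) -EFinD lebesgue_measure_itv/= lte_fin /mlip.
  case: ifP => [_|/negbT]; first by rewrite -EFinB; congr (_%:E); ring.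
  rewrite -leNgt => ba; have -> : a = b by apply/eqP; rewrite eq_le ab ba.
  by rewrite !subrr addr0.
by rewrite H mE leeDl.
Qed.

(** On a bounded interval the Stieltjes measure is finite and dominated by Lebesgue measure, so it
    has an integrable density. There G is a constant plus the indefinite integral of that density,
    which is derivable almost everywhere. *)
Lemma mlip_ae_derivable_itv G (mG : monotone_lipschitz G) (m : R) : 0 < m ->
  {ae leb, forall x, - m < x < m -> derivable G x 1}.
Proof.
move=> m0; set D : set (measurableTypeR R) := `]- m, m]%classic.
have mD : measurable D by exact: measurable_itv.
pose nu : {measure set (measurableTypeR R) -> \bar R} := lebesgue_stieltjes_measure (mlip mG).
have nuD : (nu D < +oo)%E.
  apply: (le_lt_trans (lebesgue_stieltjes_mlip_le mG mD)).
  by rewrite lebesgue_measure_itv/=; case: ifP => _; rewrite ltry.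
pose nuf : {finite_measure set (measurableTypeR R) -> \bar R} := mfrestr mD nuD.
have dom : nuf `<< leb.
  apply/null_content_dominatesP => A mA A0; apply/eqP; rewrite eq_le measure_ge0 andbT.
  rewrite -A0; apply: (@le_trans _ _ (nu A)); last exact: lebesgue_stieltjes_mlip_le.
  apply: le_measure; rewrite ?inE//; first [exact: measurableI|exact: subIsetl].
have [f [f0 ffin fint fE]] := radon_nikodym_sigma_finite dom.
have fgint : leb.-integrable setT (EFin \o (fine \o f)).
  by apply: eq_integrable fint => // x _ /=; rewrite fineK.
have loc : locally_integrable setT (fine \o f) by exact: open_integrable_locally openT fgint.
have inty y : leb.-integrable [set` Interval (BRight (- m)) (BRight y)] (EFin \o (fine \o f)).
  by apply: (@integrableS _ (measurableTypeR R) R leb setT) => //; exact: measurable_itv.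
have /= := @FTC1 R (fine \o f) (BRight (- m)) inty loc.
apply: filterS; first exact: (ae_filter_ringOfSetsType leb).
move=> x /= H /andP[mx xm].
have [dF _] := H mx.
move: dF; set F := (X in derivable X); move=> dF.
have GF y : - m < y < m -> G y = G (- m) + F y.
  move=> /andP[my ym]; rewrite /F /Rintegral.
  have -> : (\int[leb]_(t in `](- m)%R, y]) (fine (f t))%:E = nuf `](- m)%R, y]%classic)%E.
    rewrite fE; last exact: measurable_itv.
    by apply: eq_integral => t _ /=; rewrite fineK.
  rewrite /nuf/= /mfrestr/= /mrestr setIidl; last first.
    by move=> t /=; rewrite /D/= !in_itv/= => /andP[-> /le_trans]; apply; exact: ltW.
  by rewrite lebesgue_stieltjes_oc ?(ltW my)//= /mlip addrC subrK.
apply: (@near_eq_derivable _ _ _ (fun y => G (- m) + F y)).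
  near=> y; rewrite [RHS](GF y)//; apply/andP; split; near: y.
    exact: lt_nbhsr.
  exact: lt_nbhsl.
by apply: derivableD; [exact: derivable_cst|exact: dF].
Unshelve. all: by end_near. Qed.

Lemma lipschitz_ae_derivable (F : R -> R) (L : R) :
  (forall x y, `|F x - F y| <= L * `|x - y|) ->
  {ae leb, forall x, derivable F x 1}.
Proof.
move=> lF.
have [K K0 lK] : exists2 K, 0 < K & forall x y, `|F x - F y| <= K * `|x - y|.
  exists (`|L| + 1) => [|x y]; first by rewrite ltr_pwDr.
  apply: (le_trans (lF x y)); apply: ler_wpM2r => //.
  by rewrite (le_trans (ler_norm _))// lerDl.
(* F / K has slopes in [-1, 1]; adding the identity and halving brings them into [0, 1]. *)
pose G x := 2^-1 * (x + K^-1 * F x).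
have mG : monotone_lipschitz G.
  move=> x y xy; have := lK y x; rewrite [in leRHS]ger0_norm ?subr_ge0// ler_norml => /andP[h1 h2].
  have e : K^-1 * F y - K^-1 * F x = K^-1 * (F y - F x) by rewrite mulrBr.
  have h3 : - (y - x) <= K^-1 * (F y - F x) by rewrite mulrC ler_pdivlMr// mulNr mulrC.
  have h4 : K^-1 * (F y - F x) <= y - x by rewrite mulrC ler_pdivrMr// mulrC.
  rewrite /G; lra.
have H (m : nat) : leb.-negligible (~` [set x | - m.+1%:R < x < m.+1%:R -> derivable G x 1]).
  by apply: (@mlip_ae_derivable_itv _ mG m.+1%:R); rewrite ltr0n.
apply: negligibleS (negligible_bigcup H) => x /= nd.
exists (Num.bound `|x|) => //= d; apply: nd.
have xb : - (Num.bound `|x|).+1%:R < x < (Num.bound `|x|).+1%:R.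
  rewrite -ltr_norml; apply: (lt_trans (archi_boundP (normr_ge0 x))).
  by rewrite ltr_nat.
have -> : F = (K * 2) \*: G - K \*: (id : R -> R).
  apply/funext => y; rewrite (_ : (_ - _) y = K * 2 * (2^-1 * (y + K^-1 * F y)) - K * y)//.
  by field; exact: lt0r_neq0.
apply: derivableB; apply: derivableZ; first exact: d.
exact: derivable_id.
Qed.

End monotone_lipschitz.

(** * Null sets along lines and Borel partial derivatives *)

Section lines.
Context {R : realType}.
Local Notation leb := (@lebesgue_measure R).

Definition evec n (i : 'I_n) : 'rV[R]_n := delta_mx ord0 i.

Lemma evecE n (i j : 'I_n) : evec i ord0 j = (j == i)%:R.
Proof. by rewrite /evec mxE eqxx. Qed.

Lemma norm_evec_le n (i : 'I_n) : `|evec i| <= 1.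
Proof.
rewrite [`|_|]mx_normrE; apply/bigmax_leP; split=> // -[a j] _ /=.
by rewrite ord1 evecE normr_nat lern1 leq_b1.
Qed.

Lemma norm_scale_evec_le n (i : 'I_n) (t : R) : `|t *: evec i| <= `|t|.
Proof. by rewrite normrZ ler_piMr// norm_evec_le. Qed.

Lemma rV_cons_evec0 n (t : R) (x : 'rV[R]_n) : rV_cons (t, x) = rV_cons (0, x) + t *: evec ord0.
Proof.
apply/rowP => i; rewrite !mxE eqxx/=.
case: (unliftP ord0 i) => [j|] -> /=; last by rewrite mulr1 add0r.
by rewrite mulr0 addr0.
Qed.

Lemma rV_cons_evecS n (t s : R) (x : 'rV[R]_n) j :
  rV_cons (t, x + s *: evec j) = rV_cons (t, x) + s *: evec (lift ord0 j).
Proof.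
apply/rowP => i; rewrite !mxE eqxx/=.
case: (unliftP ord0 i) => [l|] -> /=; first by rewrite !mxE eqxx/= (inj_eq lift_inj).
by rewrite mulr0 addr0.
Qed.

Lemma measurable_line n (x : 'rV[R]_n) (i : 'I_n) :
  measurable_fun setT (fun t : measurableTypeR R => x + t *: evec i).
Proof.
apply: measurable_fun_rVP => j; under eq_fun do rewrite !mxE.
by apply: measurable_funD => //; exact: measurable_funM.
Qed.

(** Tonelli by induction on the dimension: direction 0 is integrated innermost, any other direction
    is a direction of the slices. *)
Lemma lebesgue_rV_null_lines n (i : 'I_n) (Z : set 'rV[R]_n) : measurable Z ->
  (forall x, leb [set t | Z (x + t *: evec i)] = 0%E) -> lebesgue_rV Z = 0%E.
Proof.
elim: n i Z => [|n ih] i Z mZ Z0; first by case: i {Z0}.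
have mI : measurable_fun setT (fun x : 'rV[R]_n.+1 => (\1_Z x)%:E : \bar R).
  by apply/measurable_EFinP.
have I0 (x : 'rV[R]_n.+1) : (0 <= (\1_Z x)%:E :> \bar R)%E by rewrite lee_fin.
rewrite -[Z]setIT -integral_indic//.
have [j|] := unliftP ord0 i => iE; last first.
  rewrite (ge0_integral_rV_cons_swap mI I0); apply: integral0_eq => x _.
  rewrite -[RHS](Z0 (rV_cons (0, x))).
  transitivity (\int[leb]_t (\1_[set t | Z (rV_cons (0, x) + t *: evec i)] t)%:E)%E.
    by apply: eq_integral => t _; rewrite rV_cons_evec0 iE !indicE.
  rewrite integral_indic ?setIT//.
  by rewrite -[X in measurable X]setTI; exact: measurable_line.
rewrite (ge0_integral_rV_cons mI I0); apply: integral0_eq => t _.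
transitivity (\int[lebesgue_rV]_x (\1_[set x | Z (rV_cons (t, x))] x)%:E)%E.
  by apply: eq_integral => x _; rewrite !indicE.
have mS : measurable [set x : 'rV[R]_n | Z (rV_cons (t, x))].
  by rewrite -[X in measurable X]setTI; exact: measurable_rV_cons_snd.
rewrite integral_indic// setIT; apply: (ih j) => // x.
rewrite -[RHS](Z0 (rV_cons (t, x))); congr (leb _); apply/seteqP; split => s /=.
  by rewrite rV_cons_evecS iE.
by rewrite rV_cons_evecS iE.
Qed.

End lines.

Section lipschitz_partial.
Context {R : realType} {n : nat}.
Local Notation leb := (@lebesgue_measure R).
Variables (F : 'rV[R]_n -> R) (L : R).
Hypothesis lipF : forall x y, `|F x - F y| <= L * `|x - y|.

Lemma lipschitz_continuous : continuous F.
Proof.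
move=> x; apply/(@cvgrPdist_le _ _ _ _ (nbhs_filter x)) => /= e e0.
have L1 : 0 < `|L| + 1 by rewrite ltr_pwDr.
have : \forall y \near x, `|x - y| <= e / (`|L| + 1).
  by apply: (@cvgr_dist_le _ _ _ _ (nbhs_filter x)); [exact: cvg_id|exact: divr_gt0].
apply: filterS => y xy; apply: (le_trans (lipF x y)).
apply: (@le_trans _ _ ((`|L| + 1) * `|x - y|)).
  by apply: ler_wpM2r => //; rewrite (le_trans (ler_norm _))// lerDl.
by rewrite mulrC -ler_pdivlMr.
Qed.

Lemma continuous_measurable_rV (f : 'rV[R]_n -> R) : continuous f -> measurable_fun setT f.
Proof.
move=> cf; apply: (measurability _ (RGenOpens.measurableE R)).
move=> _ [_ [a [b ->]] <-]; rewrite setTI; apply: open_measurable_rV.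
by apply: open_comp; [move=> x _; exact: cf|exact: interval_open].
Qed.

Definition diffq (i : 'I_n) (h : R) x := h^-1 * (F (x + h *: evec i) - F x).

Lemma diffq_le i h x : `|diffq i h x| <= `|L|.
Proof.
rewrite /diffq; have [->|h0] := eqVneq h 0; first by rewrite invr0 mul0r normr0.
rewrite normrM normfV ler_pdivrMl ?normr_gt0//.
apply: (le_trans (lipF _ _)); rewrite addrC addKr mulrC.
apply: (@le_trans _ _ (`|h *: evec i| * `|L|)); first by apply: ler_wpM2l => //; exact: ler_norm.
by apply: ler_wpM2r => //; exact: norm_scale_evec_le.
Qed.

Lemma continuous_diffq i h : continuous (diffq i h).
Proof.
move=> x; apply: cvgM; first exact: cvg_cst.
apply: cvgB; last exact: lipschitz_continuous.
have c1 : {for x, continuous (fun y : 'rV[R]_n => y + h *: evec i)}.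
  by apply: cvgD; [exact: cvg_id|exact: cvg_cst].
exact: (continuous_comp c1 (@lipschitz_continuous _)).
Qed.

(** The Cauchy criterion for the difference quotients, with a non-strict bound so that each inner
    set is an intersection of closed sets and the whole is Borel. *)
Definition partial_dom i : set 'rV[R]_n := \bigcap_p \bigcup_m
  [set x | forall h h', 0 < `|h| < m.+1%:R^-1 -> 0 < `|h'| < m.+1%:R^-1 ->
    `|diffq i h x - diffq i h' x| <= p.+1%:R^-1].

Lemma measurable_partial_dom i : measurable (partial_dom i).
Proof.
apply: bigcapT_measurable => p; apply: bigcupT_measurable => m.
apply: closed_measurable_rV.
rewrite (_ : [set x | _] = \bigcap_(q in [set q : R * R | 0 < `|q.1| < m.+1%:R^-1 /\ 0 < `|q.2| < m.+1%:R^-1])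
    ((fun x => `|diffq i q.1 x - diffq i q.2 x|) @^-1` [set y | y <= p.+1%:R^-1])); last first.
  apply/seteqP; split => [x /= H [h h'] /= [h1 h2]|x /= H h h' h1 h2]; first exact: H.
  by apply: (H (h, h')).
apply: closed_bigI => -[h h'] _; apply: closed_comp; last exact: closed_le.
by move=> x _; apply: cvg_norm; apply: cvgB; exact: continuous_diffq.
Qed.

Lemma diffqE i x : (fun h => h^-1 *: ((F \o shift x) (h *: evec i) - F x)) = (fun h => diffq i h x).
Proof. by apply/funext => h; rewrite /diffq /= [x + _]addrC. Qed.

Lemma partial_domP i x : partial_dom i x <-> derivable F x (evec i).
Proof.
rewrite /derivable diffqE; split => [Ax|/cvg_ex[/= l dl]].
  apply/cauchy_cvgP; apply: cauchy_exP => e e0.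
  have [p _ /(_ p (leqnn p)) pe] := near_infty_natSinv_lt (PosNum e0).
  have [m _ Am] := Ax p Logic.I.
  have m0 : 0 < m.+1%:R^-1 :> R by rewrite invr_gt0.
  exists (diffq i m.+2%:R^-1 x); rewrite /nbhs/=; near=> h.
  rewrite /ball/=; apply: (le_lt_trans _ pe); apply: Am.
    by rewrite ger0_norm ?invr_ge0// invr_gt0 ltr0n/= ltf_pV2 ?posrE ?ltr0n// ltr_nat.
  apply/andP; split; first by rewrite normr_gt0; near: h; exact: nbhs_dnbhs_neq.
  by near: h; exact: dnbhs0_lt.
move=> p _.
have p0 : 0 < p.+1%:R^-1 / 2 :> R by rewrite divr_gt0// invr_gt0.
have /cvgrPdist_lt/(_ _ p0) := dl.
move=> [e /= e0 H].
have [m _ /(_ m (leqnn m)) me] := near_infty_natSinv_lt (PosNum e0).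
exists m => // h h' /andP[h0 hm] /andP[h'0 h'm].
have H1 : forall h, 0 < `|h| -> `|h| < m.+1%:R^-1 -> `|l - diffq i h x| < p.+1%:R^-1 / 2.
  move=> h1 h10 h1m; apply: H; last by rewrite -normr_gt0.
  by rewrite /ball/= sub0r normrN (lt_trans h1m).
rewrite (_ : _ - _ = (l - diffq i h' x) - (l - diffq i h x)); last by ring.
apply: (le_trans (ler_normB _ _)); rewrite [leRHS]splitr lerD// ltW// H1//.
Unshelve. all: by end_near. Qed.

(** A Borel version of the partial derivative. The value 0 where the derivative does not exist makes
    it bounded by |L| everywhere and its square at most that of [partial]. *)
Definition gpartial i x := if x \in partial_dom i then partial i F x else 0.

Lemma diffq_cvg i x : partial_dom i x -> diffq i m.+1%:R^-1 x @[m --> \oo] --> partial i F x.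
Proof.
move=> /partial_domP; rewrite /derivable diffqE => dx.
rewrite /partial /derive -/(evec i) diffqE.
apply: (cvg_comp _ _ _ dx).
move=> A [e /= e0 eA].
apply: filterS (near_infty_natSinv_lt (PosNum e0)) => m /= me; apply: eA => /=.
  by rewrite sub0r normrN gtr0_norm.
by rewrite gt_eqF.
Qed.

Lemma measurable_gpartial i : measurable_fun setT (gpartial i).
Proof.
have mA := measurable_partial_dom i.
apply: (@measurable_fun_cvg _ _ _ _ (fun m x => diffq i m.+1%:R^-1 x * \1_(partial_dom i) x)).
  move=> m; apply: measurable_funM => //.
  by apply: continuous_measurable_rV; exact: continuous_diffq.
move=> x _; rewrite /gpartial; case: ifPn => [|nx].
  rewrite inE => Ax; under eq_fun do rewrite indicE mem_set// mulr1.
  exact: diffq_cvg.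
under eq_fun do rewrite indicE (negbTE nx) mulr0.
exact: cvg_cst.
Qed.

Lemma gpartial_le i x : `|gpartial i x| <= `|L|.
Proof.
rewrite /gpartial; case: ifPn => [|_]; last by rewrite normr0.
rewrite inE => /diffq_cvg/cvg_norm dl.
by apply: (cvgr_to_le dl); near=> m; exact: diffq_le.
Unshelve. all: by end_near. Qed.

(** On each line in direction i the restriction of F is Lipschitz, hence derivable almost
    everywhere. *)
Lemma lebesgue_partial_domC i : lebesgue_rV (~` partial_dom i) = 0%E.
Proof.
apply: (@lebesgue_rV_null_lines R n i); first exact: measurableC (measurable_partial_dom i).
move=> x; pose phi t := F (x + t *: evec i).
have : {ae leb, forall t, derivable phi t 1}.
  apply: (@lipschitz_ae_derivable _ _ `|L|) => s t.
  apply: (le_trans (lipF _ _)); rewrite opprD addrACA subrr add0r -scalerBl.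
  apply: (@le_trans _ _ (`|L| * `|(s - t) *: evec i|)); first by apply: ler_wpM2r => //; exact: ler_norm.
  by apply: ler_wpM2l => //; exact: norm_scale_evec_le.
move=> nae; apply: measure_negligible.
  have := @measurable_line R n x i measurableT _ (measurableC (measurable_partial_dom i)).
  by rewrite setTI.
apply: negligibleS nae => t /= nA /= dphi; apply: nA; apply/partial_domP.
move: dphi; rewrite /derivable diffqE.
suff -> : (fun h : R => h^-1 *: ((phi \o shift t) (h *: (1 : R)) - phi t)) = (fun h => diffq i h (x + t *: evec i)) by [].
apply/funext => h; rewrite /diffq /phi /= /shift /=.
have -> : h%:A = h :> R by rewrite /GRing.scale/= mulr1.
by rewrite scalerDl [h *: _ + _]addrC addrA.
Qed.

End lipschitz_partial.

(** * Cube averages of Lipschitz functions *)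

Section bounded_integrals.
Context d (T : measurableType d) {R : realType}.
Variable mu : {measure set T -> \bar R}.

Lemma integrable_bounded (A : set T) (g : T -> R) (K : R) :
  measurable A -> (mu A < +oo)%E -> measurable_fun A g -> (forall x, A x -> `|g x| <= K) ->
  mu.-integrable A (EFin \o g).
Proof.
move=> mA Aoo mg gK; apply: measurable_bounded_integrable => //.
rewrite /bounded_near; near=> M => x /= Ax; apply: (le_trans (gK x Ax)).
by near: M; apply: nbhs_pinfty_ge; exact: num_real.
Unshelve. all: by end_near. Qed.

Lemma Rintegral_le_cst (A : set T) (g : T -> R) (K : R) :
  measurable A -> (mu A < +oo)%E -> measurable_fun A g -> (forall x, A x -> `|g x| <= K) ->
  `|\int[mu]_(x in A) g x| <= K * fine (mu A).
Proof.
move=> mA Aoo mg gK; have ig := integrable_bounded mA Aoo mg gK.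
apply: (le_trans (le_normr_Rintegral mA ig)); rewrite -Rintegral_cst//.
apply: le_Rintegral => //.
- apply: (@integrable_bounded _ _ K) => //; first exact: measurableT_comp.
  by move=> x Ax; rewrite normr_id gK.
- by apply: (@integrable_bounded _ _ `|K|) => //.
Qed.

End bounded_integrals.

Section cube_average.
Context {R : realType} {n : nat}.
Local Notation leb := (@lebesgue_measure R).
Variable eta : R.
Hypothesis eta0 : 0 < eta.

Definition cube : set 'rV[R]_n := cbox 0 eta.

Definition cube_vol : R := fine (lebesgue_rV cube).

Lemma lebesgue_cube_side : leb `[0, eta]%classic = eta%:E.
Proof. by rewrite lebesgue_measure_itv/= lte_fin eta0 -EFinB subr0. Qed.

Lemma prode_EFin (I : finType) (P : pred I) (f : I -> R) :
  (\prod_(i | P i) (f i)%:E)%E = (\prod_(i | P i) f i)%:E.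
Proof. by elim/big_rec2 : _ => // i x y _ ->. Qed.

Lemma cube_vol_gt0 : 0 < cube_vol.
Proof.
rewrite /cube_vol lebesgue_rV_cbox (eq_bigr (fun=> eta%:E)) => [|i _]; last exact: lebesgue_cube_side.
by rewrite prode_EFin/= prodr_gt0.
Qed.

Let mQ : measurable cube. Proof. exact: measurable_cbox. Qed.
Let Qoo : (lebesgue_rV cube < +oo)%E. Proof. exact: lebesgue_rV_cbox_lty. Qed.

Definition cube_avg (g : 'rV[R]_n -> R) (x : 'rV[R]_n) : R :=
  cube_vol^-1 * \int[lebesgue_rV]_(z in cube) g (x + z).

Lemma measurable_shiftr (g : 'rV[R]_n -> R) x : measurable_fun setT g ->
  measurable_fun setT (fun z : 'rV[R]_n => g (x + z)).
Proof.
move=> mg; under eq_fun do rewrite addrC.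
by apply: (measurableT_comp mg); exact: measurable_rV_shift.
Qed.

Section bounded.
Variables (g : 'rV[R]_n -> R) (K : R).
Hypotheses (mg : measurable_fun setT g) (gK : forall x, `|g x| <= K).

Lemma integrable_cube x : lebesgue_rV.-integrable cube (EFin \o (fun z => g (x + z))).
Proof.
apply: (integrable_bounded (K := K)) => //.
by apply: measurable_funTS; exact: measurable_shiftr.
Qed.

Lemma cube_avg_le x : `|cube_avg g x| <= K.
Proof.
rewrite /cube_avg normrM gtr0_norm ?invr_gt0 ?cube_vol_gt0//.
rewrite ler_pdivrMl ?cube_vol_gt0// mulrC; apply: Rintegral_le_cst => //.
by apply: measurable_funTS; exact: measurable_shiftr.
Qed.

Lemma cube_avg_cst_dist (c e : R) x : (forall z, cube z -> `|g (x + z) - c| <= e) ->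
  `|cube_avg g x - c| <= e.
Proof.
move=> ge.
have -> : cube_avg g x - c = cube_vol^-1 * \int[lebesgue_rV]_(z in cube) (g (x + z) - c).
  rewrite RintegralB//; [|exact: integrable_cube|]; last first.
    by apply: (integrable_bounded (K := `|c|)).
  by rewrite Rintegral_cst// -/cube_vol mulrBr mulrCA mulVf ?mulr1// gt_eqF ?cube_vol_gt0.
rewrite normrM gtr0_norm ?invr_gt0 ?cube_vol_gt0//.
rewrite ler_pdivrMl ?cube_vol_gt0// mulrC; apply: Rintegral_le_cst => //.
apply: measurable_funTS; apply: measurable_funB => //; exact: measurable_shiftr.
Qed.

(** Jensen's inequality, from the integral of (g - m)^2 with m the average. *)
Lemma cube_avg_sqr x : cube_avg g x ^+ 2 <= cube_avg (fun y => g y ^+ 2) x.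
Proof.
have K0 : 0 <= K by exact: le_trans (normr_ge0 _) (gK x).
have ig := integrable_cube x.
have mgx : measurable_fun cube (fun z => g (x + z)) by apply: measurable_funTS; exact: measurable_shiftr.
have ig2 : lebesgue_rV.-integrable cube (EFin \o (fun z => g (x + z) ^+ 2)).
  apply: (integrable_bounded (K := K ^+ 2)) => //; first exact: measurable_funX.
  by move=> z _; rewrite normrX ler_pXn2r ?nnegrE// gK.
have V0 := cube_vol_gt0.
set m := cube_avg g x.
have mE : \int[lebesgue_rV]_(z in cube) g (x + z) = cube_vol * m.
  by rewrite /m /cube_avg mulrA divff ?mul1r// gt_eqF.
have iZ : lebesgue_rV.-integrable cube (EFin \o (fun z => (2 * m) * g (x + z))).
  apply: (integrable_bounded (K := `|2 * m| * K)) => //; first exact: measurable_funM.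
  by move=> z _; rewrite normrM ler_wpM2l.
have ic : lebesgue_rV.-integrable cube (EFin \o (fun z => m ^+ 2)).
  by apply: (integrable_bounded (K := `|m ^+ 2|)).
have iB : lebesgue_rV.-integrable cube (EFin \o (fun z => g (x + z) ^+ 2 - (2 * m) * g (x + z))).
  by have := integrableB mQ ig2 iZ; apply: eq_integrable.
have : 0 <= \int[lebesgue_rV]_(z in cube) (g (x + z) ^+ 2 - (2 * m) * g (x + z) + m ^+ 2).
  by apply: Rintegral_ge0 => z _; have := sqr_ge0 (g (x + z) - m); rewrite sqrrB; lra.
rewrite RintegralD// RintegralB// RintegralZl// Rintegral_cst// mE -/cube_vol.
set I2 := \int[lebesgue_rV]_(z in cube) _ => h.
rewrite /cube_avg ler_pdivlMl// -/I2 mulrC -subr_ge0.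
by rewrite (_ : I2 - _ = I2 - 2 * m * (cube_vol * m) + m ^+ 2 * cube_vol)//; ring.
Qed.

End bounded.

(** The total area of n faces of the cube, one per direction, divided by its volume. *)
Definition cube_lip : R := cube_vol^-1 * \sum_(i < n) \prod_(j < n | j != i) eta.

(** A point that leaves the cube under the shift does so in some coordinate i, so it lies in a slab
    [B i] of thickness at most |s_i|. *)
Lemma lebesgue_cube_shift (s : 'rV[R]_n) :
  (lebesgue_rV [set z : 'rV[R]_n | cube z /\ ~ cube (z + s)%R] <=
   ((\sum_(i < n) \prod_(j < n | j != i) eta) * `|s|)%:E)%E.
Proof.
pose A i j : set (measurableTypeR R) := if j == i then `[0, eta]%classic `\` [set t | 0 <= t + s ord0 i <= eta]
  else `[0, eta]%classic.
pose B i := [set z : 'rV[R]_n | forall j, A i j (z ord0 j)].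
have mt i : measurable [set t : measurableTypeR R | 0 <= t + s ord0 i <= eta].
  rewrite (_ : [set t | _] = `[- s ord0 i, eta - s ord0 i]%classic); first exact: measurable_itv.
  by apply/seteqP; split => t /=; rewrite in_itv/= lerBrDr -lerBlDr sub0r.
have mA i j : measurable (A i j).
  rewrite /A; case: ifP => _; last exact: measurable_itv.
  by apply: measurableD => //; exact: measurable_itv.
have mB i : measurable (B i).
  rewrite (_ : B i = \bigcap_(j in [set: 'I_n]) ((fun z : 'rV[R]_n => z ord0 j) @^-1` A i j)).
    apply: fin_bigcap_measurable => [|j _]; first exact: finite_finset.
    by rewrite -[X in measurable X]setTI; exact: (measurable_coord j measurableT (mA i j)).
  by apply/seteqP; split => z /= h j; [move=> _; exact: h|exact: h].
have mQs : measurable [set z | cube z /\ ~ cube (z + s)].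
  apply: measurableI => //; apply: measurableC.
  by rewrite -[X in measurable X]setTI; exact: measurable_rV_shift.
have si i : `|s ord0 i| <= `|s|.
  rewrite [leRHS]mx_normrE; exact: (le_bigmax _ (fun ij : 'I_1 * 'I_n => `|s ij.1 ij.2|) (ord0, i)).
have BE i : (lebesgue_rV (B i) <= ((\prod_(j < n | j != i) eta) * `|s|)%:E)%E.
  rewrite lebesgue_rV_box// (bigD1 i)//= mulrC EFinM -prode_EFin.
  apply: lee_pmul => //.
  - by apply: prode_ge0.
  - rewrite /A eqxx.
    have [s0|s0] := leP 0 (s ord0 i).
      apply: (@le_trans _ _ (leb `[eta - s ord0 i, eta]%classic)).
        apply: le_measure; rewrite ?inE; [by apply: measurableD => //; exact: measurable_itv|exact: measurable_itv|].
        move=> t [/=]; rewrite !in_itv/= => /andP[t0 te] nt; rewrite te andbT leNgt; apply/negP => h.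
        by apply: nt; lra.
      rewrite lebesgue_measure_itv/= lte_fin; case: ifP => _; last by rewrite lee_fin.
      by rewrite -EFinB lee_fin; have := si i; rewrite ger0_norm//; lra.
    apply: (@le_trans _ _ (leb `[0, - s ord0 i]%classic)).
      apply: le_measure; rewrite ?inE; [by apply: measurableD => //; exact: measurable_itv|exact: measurable_itv|].
      move=> t [/=]; rewrite !in_itv/= => /andP[t0 te] nt; rewrite t0/= leNgt; apply/negP => h.
      by apply: nt; lra.
    rewrite lebesgue_measure_itv/= lte_fin; case: ifP => _; last by rewrite lee_fin.
    by rewrite -EFinB lee_fin; have := si i; rewrite ltr0_norm//; lra.
  - rewrite le_eqVlt; apply/orP; left; apply/eqP; apply: eq_bigr => j ji.
    by rewrite /A (negbTE ji) lebesgue_cube_side.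
rewrite -[X in (lebesgue_rV X <= _)%E]setIT -integral_indic//.
apply: (@le_trans _ _ (\int[lebesgue_rV]_z \sum_(i <- index_enum 'I_n) (\1_(B i) z)%:E)%E).
  apply: ge0_le_integral => //.
  - by apply/measurable_EFinP.
  - by apply: emeasurable_sum => i; apply/measurable_EFinP.
  move=> z _; rewrite indicE; case: (boolP (z \in _)) => [|_]; last first.
    by apply: sume_ge0 => i _; rewrite lee_fin.
  rewrite inE/= => -[Qz nQ].
  have [i ni] : exists i, ~ (0 <= z ord0 i + s ord0 i <= eta).
    apply: contrapT => /forallNP h; apply: nQ => i; rewrite mxE.
    by apply: contrapT; exact: h.
  rewrite (bigD1 i)//= -[leLHS]adde0; apply: leeD.
    rewrite indicE mem_set// => j; rewrite /A; case: eqP => [->|_]; last by rewrite /= in_itv/=; exact: Qz.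
    by split => //=; rewrite in_itv/=; exact: Qz.
  by apply: sume_ge0 => j _; rewrite lee_fin.
rewrite ge0_integral_sum//; last first.
- by move=> i; apply/measurable_EFinP.
rewrite mulr_suml -sumEFin; apply: lee_sum => i _.
by rewrite integral_indic// setIT; exact: BE.
Qed.

(** Two averages are integrals over translates of one cube, which differ by a set of measure O(|x -
    x'|). *)
Lemma cube_avg_lip (g : 'rV[R]_n -> R) (K : R) : measurable_fun setT g ->
  (forall x, `|g x| <= K) ->
  forall x x', `|cube_avg g x - cube_avg g x'| <= 2 * K * cube_lip * `|x - x'|.
Proof.
move=> mg gK.
have K0 : 0 <= K by exact: le_trans (normr_ge0 _) (gK 0).
have V0 := cube_vol_gt0.
(* The values of [h] lie in [0, 2K], so dropping the part of one cube outside the other costs at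
   most 2K times its volume. *)
pose h x : R := g x + K.
have mh : measurable_fun setT h by exact: measurable_funD.
have h0 x : 0 <= h x by rewrite /h; have := gK x; rewrite ler_norml; lra.
have h2 x : h x <= 2 * K by rewrite /h; have := gK x; rewrite ler_norml; lra.
pose Sum := \sum_(i < n) \prod_(j < n | j != i) eta.
have intE x : ((\int[lebesgue_rV]_(z in cube) g (x + z) + K * cube_vol)%R%:E =
    \int[lebesgue_rV]_w (h w * \1_cube (w - x))%:E)%E.
  rewrite -Rintegral_cst// -RintegralD//; [|exact: integrable_cube|]; last first.
    by apply: (integrable_bounded (K := `|K|)).
  rewrite /Rintegral fineK; last first.
    apply: integrable_fin_num => //; apply: (integrable_bounded (K := 2 * K)) => //.
      by apply: measurable_funTS; apply: measurable_funD => //; exact: measurable_shiftr.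
    by move=> z _; rewrite ger0_norm; [exact: h2|exact: h0].
  rewrite -(ge0_integral_rV_shift x); last 2 first.
  - apply/measurable_EFinP; apply: measurable_funM => //.
    by apply: measurableT_comp => //; exact: measurable_rV_shift.
  - by move=> w; rewrite lee_fin mulr_ge0.
  rewrite integral_mkcond; apply: eq_integral => z _.
  rewrite patchE addrK indicE /h [z + x]addrC; case: ifPn => _; first by rewrite mulr1.
  by rewrite mulr0.
have le1 x x' : \int[lebesgue_rV]_(z in cube) g (x + z) <=
    \int[lebesgue_rV]_(z in cube) g (x' + z) + 2 * K * (Sum * `|x - x'|).
  rewrite -(lerD2r (K * cube_vol)) -lee_fin intE addrAC EFinD intE.
  have mI (y : 'rV[R]_n) : measurable_fun setT (fun w : 'rV[R]_n => \1_cube (w - y) : R).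
    by apply: measurableT_comp => //; exact: measurable_rV_shift.
  pose E := [set w : 'rV[R]_n | cube (w - x) /\ ~ cube (w - x')].
  have EE : E = (fun w => w - x) @^-1` [set z | cube z /\ ~ cube (z + (x - x'))].
    by apply/seteqP; split => w /=; rewrite /E/= addrA subrK.
  have mQs : measurable [set z | cube z /\ ~ cube (z + (x - x'))].
    apply: measurableI => //; apply: measurableC.
    by rewrite -[X in measurable X]setTI; exact: measurable_rV_shift.
  have mE : measurable E.
    by rewrite EE -[X in measurable X]setTI; exact: measurable_rV_shift.
  apply: (@le_trans _ _ (\int[lebesgue_rV]_w ((h w * \1_cube (w - x'))%:E + (2 * K)%:E * (\1_E w)%:E))%E).
    apply: ge0_le_integral => //.
    - by move=> w _; rewrite lee_fin mulr_ge0.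
    - by apply/measurable_EFinP; exact: measurable_funM.
    - apply: emeasurable_funD; first by apply/measurable_EFinP; exact: measurable_funM.
      by apply: measurable_funeM; apply/measurable_EFinP.
    move=> w _; rewrite -EFinM -EFinD lee_fin !indicE.
    have [Qx|_] := boolP (w - x \in cube); last first.
      by rewrite mulr0 addr_ge0// mulr_ge0// mulr_ge0.
    have [Qx'|Qx'] := boolP (w - x' \in cube); first by rewrite lerDl !mulr_ge0.
    rewrite mulr1 mulr0 add0r mem_set ?mulr1 ?h2//.
    by split; [rewrite inE in Qx|rewrite notin_setE in Qx'].
  rewrite ge0_integralD//; last 4 first.
  - by move=> w _; rewrite lee_fin mulr_ge0.
  - by apply/measurable_EFinP; exact: measurable_funM.
  - by move=> w _; rewrite mule_ge0// lee_fin ?mulr_ge0.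
  - by apply: measurable_funeM; apply/measurable_EFinP.
  apply: leeD => //; rewrite ge0_integralZl//; last 2 first.
  - by apply/measurable_EFinP.
  - by rewrite lee_fin mulr_ge0.
  rewrite integral_indic// setIT [leRHS]EFinM; apply: lee_wpmul2l; first by rewrite lee_fin mulr_ge0.
  have := lebesgue_cube_shift (x - x'); rewrite -(lebesgue_rV_shift (- x) mQs) -EE; exact.
move=> x x'; rewrite /cube_avg -mulrBr normrM gtr0_norm ?invr_gt0//.
rewrite /cube_lip -/Sum ler_pdivrMl//.
have -> : cube_vol * (2 * K * (cube_vol^-1 * Sum) * `|x - x'|) = 2 * K * (Sum * `|x - x'|).
  by field; exact: lt0r_neq0.
have ab (a b c : R) : a <= b + c -> b <= a + c -> `|a - b| <= c by rewrite ler_norml; lra.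
by apply: ab; [exact: le1|rewrite [`|x - x'|]distrC; exact: le1].
Qed.

End cube_average.

(** * Derivatives and Taylor expansion of the averages *)

Section smoothing.
Context {R : realType} {n : nat}.
Variables (F : 'rV[R]_n -> R) (L B eta : R).
Hypotheses (lipF : forall x y, `|F x - F y| <= L * `|x - y|)
  (FB : forall x, `|F x| <= B) (eta0 : 0 < eta).

Let mF : measurable_fun setT F.
Proof. by apply: continuous_measurable_rV; exact: lipschitz_continuous lipF. Qed.

Let mQ : measurable (cube eta : set 'rV[R]_n). Proof. exact: measurable_cbox. Qed.
Let Qoo : (lebesgue_rV (cube eta : set 'rV[R]_n) < +oo)%E. Proof. exact: lebesgue_rV_cbox_lty. Qed.

Lemma cube_avg_cvg (g_ : nat -> 'rV[R]_n -> R) (g : 'rV[R]_n -> R) (K : R) (N : set 'rV[R]_n) :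
  (forall m, measurable_fun setT (g_ m)) -> measurable_fun setT g ->
  (forall m x, `|g_ m x| <= K) -> (forall x, `|g x| <= K) ->
  measurable N -> lebesgue_rV N = 0%E -> (forall x, ~ N x -> g_ m x @[m --> \oo] --> g x) ->
  forall x, cube_avg eta (g_ m) x @[m --> \oo] --> cube_avg eta g x.
Proof.
move=> mg_ mg gK_ gK mN N0 gg x; rewrite /cube_avg; apply: cvgM; first exact: cvg_cst.
rewrite /Rintegral; apply: fine_cvg; rewrite fineK; last first.
  by apply: integrable_fin_num => //; exact: (integrable_cube eta mg gK).
have [|||||_ _] := @dominated_convergence _ _ _ lebesgue_rV (cube eta) mQ
    (fun m (z : 'rV[R]_n) => (g_ m (x + z))%:E) (fun z => (g (x + z))%:E) (fun=> K%:E); last exact.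
- by move=> m; apply/measurable_EFinP; apply: measurable_funTS; exact: measurable_shiftr.
- by apply/measurable_EFinP; apply: measurable_funTS; exact: measurable_shiftr.
- exists [set z | N (z + x)]; split.
  + by rewrite -[X in measurable X]setTI; exact: measurable_rV_shift.
  + by rewrite -N0; exact: lebesgue_rV_shift.
  move=> z /= nz; apply: contrapT => Nz; apply: nz => _.
  by apply: cvg_EFin; [exact: nearW|apply: gg; rewrite addrC].
- by apply: (integrable_bounded (K := `|K|)).
- by apply: aeW => z m _; rewrite lee_fin.
Qed.

Lemma diffq_dcvg i x : partial_dom F i x -> diffq F i h x @[h --> 0^'] --> gpartial F i x.
Proof.
move=> Ax; rewrite /gpartial mem_set//; move: Ax => /(partial_domP F).
by rewrite /derivable diffqE /partial /derive -/(evec i) diffqE.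
Qed.

Lemma cube_avg_diffq i h x : diffq (cube_avg eta F) i h x = cube_avg eta (diffq F i h) x.
Proof.
rewrite /diffq /cube_avg RintegralZl//; last first.
  have := integrableB mQ (integrable_cube eta mF FB (x + h *: evec i)) (integrable_cube eta mF FB x).
  by apply: eq_integrable => // z _; rewrite /= addrAC.
rewrite -mulrBr mulrCA; congr (_ * (_ * _)).
rewrite -RintegralB//; [|exact: (integrable_cube eta mF FB)|exact: (integrable_cube eta mF FB)].
by apply: eq_Rintegral => z _; rewrite addrAC.
Qed.

(** Averaging commutes with difference quotients, which are bounded by |L| and converge almost
    everywhere; dominated convergence then gives the derivative at every point. *)
Lemma cube_avg_dcvg i x :
  diffq (cube_avg eta F) i h x @[h --> 0^'] --> cube_avg eta (gpartial F i) x.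
Proof.
under eq_fun do rewrite cube_avg_diffq.
apply/cvgr_dnbhsP => u u0.
apply: (@cube_avg_cvg (fun m => diffq F i (u m)) _ `|L| (~` partial_dom F i)).
- by move=> m; apply: continuous_measurable_rV; exact: continuous_diffq lipF _ _.
- exact: measurable_gpartial lipF _.
- by move=> m y; exact: diffq_le lipF _ _ _.
- by move=> y; exact: gpartial_le lipF _ _.
- by apply: measurableC; exact: measurable_partial_dom lipF _.
- exact: lebesgue_partial_domC lipF _.
move=> y /contrapT /diffq_dcvg /cvgr_dnbhsP; exact.
Qed.

Lemma cube_avg_is_derive i (p : 'rV[R]_n) (t : R) :
  is_derive t 1 (fun s : R => cube_avg eta F (p + s *: evec i)) (cube_avg eta (gpartial F i) (p + t *: evec i)).
Proof.
set psi := fun s : R => _.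
have E : (fun h : R => h^-1 *: ((psi \o shift t) (h *: (1 : R)) - psi t)) =
    (fun h => diffq (cube_avg eta F) i h (p + t *: evec i)).
  apply/funext => h; rewrite /diffq /psi /= /shift /=.
  have -> : h%:A = h :> R by rewrite /GRing.scale/= mulr1.
  by rewrite scalerDl [h *: _ + _]addrC addrA.
have D := @cube_avg_dcvg i (p + t *: evec i).
apply: DeriveDef; first by rewrite /derivable E; apply/cvg_ex; eexists; exact: D.
by rewrite /derive E; apply: cvg_lim D.
Qed.

Definition avg_lip : R := 2 * `|L| * cube_lip (n := n) eta.

(** The gain from averaging: a merely bounded gradient becomes Lipschitz, whence a quadratic Taylor
    remainder. *)
Lemma cube_avg_gpartial_lip i x y :
  `|cube_avg eta (gpartial F i) x - cube_avg eta (gpartial F i) y| <= avg_lip * `|x - y|.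
Proof.
apply: cube_avg_lip => //; first exact: measurable_gpartial lipF _.
by move=> z; exact: gpartial_le lipF _ _.
Qed.

Lemma avg_lip_ge0 : 0 <= avg_lip.
Proof.
rewrite /avg_lip mulr_ge0// /cube_lip mulr_ge0// ?invr_ge0; first exact/ltW/cube_vol_gt0.
by apply: sumr_ge0 => i _; apply: prodr_ge0 => j _; exact: ltW.
Qed.

Lemma cube_avg_taylor_coord i p (t : R) :
  `|cube_avg eta F (p + t *: evec i) - cube_avg eta F p - t * cube_avg eta (gpartial F i) p| <=
  avg_lip * t ^+ 2.
Proof.
pose psi (s : R) := cube_avg eta F (p + s *: evec i).
pose psi' (s : R) := cube_avg eta (gpartial F i) (p + s *: evec i).
have dpsi (s : R) : is_derive s 1 psi (psi' s) by exact: cube_avg_is_derive.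
have cpsi : continuous psi.
  by move=> s; apply: differentiable_continuous; apply/derivable1_diffP; exact: ex_derive.
have [c cle cE] : exists2 c, `|c| <= `|t| & psi t - psi 0 = psi' c * t.
  have [t0|t0] := leP 0 t.
    have [|c] := @MVT_segment _ psi psi' 0 t t0; first exact: continuous_subspaceT.
    by rewrite in_itv/= subr0 => /andP[c0 ct] E; exists c; rewrite // !ger0_norm.
  have [|c] := @MVT_segment _ psi psi' t 0 (ltW t0); first exact: continuous_subspaceT.
  rewrite in_itv/= sub0r => /andP[tc c0] E; exists c; first by rewrite !ler0_norm ?lerN2// ltW.
  by rewrite -[LHS]opprB E mulrN opprK.
have -> : cube_avg eta F p = psi 0 by rewrite /psi scale0r addr0.
rewrite -/(psi t) cE [t * _]mulrC -mulrBl normrM.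
apply: (@le_trans _ _ (avg_lip * `|c| * `|t|)).
  apply: ler_wpM2r => //; apply: (le_trans (cube_avg_gpartial_lip _ _ _)).
  rewrite addrC addKr; apply: ler_wpM2l; [exact: avg_lip_ge0|exact: norm_scale_evec_le].
rewrite -mulrA; apply: ler_wpM2l; first exact: avg_lip_ge0.
by rewrite -real_normK ?num_real// expr2 ler_wpM2r.
Qed.

(** The coordinates are moved one at a time. After j moves the partial derivative is off by at most
    [avg_lip] j D, so a move adds at most (j + 1) [avg_lip] D^2 to the remainder, and these sum to
    at most n^2 [avg_lip] D^2. *)
Lemma cube_avg_taylor (x d : 'rV[R]_n) (D : R) : (forall i, `|d ord0 i| <= D) ->
  `|cube_avg eta F (x + d) - cube_avg eta F x - \sum_(i < n) d ord0 i * cube_avg eta (gpartial F i) x| <=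
  n%:R ^+ 2 * avg_lip * D ^+ 2.
Proof.
move=> dD; have M0 := avg_lip_ge0.
pose S s := \sum_(i <- s) d ord0 i *: evec i.
have S_le s : `|S s| <= (size s)%:R * D.
  elim: s => [|i s ih]; first by rewrite /S big_nil normr0 mul0r.
  rewrite /S big_cons /= -[(size s).+1]add1n natrD mulrDl mul1r; apply: (le_trans (ler_normD _ _)).
  by apply: lerD => //; apply: (le_trans (norm_scale_evec_le _ _)).
have H s : `|cube_avg eta F (x + S s) - cube_avg eta F x -
    \sum_(i <- s) d ord0 i * cube_avg eta (gpartial F i) x| <= (size s)%:R ^+ 2 * avg_lip * D ^+ 2.
  elim: s => [|i s ih].
    by rewrite /S !big_nil addr0 !subrr normr0 expr0n/= !mul0r.
  have -> : S (i :: s) = S s + d ord0 i *: evec i by rewrite /S big_cons addrC.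
  rewrite big_cons addrA.
  have T := cube_avg_taylor_coord i (x + S s) (d ord0 i).
  have D0 : 0 <= D by exact: le_trans (normr_ge0 _) (dD i).
  have G : `|d ord0 i * (cube_avg eta (gpartial F i) (x + S s) - cube_avg eta (gpartial F i) x)| <=
      avg_lip * (size s)%:R * D ^+ 2.
    rewrite normrM (_ : _ * _ * _ = D * (avg_lip * ((size s)%:R * D))); last by ring.
    apply: ler_pM => //; apply: (le_trans (cube_avg_gpartial_lip _ _ _)).
    by apply: ler_wpM2l => //; rewrite addrC addKr.
  have d2 : avg_lip * d ord0 i ^+ 2 <= avg_lip * D ^+ 2.
    by apply: ler_wpM2l => //; rewrite -real_normK ?num_real// ler_pXn2r ?nnegrE.
  have s0 : 0 <= (size s)%:R * avg_lip * D ^+ 2 :> R by apply: mulr_ge0; [exact: mulr_ge0|exact: sqr_ge0].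
  rewrite /= -[(size s).+1]add1n natrD.
  move: ih G T d2 s0.
  set a := cube_avg eta F (x + S s); set a0 := cube_avg eta F x.
  set a1 := cube_avg eta F _; set g := cube_avg eta (gpartial F i) _.
  set g0 := cube_avg eta (gpartial F i) _; set sg := \sum_(j <- s) _.
  move: (a) (a0) (a1) (g) (g0) (sg) (d ord0 i) ((size s)%:R : R) (avg_lip) => b b0 b1 h h0 sh e z M ih G T d2 s0.
  have -> : b1 - b0 - (e * h0 + sh) = (b - b0 - sh) + (b1 - b - e * h) + e * (h - h0) by ring.
  apply: (le_trans (ler_normD _ _)); apply: (le_trans (lerD (ler_normD _ _) (lexx _))).
  apply: (le_trans (lerD (lerD ih T) G)).
  rewrite -subr_ge0 (_ : _ - _ = (M * D ^+ 2 - M * e ^+ 2) + z * M * D ^+ 2); last by ring.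
  by rewrite addr_ge0// subr_ge0.
have dE : S (enum 'I_n) = d.
  apply/rowP => j; rewrite /S big_enum summxE (bigD1 j)//= big1 => [|i ij]; last first.
    by rewrite mxE evecE eq_sym (negbTE ij) mulr0.
  by rewrite mxE evecE eqxx mulr1 addr0.
by have := H (enum 'I_n); rewrite dE big_enum size_enum_ord.
Qed.

End smoothing.

(** * The variance inequality for smooth functions *)

Section elementary_bounds.
Context {R : realType}.

(** The mean value theorem for f = exp minus its second Taylor polynomial: f' >= 0 settles t >= 0,
    and f' <= t^2 between t and 0 settles t < 0. *)
Lemma expR_taylor2_ge (t : R) : 1 + t + t ^+ 2 / 2 - `|t| ^+ 3 <= expR t.
Proof.
pose f (s : R) : R := expR s - (1 + s + s ^+ 2 / 2).
pose f' (s : R) : R := expR s - (1 + s).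
have df (s : R) : is_derive s 1 f (f' s).
  have h : is_derive s 1 (fun u : R => u ^+ 2) (2 * s).
    by apply: is_derive_eq; rewrite /GRing.scale/= !mulr1 mulr_natl mulr2n.
  have h1 : is_derive s 1 (fun u : R => u ^+ 2 / 2) s.
    have -> : (fun u : R => u ^+ 2 / 2) = (2^-1 : R) *: (fun u : R => u ^+ 2).
      by apply/funext => u; rewrite fctE /= mulrC.
    by have := is_deriveZ (2^-1 : R) h; rewrite /GRing.scale/= mulKf.
  have h2 : is_derive s 1 (fun u : R => 1 + u) 1.
    by have := is_deriveD (is_derive_cst (1 : R) s (1 : R)) (is_derive_id s (1 : R)); rewrite add0r.
  exact: is_deriveB (is_derive_expR s) (is_deriveD h2 h1).
have cf : continuous f.
  by move=> s; apply: differentiable_continuous; apply/derivable1_diffP; exact: ex_derive.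
have f0 : f 0 = 0 by rewrite /f expR0 expr0n/= mul0r; ring.
have [t0|t0] := leP 0 t.
  have [|c] := @MVT_segment _ f f' 0 t t0; first exact: continuous_subspaceT.
  rewrite in_itv/= !subr0 f0 subr0 => /andP[c0 ct] E.
  have f'c : 0 <= f' c by rewrite /f' subr_ge0 expR_ge1Dx.
  have : 0 <= f t by rewrite E mulr_ge0.
  by rewrite /f; have := exprn_ge0 3 (normr_ge0 t); lra.
have [|c] := @MVT_segment _ f f' t 0 (ltW t0); first exact: continuous_subspaceT.
rewrite in_itv/= f0 !sub0r => /andP[tc c0] E.
have f'c : f' c <= t ^+ 2.
  have : expR c <= 1 + c + c ^+ 2.
    have c1 : 0 < 1 - c by lra.
    have : expR c * (1 - c) <= 1.
      have := expR_ge1Dx (- c); rewrite expRN => h.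
      by rewrite -[leRHS](@mulfV _ (expR c)) ?gt_eqF ?expR_gt0// ler_pM2l ?expR_gt0.
    move=> h; rewrite -(ler_pM2r c1); apply: (le_trans h); nra.
  by rewrite /f'; nra.
have : - f t <= t ^+ 2 * (- t) by rewrite E ler_wpM2r// oppr_ge0 ltW.
rewrite /f (ltr0_norm t0); lra.
Qed.

Lemma expR_taylor1_le (t : R) : 0 <= t <= 1 / 2 -> expR t <= 1 + t + 2 * t ^+ 2.
Proof.
move=> /andP[t0 t1].
have : expR t * (1 - t) <= 1.
  have := expR_ge1Dx (- t); rewrite expRN => h.
  by rewrite -[leRHS](@mulfV _ (expR t)) ?gt_eqF ?expR_gt0// ler_pM2l ?expR_gt0.
have c1 : 0 < 1 - t by lra.
by move=> h; rewrite -(ler_pM2r c1); apply: (le_trans h); nra.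
Qed.

Lemma pow1D_taylor k : exists2 c : R, 0 <= c & forall a, `|a| <= 1 ->
  `|(1 + a) ^+ k - 1 - k%:R * a| <= c * a ^+ 2.
Proof.
elim: k => [|k [c c0 ih]].
  by exists 0 => // a _; rewrite expr0 mul0r !subrr normr0 mul0r.
exists (2 * c + k%:R); first by rewrite addr_ge0 ?mulr_ge0.
move=> a a1.
have -> : (1 + a) ^+ k.+1 - 1 - k.+1%:R * a =
    (1 + a) * ((1 + a) ^+ k - 1 - k%:R * a) + k%:R * a ^+ 2.
  by rewrite exprS -natr1; ring.
apply: (le_trans (ler_normD _ _)); rewrite [leRHS]mulrDl; apply: lerD; last first.
  by rewrite ger0_norm// mulr_ge0// sqr_ge0.
rewrite normrM -mulrA; apply: ler_pM => //; last exact: ih.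
by apply: (le_trans (ler_normD _ _)); rewrite normr1; lra.
Qed.

(** Optimises over the relative difference a of the two endpoints; this is where the final constant
    arises. *)
Lemma complete_square (P q a : R) : 0 < q -> 2 * P * a - q * a ^+ 2 <= P ^+ 2 / q.
Proof.
move=> q0; rewrite -subr_ge0.
have -> : P ^+ 2 / q - (2 * P * a - q * a ^+ 2) = (P - q * a) ^+ 2 / q by field; exact: lt0r_neq0.
by rewrite divr_ge0 ?sqr_ge0// ltW.
Qed.

Lemma prod_1Bsqr_le n (k : nat) (a : 'I_n -> R) : (forall i, `|a i| <= 1) ->
  \prod_(i < n) (1 - a i ^+ 2) ^+ k <= expR (- k%:R * \sum_(i < n) a i ^+ 2).
Proof.
move=> a1; rewrite mulr_sumr expR_sum; apply: ler_prod => i _.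
have a2 : 0 <= 1 - a i ^+ 2.
  by rewrite subr_ge0 -real_normK ?num_real// expr_le1.
rewrite exprn_ge0//= mulNr -mulrN expRM_natl lerXn2r ?nnegrE ?expR_ge0//.
exact: expR_ge1Dx.
Qed.

End elementary_bounds.

Lemma vmidE {R : realType} {n : nat} (y y' : 'rV[R]_n) : vmid y y' = 2^-1 *: y + (1 - 2^-1) *: y'.
Proof. by rewrite /vmid scalerDr; congr (_ + _ *: _); lra. Qed.

Lemma vpow_cbox {R : realType} {n : nat} (k : nat) (a b : R) (y y' : 'rV[R]_n) (t : R) :
  (0 < k)%N -> 0 <= t <= 1 -> orthant R n y -> orthant R n y' ->
  cbox a b (vpow k y) -> cbox a b (vpow k y') -> cbox a b (vpow k (t *: y + (1 - t) *: y')).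
Proof.
move=> k0 t01 y0 y'0 Ky Ky' i.
have := Ky i; have := Ky' i; rewrite !mxE => /andP[h1 h2] /andP[h3 h4].
have := y0 i; have := y'0 i => p' p; have /andP[t0 t1] := t01.
set s := y ord0 i in h3 h4 p *; set u := y' ord0 i in h1 h2 p' *.
have c0 : 0 <= t * s + (1 - t) * u by rewrite addr_ge0// mulr_ge0 ?subr_ge0// ltW.
have [su|/ltW us] := leP s u; apply/andP; split.
- by apply: (le_trans h3); rewrite ler_pXn2r ?nnegrE ?(ltW p)//; nra.
- by apply: (le_trans _ h2); rewrite ler_pXn2r ?nnegrE ?(ltW p')//; nra.
- by apply: (le_trans h1); rewrite ler_pXn2r ?nnegrE ?(ltW p')//; nra.
- by apply: (le_trans _ h4); rewrite ler_pXn2r ?nnegrE ?(ltW p)//; nra.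
Qed.

(** * Second-order comparison of two points with their midpoint *)

Section taylor_midpoint.
Context {R : realType} {n : nat}.
Variables (k : nat) (a b : R) (F : 'rV[R]_n -> R) (G : 'I_n -> 'rV[R]_n -> R) (L M : R).
Hypotheses (k0 : (0 < k)%N) (a0 : 0 < a) (GL : forall i x, `|G i x| <= L)
  (taylor : forall (x d : 'rV[R]_n) (D : R), (forall i, `|d ord0 i| <= D) ->
    `|F (x + d) - F x - \sum_(i < n) d ord0 i * G i x| <= M * D ^+ 2).

(** Parametrises the endpoints by their midpoint m as y = m (1 + a) and y' = m (1 - a), so that y y'
    = m^2 (1 - a^2). *)
Definition reldiff (y y' : 'rV[R]_n) (i : 'I_n) : R :=
  (y ord0 i - y' ord0 i) / (y ord0 i + y' ord0 i).

Lemma reldiff_le y y' i : orthant R n y -> orthant R n y' -> `|reldiff y y' i| <= 1.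
Proof.
move=> y0 y'0; have := y0 i; have := y'0 i => h h'.
rewrite /reldiff normrM normfV ler_pdivrMr ?mul1r; last by rewrite gtr0_norm addr_gt0.
by rewrite [leRHS]gtr0_norm ?addr_gt0// ler_norml; lra.
Qed.

Lemma vmid_reldiffl y y' i : orthant R n y -> orthant R n y' ->
  y ord0 i = vmid y y' ord0 i * (1 + reldiff y y' i).
Proof.
move=> y0 y'0; have := y0 i; have := y'0 i => h h'.
by rewrite /vmid /reldiff !mxE; field; apply: lt0r_neq0; exact: addr_gt0.
Qed.

Lemma vmid_reldiffr y y' i : orthant R n y -> orthant R n y' ->
  y' ord0 i = vmid y y' ord0 i * (1 - reldiff y y' i).
Proof.
move=> y0 y'0; have := y0 i; have := y'0 i => h h'.
by rewrite /vmid /reldiff !mxE; field; apply: lt0r_neq0; exact: addr_gt0.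
Qed.

Lemma vmid_orthant (y y' : 'rV[R]_n) : orthant R n y -> orthant R n y' -> orthant R n (vmid y y').
Proof. by move=> y0 y'0 i; rewrite /vmid !mxE mulr_gt0// addr_gt0. Qed.

Lemma vmid_cbox y y' : orthant R n y -> orthant R n y' -> cbox a b (vpow k y) -> cbox a b (vpow k y') ->
  cbox a b (vpow k (vmid y y')).
Proof. by move=> *; rewrite vmidE; apply: vpow_cbox => //; rewrite invr_ge0 ler0n invf_le1 ?ler1n. Qed.

Lemma vjac_reldiff y y' : orthant R n y -> orthant R n y' ->
  vjac k y * vjac k y' <= vjac k (vmid y y') ^+ 2 * expR (- k.-1%:R * \sum_(i < n) reldiff y y' i ^+ 2).
Proof.
move=> y0 y'0.
have -> : vjac k y * vjac k y' = vjac k (vmid y y') ^+ 2 * \prod_(i < n) (1 - reldiff y y' i ^+ 2) ^+ k.-1.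
  rewrite /vjac -big_split/= -prodrXl -big_split/=; apply: eq_bigr => i _.
  rewrite -exprMn [X in X * _](vmid_reldiffl i y0 y'0) [X in _ * X](vmid_reldiffr i y0 y'0).
  by rewrite -!exprM [(k.-1 * 2)%N]mulnC !exprM -exprMn; congr (_ ^+ _); ring.
apply: ler_wpM2l; first exact: sqr_ge0.
by apply: prod_1Bsqr_le => i; exact: reldiff_le.
Qed.

(** The endpoints are m^k (1 + a)^k and m^k (1 - a)^k, displaced from m^k by +k a m^k and -k a m^k
    up to O(a^2). The linear terms add up to the stated sum; everything else is quadratic in a. *)
Lemma taylor_midpoint : exists2 C : R, 0 <= C & forall y y', orthant R n y -> orthant R n y' ->
  cbox a b (vpow k y) -> cbox a b (vpow k y') ->
  F (vpow k y) - F (vpow k y') <=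
    \sum_(i < n) 2 * (k%:R * vpow k (vmid y y') ord0 i * G i (vpow k (vmid y y'))) * reldiff y y' i +
    C * \sum_(i < n) reldiff y y' i ^+ 2.
Proof.
have [c c0 ck] := @pow1D_taylor R k.
(* Since |a| <= 1 and m^k <= b, each coordinate of a displacement is at most b (k |a| + c a^2) <= D0
   |a|. In the constant below, the first term bounds the two Taylor remainders, the second the
   errors [e] times the gradient. *)
pose D0 := b * (k%:R + c).
exists (2 * `|M| * D0 ^+ 2 + 2 * `|b| * c * `|L|).
  apply: addr_ge0; last by rewrite !mulr_ge0.
  by apply: mulr_ge0; [exact: mulr_ge0|exact: sqr_ge0].
move=> y y' y0 y'0 Ky Ky'; set w := vmid y y'; set m := vpow k w.
have Km : cbox a b m by exact: vmid_cbox.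
pose A := Num.sqrt (\sum_(i < n) reldiff y y' i ^+ 2).
have A2 : A ^+ 2 = \sum_(i < n) reldiff y y' i ^+ 2.
  by rewrite sqr_sqrtr// sumr_ge0// => i _; exact: sqr_ge0.
have rA i : `|reldiff y y' i| <= A.
  rewrite -sqrtr_sqr ler_sqrt; last by rewrite sumr_ge0// => j _; exact: sqr_ge0.
  by rewrite (bigD1 i)//= lerDl sumr_ge0// => j _; exact: sqr_ge0.
have A0 : 0 <= A by exact: sqrtr_ge0.
have mb i : 0 < m ord0 i <= b.
  by have /andP[h ->] := Km i; rewrite (lt_le_trans a0 h).
(* The sign s, 1 or -1, treats both endpoints at once. *)
pose e (s : R) i := (1 + s * reldiff y y' i) ^+ k - 1 - k%:R * (s * reldiff y y' i).
have eP (s : R) i : `|s| = 1 -> `|e s i| <= c * reldiff y y' i ^+ 2.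
  move=> s1; have s2 : s ^+ 2 = 1 by rewrite -real_normK ?num_real// s1 expr1n.
  rewrite -[leRHS]/(c * _ ^+ 2) -[X in _ <= _ * X]mul1r -s2 -exprMn; apply: ck.
  by rewrite normrM s1 mul1r reldiff_le.
pose d s := \row_(i < n) (m ord0 i * (k%:R * (s * reldiff y y' i) + e s i)).
have dD (s : R) i : `|s| = 1 -> `|d s ord0 i| <= D0 * A.
  move=> s1; have /andP[m0 mb'] := mb i; rewrite mxE normrM (gtr0_norm m0) /D0 -mulrA.
  apply: ler_pM => //; first exact: ltW.
  apply: (le_trans (ler_normD _ _)); rewrite mulrDl; apply: lerD.
    by rewrite normrM [`|s * _|]normrM s1 mul1r [`|k%:R|]ger0_norm//; exact: ler_wpM2l.
  apply: (le_trans (eP _ _ s1)); apply: ler_wpM2l => //.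
  rewrite -real_normK ?num_real// expr2 -[leRHS]mul1r; apply: ler_pM => //.
  exact: reldiff_le.
have vE (z : 'rV[R]_n) i : vpow k z ord0 i = z ord0 i ^+ k by rewrite mxE.
have dE (s : R) i : d s ord0 i = m ord0 i * (k%:R * (s * reldiff y y' i) + e s i) by rewrite mxE.
have yE : vpow k y = m + d 1.
  apply/rowP => i; rewrite [RHS]mxE dE !vE (vmid_reldiffl i y0 y'0) exprMn -/w /e.
  by rewrite mul1r; ring.
have y'E : vpow k y' = m + d (-1).
  apply/rowP => i; rewrite [RHS]mxE dE !vE (vmid_reldiffr i y0 y'0) exprMn -/w /e.
  by rewrite mulN1r; ring.
have T1 := taylor m (fun i => dD 1 i (normr1 R)).
have T2 := taylor m (fun i => dD (-1) i (normrN1 R)).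
rewrite yE y'E.
set S0 := \sum_(i < n) 2 * _ * _.
have S1 : \sum_(i < n) d 1 ord0 i * G i m - \sum_(i < n) d (-1) ord0 i * G i m <=
    S0 + (2 * `|b| * c * `|L|) * A ^+ 2.
  rewrite A2 mulr_sumr /S0 -big_split/= -sumrB; apply: ler_sum => i _.
  rewrite !dE.
  have -> : m ord0 i * (k%:R * (1 * reldiff y y' i) + e 1 i) * G i m -
     m ord0 i * (k%:R * (-1 * reldiff y y' i) + e (-1) i) * G i m =
     2 * (k%:R * m ord0 i * G i m) * reldiff y y' i + m ord0 i * G i m * (e 1 i - e (-1) i) by ring.
  rewrite lerD2l; apply: (le_trans (ler_norm _)); rewrite normrM normrM.
  have -> : 2 * `|b| * c * `|L| * reldiff y y' i ^+ 2 =
     `|b| * `|L| * (c * reldiff y y' i ^+ 2 + c * reldiff y y' i ^+ 2) by ring.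
  apply: ler_pM => //.
    apply: ler_pM => //.
      have /andP[m0 mb'] := mb i; rewrite (gtr0_norm m0) (le_trans mb')// ler_norm//.
    exact: (le_trans (GL i m) (ler_norm _)).
  apply: (le_trans (ler_normB _ _)); apply: lerD; apply: eP; [exact: normr1|exact: normrN1].
have MD : M * (D0 * A) ^+ 2 <= `|M| * D0 ^+ 2 * A ^+ 2.
  by rewrite exprMn mulrA; apply: ler_wpM2r; rewrite ?sqr_ge0//; apply: ler_wpM2r; rewrite ?sqr_ge0// ler_norm.
rewrite -A2; move: T1 T2 S1 MD; rewrite !ler_norml.
move: (F _) (F _) (F _) (\sum_(i < n) d 1 ord0 i * G i m) (\sum_(i < n) d (-1) ord0 i * G i m) (M * _).
move=> f1 f2 f0 s1 s2 md /andP[_ T1] /andP[T2 _] S1 MD.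
rewrite mulrDl; move: MD S1; set u := `|M| * _ * _; set v := _ * A ^+ 2.
have -> : 2 * `|M| * D0 ^+ 2 * A ^+ 2 = 2 * u by rewrite /u; ring.
move: (u) (v) => u' v'; lra.
Qed.

End taylor_midpoint.

(** * Borel weights and weighted integrals *)

Section good_weight.
Context {R : realType} {n : nat}.

Lemma continuous_at_measurable (N : set 'rV[R]_n) (f : 'rV[R]_n -> R) : measurable N ->
  (forall x, ~ N x -> {for x, continuous f}) -> measurable_fun (~` N) f.
Proof.
move=> mN cf; apply: (measurability _ (RGenOpens.measurableE R)).
move=> _ [_ [a [b ->]] <-].
set U := f @^-1` _.
(* Continuity holds in the whole space at points off N, so such a point of the preimage is interior
   to it. *)
rewrite (_ : ~` N `&` U = ~` N `&` U°).
  apply: measurableI; first exact: measurableC.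
  by apply: open_measurable_rV; exact: open_interior.
apply/seteqP; split => x [nx Ux]; split => //; last exact: interior_subset.
by apply: (cf _ nx); apply: open_nbhs_nbhs; split => //; exact: interval_open.
Qed.

(** Changes [rho] on a null set only, and makes it Borel when it is continuous off [bad_set rho]. *)
Definition weight (rho : 'rV[R]_n -> R) : 'rV[R]_n -> R := rho \_ (~` bad_set rho).

Variables (k : nat) (a b C : R) (rho : 'rV[R]_n -> R).
Hypotheses (k0 : (0 < k)%N) (a0 : 0 < a) (rho0 : forall x, 0 <= rho x) (rhoC : forall x, rho x <= C)
  (rhoK : forall x, ~ cbox a b x -> rho x = 0) (qc : quasi_pconcave k rho).

Lemma cbox_orthant x : cbox a b x -> orthant R n x.
Proof. by move=> Kx i; have /andP[h _] := Kx i; exact: lt_le_trans h. Qed.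

Lemma pconcave_continuous_cbox q : ~ bad_set rho q -> {for q, continuous rho}.
Proof.
apply: (pconcave_continuous k0 qc rho0) => x nx; apply: rhoK => Kx; apply: nx.
exact: cbox_orthant.
Qed.

Lemma measurable_weight : measurable_fun setT (weight rho).
Proof.
have mN := measurable_bad_set rho; apply: (measurable_restrictT rho (measurableC mN)).1.
by apply: continuous_at_measurable => //; exact: pconcave_continuous_cbox.
Qed.

Lemma weightE x : ~ bad_set rho x -> weight rho x = rho x.
Proof. by move=> nx; rewrite /weight patchE mem_set. Qed.

Lemma weightN x : bad_set rho x -> weight rho x = 0.
Proof. by move=> nx; rewrite /weight patchE memNset// => /(_ nx). Qed.

Lemma weight_ge0 x : 0 <= weight rho x.
Proof. by rewrite /weight patchE; case: ifP. Qed.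

Lemma weight_leC x : weight rho x <= C.
Proof. by rewrite /weight patchE; case: ifP => // _; exact: le_trans (rho0 x) (rhoC x). Qed.

Lemma weightK x : ~ cbox a b x -> weight rho x = 0.
Proof. by move=> /rhoK rx; rewrite /weight patchE rx; case: ifP. Qed.

End good_weight.

Section weighted_integral.
Context {R : realType} {n : nat}.
Variables (a b C : R) (W : 'rV[R]_n -> R).
Hypotheses (mW : measurable_fun setT W) (W0 : forall x, 0 <= W x) (WC : forall x, W x <= C)
  (WK : forall x, ~ cbox a b x -> W x = 0).
Local Notation K := (cbox a b : set 'rV[R]_n).

Let mK : measurable K. Proof. exact: measurable_cbox. Qed.
Let Koo : (lebesgue_rV K < +oo)%E. Proof. exact: lebesgue_rV_cbox_lty. Qed.

Definition wint (g : 'rV[R]_n -> R) : R := \int[lebesgue_rV]_(x in K) (W x * g x).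

(** Bounded only on the box that carries the weight, so that coordinate functions qualify. *)
Definition wbounded (g : 'rV[R]_n -> R) :=
  measurable_fun setT g /\ exists B, forall x, K x -> `|g x| <= B.

Lemma wbounded_cst c : wbounded (fun=> c).
Proof. by split=> //; exists `|c|. Qed.

Lemma wboundedD f g : wbounded f -> wbounded g -> wbounded (fun x => f x + g x).
Proof.
move=> [mf [B Bf]] [mg [B' Bg]]; split; first exact: measurable_funD.
by exists (B + B') => x Kx; apply: (le_trans (ler_normD _ _)); rewrite lerD ?Bf ?Bg.
Qed.

Lemma wboundedM f g : wbounded f -> wbounded g -> wbounded (fun x => f x * g x).
Proof.
move=> [mf [B Bf]] [mg [B' Bg]]; split; first exact: measurable_funM.
by exists (B * B') => x Kx; rewrite normrM ler_pM ?Bf ?Bg.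
Qed.

Lemma wboundedZ c f : wbounded f -> wbounded (fun x => c * f x).
Proof. by apply: wboundedM; exact: wbounded_cst. Qed.

Lemma wboundedX m f : wbounded f -> wbounded (fun x => f x ^+ m).
Proof.
move=> bf; elim: m => [|m ih].
  by under eq_fun do rewrite expr0; exact: wbounded_cst.
by under eq_fun do rewrite exprS; exact: wboundedM.
Qed.

Lemma wbounded_sum (I : Type) (s : seq I) (f : I -> 'rV[R]_n -> R) : (forall i, wbounded (f i)) ->
  wbounded (fun x => \sum_(i <- s) f i x).
Proof.
move=> bf; elim: s => [|i s ih].
  by under eq_fun do rewrite big_nil; exact: wbounded_cst.
by under eq_fun do rewrite big_cons; exact: wboundedD.
Qed.

Lemma wbounded_expR f : wbounded f -> wbounded (fun x => expR (f x)).
Proof.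
move=> [mf [B Bf]]; split; first exact: measurableT_comp.
exists (expR B) => x Kx; rewrite ger0_norm ?expR_ge0// ler_expR.
exact: (le_trans (ler_norm _) (Bf _ Kx)).
Qed.

Lemma wbounded_coord i : wbounded (fun x => x ord0 i).
Proof.
split; first exact: measurable_coord.
by exists (`|a| + `|b|) => x /(_ i)/andP[ax xb]; rewrite ler_norml;
   have := ler_norm b; have := ler_norm (- a); rewrite normrN; have := normr_ge0 a; have := normr_ge0 b; lra.
Qed.

Lemma wint_integrable g : wbounded g -> lebesgue_rV.-integrable K (EFin \o (fun x => W x * g x)).
Proof.
move=> [mg [B Bg]]; apply: (integrable_bounded (K := C * B)) => //.
  by apply: measurable_funTS; exact: measurable_funM.
move=> x Kx; rewrite normrM (ger0_norm (W0 x)).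
by apply: ler_pM => //; exact: Bg.
Qed.

Lemma integral_wint g : wbounded g ->
  (\int[lebesgue_rV]_x (W x * g x)%:E = (wint g)%:E)%E.
Proof.
move=> bg; rewrite /wint /Rintegral fineK; last exact: integrable_fin_num (wint_integrable bg).
rewrite [RHS]integral_mkcond; apply: eq_integral => x _.
by rewrite patchE; case: ifPn => // nx; rewrite WK ?mul0r//; rewrite notin_setE in nx.
Qed.

Lemma wintD f g : wbounded f -> wbounded g -> wint (fun x => f x + g x) = wint f + wint g.
Proof.
move=> bf bg; rewrite /wint -RintegralD//; [|exact: wint_integrable|exact: wint_integrable].
by apply: eq_Rintegral => x _; rewrite mulrDr.
Qed.

Lemma wintZ c f : wbounded f -> wint (fun x => c * f x) = c * wint f.
Proof.
move=> bf; rewrite /wint -RintegralZl//; last exact: wint_integrable.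
by apply: eq_Rintegral => x _; rewrite mulrCA.
Qed.

Lemma wint_cst c : wint (fun=> c) = c * wint (fun=> 1).
Proof. by rewrite -wintZ; [congr wint; apply/funext => x; rewrite mulr1|exact: wbounded_cst]. Qed.

Lemma wint_sum (I : Type) (s : seq I) (f : I -> 'rV[R]_n -> R) : (forall i, wbounded (f i)) ->
  wint (fun x => \sum_(i <- s) f i x) = \sum_(i <- s) wint (f i).
Proof.
move=> bf; elim: s => [|i s ih].
  rewrite big_nil (_ : (fun x => _) = fun=> 0); last by apply/funext => x; rewrite big_nil.
  by rewrite wint_cst mul0r.
rewrite big_cons -ih -wintD//; last exact: wbounded_sum.
by congr wint; apply/funext => x; rewrite big_cons.
Qed.

Lemma wint_le f g : wbounded f -> wbounded g -> (forall x, K x -> f x <= g x) -> wint f <= wint g.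
Proof.
move=> bf bg fg; apply: le_Rintegral => //; [exact: wint_integrable|exact: wint_integrable|].
by move=> x Kx; apply: ler_wpM2l => //; exact: fg.
Qed.

Lemma wint_ge0 f : (forall x, K x -> 0 <= f x) -> 0 <= wint f.
Proof. by move=> f0; apply: Rintegral_ge0 => x Kx; rewrite mulr_ge0// f0. Qed.

End weighted_integral.

(** Cancel [I], divide by d^2 and multiply by 1/q = 2 (kr - d C1): all errors end up in d times a
    quantity independent of d. *)
Lemma second_order_compare (R : realType) (I kr C1 S J v u d q : R) : 0 < d -> d <= 1 ->
  0 <= v -> 0 <= u -> 0 <= C1 -> 0 < kr - d * C1 -> q = (2 * (kr - d * C1))^-1 ->
  I + d ^+ 2 / 2 * S - d ^+ 3 * v <= I + d ^+ 2 * q * J + d ^+ 4 * u ->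
  kr * S <= J + d * (S * C1 + 2 * kr * (v + u)).
Proof.
move=> d0 d1 v0 u0 C10 q'0 qE h.
have d2 : 0 < d ^+ 2 by exact: exprn_gt0.
have q0 : 0 < q by rewrite qE invr_gt0 mulr_gt0.
have h2 : S / 2 <= q * J + d * (v + u).
  rewrite -(ler_pM2l d2).
  have : d ^+ 4 * u <= d ^+ 3 * u.
    apply: ler_wpM2r => //; rewrite [d ^+ 4]exprS -[leRHS]mul1r; apply: ler_wpM2r => //.
    by rewrite exprn_ge0// ltW.
  rewrite (_ : d ^+ 2 * (q * J + d * (v + u)) = d ^+ 2 * q * J + d ^+ 3 * v + d ^+ 3 * u); last by ring.
  rewrite (_ : d ^+ 2 * (S / 2) = d ^+ 2 / 2 * S); last by ring.
  move: h; lra.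
have qV0 : 0 < q^-1 by rewrite invr_gt0.
move: h2; rewrite -(ler_pM2l qV0).
rewrite (_ : q^-1 * (q * J + _) = J + q^-1 * (d * (v + u))); last by field; exact: lt0r_neq0.
rewrite qE invrK.
have : d * (d * C1) * (v + u) >= 0 by apply: mulr_ge0; [apply: mulr_ge0; [exact: ltW|apply: mulr_ge0 => //; exact: ltW]|exact: addr_ge0].
rewrite (_ : 2 * (kr - d * C1) * (S / 2) = kr * S - d * (S * C1)); last by field.
rewrite (_ : 2 * (kr - d * C1) * (d * (v + u)) = d * (2 * kr * (v + u)) - 2 * (d * (d * C1) * (v + u))); last by ring.
rewrite [d * (S * C1 + _)]mulrDr; lra.
Qed.

(** * Linearisation of the Prekopa-Leindler inequality *)

Section linearised.
Context {R : realType} {n : nat}.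
Variables (k : nat) (a b C : R) (rho : 'rV[R]_n -> R).
Hypotheses (k1 : (1 < k)%N) (a0 : 0 < a) (rho0 : forall x, 0 <= rho x) (rhoC : forall x, rho x <= C)
  (rhoK : forall x, ~ cbox a b x -> rho x = 0) (qc : quasi_pconcave k rho)
  (rho_mid : forall y y', orthant R n y -> orthant R n y' ->
    rho (vpow k y) * rho (vpow k y') <= rho (vpow k (vmid y y')) ^+ 2).

Local Notation W := (weight rho).
Local Notation wi := (wint a b W).
Let k0 : (0 < k)%N. Proof. exact: ltnW. Qed.
Let mW : measurable_fun setT W. Proof. exact: (measurable_weight k0 a0 rho0 rhoK qc). Qed.
Let W0 x : 0 <= W x. Proof. exact: weight_ge0. Qed.
Let WC x : W x <= C. Proof. exact: weight_leC. Qed.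
Let WK x : ~ cbox a b x -> W x = 0. Proof. exact: weightK. Qed.

Variables (F : 'rV[R]_n -> R) (G : 'I_n -> 'rV[R]_n -> R) (C1 : R).
Hypotheses (bF : wbounded a b F) (bG : forall i, wbounded a b (G i)) (C10 : 0 <= C1)
  (FT : forall y y', orthant R n y -> orthant R n y' ->
    cbox a b (vpow k y) -> cbox a b (vpow k y') ->
    F (vpow k y) - F (vpow k y') <=
    \sum_(i < n) 2 * (k%:R * vpow k (vmid y y') ord0 i * G i (vpow k (vmid y y'))) * reldiff y y' i +
    C1 * \sum_(i < n) reldiff y y' i ^+ 2).

Definition wgrad (x : 'rV[R]_n) := \sum_(i < n) (k%:R * x ord0 i * G i x) ^+ 2.

Lemma wbounded_wgrad : wbounded a b wgrad.
Proof.
apply: wbounded_sum => i; apply: wboundedX; apply: wboundedM => //.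
by apply: wboundedZ; exact: wbounded_coord.
Qed.

(** Prekopa-Leindler for the first-order perturbations exp(d F) and exp(- d F) of the weight. The
    condition on d keeps the quadratic form in the relative differences negative, so that the square
    can be completed. *)
Lemma wint_expR (d : R) : 0 < d -> d * C1 < k.-1%:R ->
  let q := (2 * (k.-1%:R - d * C1))^-1 in
  wi (fun x => expR (d * F x)) * wi (fun x => expR (- d * F x)) <=
  wi (fun x => expR (d ^+ 2 * q * wgrad x)) ^+ 2.
Proof.
move=> d0 dC /=; set q := (2 * _)^-1.
have bE (c : R) : wbounded a b (fun x => expR (c * F x)) by apply: wbounded_expR; exact: wboundedZ.
have bQ : wbounded a b (fun x => expR (d ^+ 2 * q * wgrad x)).
  by apply: wbounded_expR; apply: wboundedZ; exact: wbounded_wgrad.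
have C0 : 0 <= C by exact: le_trans (rho0 0) (rhoC 0).
(* The weight is 0 at a bad midpoint, where the inequality could fail. [H] adds the bound C there,
   so it dominates [rho] on the box and has the same integrals. *)
pose NK := bad_set rho `&` (cbox a b : set 'rV[R]_n).
have mNK : measurable NK by apply: measurableI; [exact: measurable_bad_set|exact: measurable_cbox].
pose H x : R := W x + C * \1_NK x.
have H0 x : 0 <= H x by rewrite addr_ge0// mulr_ge0.
have mH : measurable_fun setT H by apply: measurable_funD => //; exact: measurable_funM.
have HE : (\int[lebesgue_rV]_x (H x * expR (d ^+ 2 * q * wgrad x))%:E =
    (wi (fun x => expR (d ^+ 2 * q * wgrad x)))%:E)%E.
  rewrite -(integral_wint mW W0 WC WK bQ); apply: ge0_ae_eq_integral => //.
  - by apply/measurable_EFinP; apply: measurable_funM => //; exact: bQ.1.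
  - by apply/measurable_EFinP; apply: measurable_funM => //; exact: bQ.1.
  - by move=> x _; rewrite lee_fin mulr_ge0// expR_ge0.
  - by move=> x _; rewrite lee_fin mulr_ge0// expR_ge0.
  exists (bad_set rho); split; [exact: measurable_bad_set|exact: lebesgue_bad_set|].
  move=> x /= nx; apply: contrapT => Nx; apply: nx => _; congr (_%:E).
  by rewrite /H indicE memNset ?mulr0 ?addr0// => -[].
rewrite -lee_fin EFinM -(integral_wint mW W0 WC WK (bE d)) -(integral_wint mW W0 WC WK (bE (- d))).
rewrite expr2 EFinM -HE.
apply: (@power_prekopa_leindler R k k0 n).
- by apply/measurable_EFinP; apply: measurable_funM => //; exact: (bE d).1.
- by apply/measurable_EFinP; apply: measurable_funM => //; exact: (bE (- d)).1.
- by apply/measurable_EFinP; apply: measurable_funM => //; exact: bQ.1.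
- by move=> x; rewrite lee_fin mulr_ge0// expR_ge0.
- by move=> x; rewrite lee_fin mulr_ge0// expR_ge0.
- by move=> x; rewrite lee_fin mulr_ge0// expR_ge0.
- by move=> x nx; rewrite WK ?mul0r// => Kx; apply: nx; exact: cbox_orthant Kx.
- by move=> x nx; rewrite WK ?mul0r// => Kx; apply: nx; exact: cbox_orthant Kx.
move=> y y' y0 y'0 /=; set m := vmid y y'; rewrite -!EFinM lee_fin.
set w := W (vpow k y); set w' := W (vpow k y').
have V0 (z : 'rV[R]_n) : orthant R n z -> 0 <= vjac k z.
  by move=> z0; apply: prodr_ge0 => i _; rewrite exprn_ge0// ltW.
have m0 : orthant R n m by exact: vmid_orthant.
have rhs0 : 0 <= H (vpow k m) * expR (d ^+ 2 * q * wgrad (vpow k m)) * vjac k m.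
  by rewrite mulr_ge0 ?V0// mulr_ge0// expR_ge0.
have [Ny|Ny] := pselect (bad_set rho (vpow k y)).
  by rewrite /w weightN// !mul0r mulr_ge0.
have [Ny'|Ny'] := pselect (bad_set rho (vpow k y')).
  by rewrite /w' weightN// mul0r mulr0 mul0r mulr_ge0.
have [Ky|Ky] := pselect (cbox a b (vpow k y)); last by rewrite /w WK// !mul0r mulr_ge0.
have [Ky'|Ky'] := pselect (cbox a b (vpow k y')).
  2: by rewrite /w' WK// mul0r mulr0 mul0r mulr_ge0.
have Km : cbox a b (vpow k m) by exact: vmid_cbox.
have rH : rho (vpow k m) <= H (vpow k m).
  rewrite /H indicE; have [Nm|Nm] := pselect (bad_set rho (vpow k m)).
    by rewrite mem_set// mulr1 weightN// add0r.
  by rewrite weightE// lerDl mulr_ge0.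
have wwH : w * w' <= H (vpow k m) ^+ 2.
  rewrite /w /w' !weightE//; apply: (le_trans (rho_mid y0 y'0)).
  by rewrite ler_pXn2r ?nnegrE.
pose S2 := \sum_(i < n) reldiff y y' i ^+ 2.
(* The whole exponent: first-order change of the weights minus the Gaussian gain of the Jacobian. It
   is shared by the two copies of the midpoint function, hence the factor 2 in [EQ]. *)
pose E := d * (F (vpow k y) - F (vpow k y')) - k.-1%:R * S2.
have EQ : E <= d ^+ 2 * q * wgrad (vpow k m) * 2.
  have q'0 : 0 < k.-1%:R - d * C1 by rewrite subr_gt0.
  have := ler_wpM2l (ltW d0) (FT y0 y'0 Ky Ky'); rewrite -/S2 -/m => h.
  rewrite /E; apply: (le_trans (lerB h (lexx _))).
  have -> : d ^+ 2 * q * wgrad (vpow k m) * 2 =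
     \sum_(i < n) (d * (k%:R * vpow k m ord0 i * G i (vpow k m))) ^+ 2 / (k.-1%:R - d * C1).
    rewrite /wgrad -mulr_suml; under [in RHS]eq_bigr do rewrite exprMn.
    by rewrite -mulr_sumr /q; field; exact: lt0r_neq0.
  rewrite mulrDr mulrA -addrA -mulrBl.
  rewrite (_ : d * C1 - k.-1%:R = - (k.-1%:R - d * C1)); last by ring.
  rewrite mulNr /S2 !mulr_sumr -sumrB; apply: ler_sum => i _.
  rewrite (_ : d * (2 * _ * _) = 2 * (d * (k%:R * vpow k m ord0 i * G i (vpow k m))) * reldiff y y' i).
    exact: complete_square.
  by ring.
have VV := vjac_reldiff k y0 y'0; rewrite -/S2 -/m in VV.
have E1 : expR (d * F (vpow k y)) * expR (- d * F (vpow k y')) * expR (- k.-1%:R * S2) = expR E.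
  by rewrite -!expRD; congr expR; rewrite /E; ring.
have E2 : expR E <= expR (d ^+ 2 * q * wgrad (vpow k m)) ^+ 2.
  by rewrite -expRM_natr ler_expR.
set e := expR (d * _) in E1 *; set e' := expR (- d * _) in E1 *.
set X := expR (d ^+ 2 * _ * _) in E2 *; set HH := H _ in wwH *.
rewrite (_ : w * e * (w' * e') * _ = (w * w') * (e * e' * (vjac k y * vjac k y'))); last by ring.
rewrite (_ : HH * X * _ * _ = HH ^+ 2 * (X ^+ 2 * vjac k m ^+ 2)); last by ring.
have e0 : 0 <= e * e' by rewrite mulr_ge0// expR_ge0.
have ww0 : 0 <= w * w' by apply: mulr_ge0; exact: W0.
apply: ler_pM => //.
  by rewrite mulr_ge0// mulr_ge0 ?V0.
apply: (le_trans (ler_wpM2l e0 VV)).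
rewrite (_ : e * e' * _ = expR E * vjac k m ^+ 2); last by rewrite -E1; ring.
by apply: ler_wpM2r => //; exact: sqr_ge0.
Qed.

(** Expand the three exponentials of [wint_expR] to second order in d. Mean zero removes the linear
    term, so both left factors have the same lower bound [al], and al^2 <= be^2 is compared at order
    d^2. *)
Lemma wint_poincare_smooth : wi F = 0 -> k.-1%:R * wi (fun x => F x ^+ 2) <= wi wgrad.
Proof.
move=> F0; have wD := @wintD R n a b C W mW W0 WC; have wZ := @wintZ R n a b C W mW W0 WC.
set I := wi (fun=> 1); set S := wi (fun x => F x ^+ 2); set J := wi wgrad.
have wi0 (f : 'rV[R]_n -> R) : (forall x, cbox a b x -> 0 <= f x) -> 0 <= wi f by apply: (wint_ge0 W0).
have I0 : 0 <= I by exact: wi0.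
have S0 : 0 <= S by apply: wi0 => x _; exact: sqr_ge0.
have J0 : 0 <= J by apply: wi0 => x _; apply: sumr_ge0 => i _; exact: sqr_ge0.
have [_ [B Bx]] := bF; have [_ [T0 Tx]] := wbounded_wgrad.
pose B' := `|B|; pose T' := `|T0|.
have B'0 : 0 <= B' by exact: normr_ge0.
have T'0 : 0 <= T' by exact: normr_ge0.
have kk : 1 <= k.-1%:R :> R by rewrite ler1n -ltnS prednK.
set kr := k.-1%:R in kk *.
pose E := S * C1 + 2 * kr * (B' ^+ 3 * I + 2 * T' ^+ 2 * I).
have E0 : 0 <= E.
  rewrite /E addr_ge0//; first exact: mulr_ge0.
  apply: mulr_ge0; first by rewrite mulr_ge0// (le_trans ler01 kk).
  by apply: addr_ge0; apply: mulr_ge0 => //; rewrite ?exprn_ge0// mulr_ge0// sqr_ge0.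
have bF2 : wbounded a b (fun x => F x ^+ 2) by exact: wboundedX.
have lin c0 c1 c2 : wi (fun x => c0 + (c1 * F x + c2 * F x ^+ 2)) = c0 * I + c2 * S.
  have b1 := wboundedZ c1 bF; have b2 := wboundedZ c2 bF2.
  rewrite (wD (fun=> c0) _ (wbounded_cst _ _ _) (wboundedD b1 b2)) (wD _ _ b1 b2) wZ// wZ// F0 mulr0 add0r.
  by rewrite (@wint_cst R n a b C W mW W0 WC).
have lin' c0 c2 : wi (fun x => c0 + c2 * wgrad x) = c0 * I + c2 * J.
  have b2 := wboundedZ c2 wbounded_wgrad.
  rewrite (wD (fun=> c0) _ (wbounded_cst _ _ _) b2) wZ; last exact: wbounded_wgrad.
  by rewrite (@wint_cst R n a b C W mW W0 WC).
have main (d : R) : 0 < d -> d <= 1 -> d * C1 <= kr / 2 -> d * T' <= 1 / 2 -> kr * S <= J + d * E.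
  move=> d0 d1 dC dT.
  have dC' : d * C1 < kr by apply: (le_lt_trans dC); lra.
  have := wint_expR d0 dC'; rewrite /=; set q := (2 * _)^-1.
  have q'0 : 0 < kr - d * C1 by rewrite subr_gt0.
  have q0 : 0 < q by rewrite invr_gt0 mulr_gt0.
  (* From d C1 <= kr / 2, the denominator 2 (kr - d C1) is at least kr >= 1. *)
  have q1 : q <= 1.
    by rewrite -[leRHS]invr1 lef_pV2 ?posrE// ?mulr_gt0//; lra.
  pose al := I + d ^+ 2 / 2 * S - d ^+ 3 * B' ^+ 3 * I.
  have lo (s : R) : `|s| = d -> al <= wi (fun x => expR (s * F x)).
    move=> sd; have s2 : s ^+ 2 = d ^+ 2 by rewrite -real_normK ?num_real// sd.
    have <- : wi (fun x => (1 - d ^+ 3 * B' ^+ 3) + (s * F x + d ^+ 2 / 2 * F x ^+ 2)) = al.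
      by rewrite lin /al; ring.
    apply: (@wint_le R n a b C W mW W0 WC) => //.
    - apply: wboundedD; first exact: wbounded_cst.
      by apply: wboundedD; apply: wboundedZ => //; exact: wboundedX.
    - by apply: wbounded_expR; exact: wboundedZ.
    move=> x Kx; apply: (le_trans _ (expR_taylor2_ge _)).
    have h : `|s * F x| ^+ 3 <= d ^+ 3 * B' ^+ 3.
      rewrite -exprMn ler_pXn2r ?nnegrE ?mulr_ge0// ?(ltW d0)// normrM sd ler_wpM2l ?(ltW d0)//.
      exact: (le_trans (Bx _ Kx) (ler_norm _)).
    rewrite exprMn s2 -subr_ge0.
    rewrite (_ : _ - _ = d ^+ 3 * B' ^+ 3 - `|s * F x| ^+ 3); last by field.
    by rewrite subr_ge0.
  pose be := I + d ^+ 2 * q * J + 2 * d ^+ 4 * T' ^+ 2 * I.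
  have be0 : 0 <= be.
    have q00 := ltW q0; have d00 := ltW d0.
    rewrite /be; apply: addr_ge0; first apply: addr_ge0 => //.
      by apply: mulr_ge0 => //; apply: mulr_ge0 => //; exact: sqr_ge0.
    apply: mulr_ge0 => //; apply: mulr_ge0; last exact: sqr_ge0.
    by apply: mulr_ge0 => //; exact: exprn_ge0.
  have hi : wi (fun x => expR (d ^+ 2 * q * wgrad x)) <= be.
    have <- : wi (fun x => (1 + 2 * d ^+ 4 * T' ^+ 2) + d ^+ 2 * q * wgrad x) = be.
      by rewrite lin' /be; ring.
    apply: (@wint_le R n a b C W mW W0 WC) => //.
    - by apply: wbounded_expR; apply: wboundedZ; exact: wbounded_wgrad.
    - by apply: wboundedD; [exact: wbounded_cst|apply: wboundedZ; exact: wbounded_wgrad].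
    move=> x Kx; set t := d ^+ 2 * q * wgrad x.
    have g0 : 0 <= wgrad x by apply: sumr_ge0 => i _; exact: sqr_ge0.
    have gT : wgrad x <= T' by exact: le_trans (le_trans (ler_norm _) (Tx _ Kx)) (ler_norm _).
    have t0 : 0 <= t by rewrite /t mulr_ge0// mulr_ge0 ?sqr_ge0// ltW.
    have tT : t <= d ^+ 2 * T'.
      rewrite /t -mulrA ler_wpM2l ?sqr_ge0//.
      by rewrite -[leRHS]mul1r ler_pM// ltW.
    have t1 : t <= 1 / 2.
      apply: (le_trans tT); rewrite expr2 -mulrA; apply: (le_trans _ dT).
      by rewrite -[leRHS]mul1r ler_wpM2r// mulr_ge0// ltW.
    have t01 : 0 <= t <= 1 / 2 by rewrite t0.
    apply: (le_trans (expR_taylor1_le t01)).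
    have dT0 : 0 <= d ^+ 2 * T' by exact: le_trans tT.
    have : t ^+ 2 <= (d ^+ 2 * T') ^+ 2 by rewrite ler_pXn2r.
    rewrite (_ : (d ^+ 2 * T') ^+ 2 = d ^+ 4 * T' ^+ 2); last by ring.
    rewrite (_ : 1 + 2 * d ^+ 4 * T' ^+ 2 + t = 1 + t + 2 * (d ^+ 4 * T' ^+ 2)); last by ring.
    by move=> ?; rewrite lerD2l ler_wpM2l.
  move=> h; have alE : al <= be.
    have h1 := lo d (gtr0_norm d0); have h2 : al <= wi (fun x => expR (- d * F x)).
      by apply: lo; rewrite normrN gtr0_norm.
    rewrite leNgt; apply/negP => ba; have al0 : 0 <= al by exact: le_trans be0 (ltW ba).
    have : al * al <= be * be.
      apply: (le_trans (ler_pM al0 al0 h1 h2)); apply: (le_trans h).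
      have we0 : 0 <= wi (fun x => expR (d ^+ 2 * q * wgrad x)) by apply: wi0 => x _; exact: expR_ge0.
      by rewrite expr2; exact: (ler_pM we0 we0 hi hi).
    by rewrite leNgt (ltr_pM be0 be0 ba ba).
  apply: (@second_order_compare R I kr C1 S J (B' ^+ 3 * I) (2 * T' ^+ 2 * I) d q) => //.
  - by rewrite mulr_ge0// exprn_ge0.
  - by apply: mulr_ge0 => //; apply: mulr_ge0 => //; exact: sqr_ge0.
  rewrite (_ : I + _ - _ = al); last by rewrite /al; ring.
  by rewrite (_ : I + _ + _ = be)// /be; ring.
apply/ler_addgt0Pr => e e0.
(* Each entry of the minimum secures one smallness condition of [main], the last one d E <= e; the
   added 1 avoids zero denominators. *)
pose d := Num.min 1 (Num.min ((kr / 2) / (C1 + 1)) (Num.min ((1 / 2) / (T' + 1)) (e / (E + 1)))).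
have p1 (x : R) : 0 <= x -> 0 < x + 1 by move=> x0; rewrite ltr_wpDl.
have d0 : 0 < d.
  by rewrite /d !lt_min ltr01/= !divr_gt0 ?p1//; lra.
have := lexx d; rewrite {2}/d !le_min => /and4P[d1 dC dT dE].
have dle (x y : R) : 0 <= x -> d <= y / (x + 1) -> d * x <= y.
  move=> x0; rewrite ler_pdivlMr ?p1// mulrDr mulr1; have := d0; lra.
apply: (le_trans (main d d0 d1 (dle _ _ C10 dC) (dle _ _ T'0 dT))).
by rewrite lerD2l dle.
Qed.

End linearised.

(** * From smooth to Lipschitz functions *)

Section weighted_average.
Context {R : realType} {n : nat}.
Variables (k : nat) (a b C P : R) (rho p : 'rV[R]_n -> R).
Hypotheses (k0 : (0 < k)%N) (a0 : 0 < a) (rho0 : forall x, 0 <= rho x) (rhoC : forall x, rho x <= C)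
  (rhoK : forall x, ~ cbox a b x -> rho x = 0) (qc : quasi_pconcave k rho)
  (p0 : forall x, 0 <= p x) (pP : forall x, cbox a b x -> p x <= P) (cp : continuous p).

Local Notation W := (weight rho).
Local Notation wi := (wint a b W).
Local Notation K := (cbox a b : set 'rV[R]_n).
Local Notation K' := (cbox a (b + 1) : set 'rV[R]_n).
Let mW : measurable_fun setT W. Proof. exact: (measurable_weight k0 a0 rho0 rhoK qc). Qed.
Let W0 x : 0 <= W x. Proof. exact: weight_ge0. Qed.
Let WC x : W x <= C. Proof. exact: weight_leC. Qed.
Let WK x : ~ cbox a b x -> W x = 0. Proof. exact: weightK. Qed.
Let V (x : 'rV[R]_n) : R := W x * p x.

Let mV : measurable_fun setT V.
Proof. by apply: measurable_funM => //; exact: continuous_measurable_rV. Qed.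

Let V0 x : 0 <= V x. Proof. exact: mulr_ge0. Qed.

Let VK x : ~ K x -> V x = 0. Proof. by move=> /WK Wx; rewrite /V Wx mul0r. Qed.

Let CP0 : 0 <= C * `|P|.
Proof. by rewrite mulr_ge0// (le_trans (rho0 0) (rhoC 0)). Qed.

Let VC x : V x <= C * `|P|.
Proof.
have [Kx|/VK ->//] := pselect (K x); apply: ler_pM => //.
exact: le_trans (pP Kx) (ler_norm _).
Qed.

Lemma norm_cube (eta : R) (z : 'rV[R]_n) : 0 <= eta -> cube eta z -> `|z| <= eta.
Proof.
move=> eta0 Qz; rewrite [`|_|]mx_normrE; apply/bigmax_leP; split=> // -[i j] _ /=.
by rewrite ord1; have /andP[h1 h2] := Qz j; rewrite ger0_norm.
Qed.

(** Continuity of translations in L1. Here it follows from pointwise continuity off a null set, by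
    dominated convergence along a sequence of shifts that would violate the bound. *)
Lemma weight_shift_L1 (e : R) : 0 < e -> \forall eta \near 0^'+, forall z, cube eta z ->
  (\int[lebesgue_rV]_x `|V (x - z)%R - V x|%:E <= e%:E)%E.
Proof.
move=> e0.
suff [m Hm] : exists m, forall z, cube m.+1%:R^-1 z ->
    (\int[lebesgue_rV]_x `|V (x - z)%R - V x|%:E <= e%:E)%E.
  near=> eta => z Qz; apply: Hm => i; have /andP[-> h] := Qz i; apply: (le_trans h).
  by near: eta; apply: nbhs_right_le; rewrite invr_gt0.
apply: contrapT => nH.
have /choice[z_ Hz] : forall m, exists z, cube m.+1%:R^-1 z /\
    ~ (\int[lebesgue_rV]_x `|V (x - z)%R - V x|%:E <= e%:E)%E.
  move=> m; apply: contrapT => nz; apply: nH; exists m => z Qz; apply: contrapT => h.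
  by apply: nz; exists z.
have mN := measurable_bad_set rho; have N0 := lebesgue_bad_set rho.
(* [V] contains the modified weight, so both x and all the shifted points must avoid the bad set;
   countably many translates remain null. *)
pose N' := \bigcup_(o : option nat) (if o is Some m then (fun x => x - z_ m) @^-1` bad_set rho else bad_set rho).
have mNz m : measurable ((fun x => x - z_ m) @^-1` bad_set rho).
  by rewrite -[X in measurable X]setTI; exact: measurable_rV_shift.
have [mN' N'0] : measurable N' /\ lebesgue_rV N' = 0%E.
  by apply: measure_countable_bigcup0 => -[m|]//; rewrite -[RHS]N0; exact: lebesgue_rV_shift.
have z0 : z_ m @[m --> \oo] --> (0 : 'rV[R]_n).
  apply/cvgr0Pnorm_le => r r0.
  apply: filterS (near_infty_natSinv_lt (PosNum r0)) => m /= mr.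
  apply: le_trans (ltW mr); apply: norm_cube; first by rewrite invr_ge0.
  by have [] := Hz m.
have mK' : measurable K' by exact: measurable_cbox.
have K'oo : (lebesgue_rV K' < +oo)%E by exact: lebesgue_rV_cbox_lty.
have mVz (z : 'rV[R]_n) : measurable_fun setT (fun x : 'rV[R]_n => `|V (x - z) - V x|).
  apply: measurableT_comp => //; apply: measurable_funB => //.
  by apply: (measurableT_comp mV); exact: measurable_rV_shift.
(* The shifts are nonnegative and at most 1 in each coordinate, so everything is supported in the
   box with upper end b + 1. *)
have IE m : (\int[lebesgue_rV]_x `|V (x - z_ m)%R - V x|%:E =
    \int[lebesgue_rV]_(x in K') `|V (x - z_ m)%R - V x|%:E)%E.
  rewrite [RHS]integral_mkcond; apply: eq_integral => x _; rewrite patchE; case: ifPn => // nx.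
  have nK' : ~ K' x by rewrite notin_setE in nx.
  rewrite !VK ?subrr ?normr0// => Kx; apply: nK' => i.
    by have /andP[-> h] := Kx i; rewrite (le_trans h)// lerDl.
  have := Kx i; have [/(_ i)] := Hz m; rewrite !mxE => /andP[h1 h2] _ /andP[h3 h4].
  have : m.+1%:R^-1 <= 1 :> R by rewrite invf_le1 ?ler1n.
  have H (u v w : R) : 0 <= v -> v <= w -> a <= u - v -> u - v <= b -> w <= 1 -> a <= u <= b + 1.
    by move=> *; apply/andP; split; lra.
  exact: H h1 h2 h3 h4.
have [|||||_ _] := @dominated_convergence _ _ _ lebesgue_rV K' mK'
    (fun m (x : 'rV[R]_n) => `|V (x - z_ m) - V x|%:E) (fun=> 0%E) (fun=> (2 * (C * `|P|))%:E).
- by move=> m; apply/measurable_EFinP; exact: measurable_funTS.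
- exact: measurable_cst.
- exists N'; split => // x /= nx; apply: contrapT => Nx; apply: nx => _.
  apply: cvg_EFin; first exact: nearW.
  have nNx : ~ bad_set rho x by move=> h; apply: Nx; exists None.
  have VE m : V (x - z_ m) = rho (x - z_ m) * p (x - z_ m).
    by rewrite /V weightE// => h; apply: Nx; exists (Some m).
  have : `|rho (x - z_ m) * p (x - z_ m) - V x| @[m --> \oo] --> `|V x - V x|.
    apply: cvg_norm; apply: cvgB; last exact: cvg_cst.
    rewrite [V x]/V weightE//.
    have xz : x - z_ m @[m --> \oo] --> x.
      by rewrite -[X in _ --> X]subr0; apply: cvgB => //; exact: cvg_cst.
    apply: cvgM; last by apply: cvg_comp xz _; exact: cp.
    apply: cvg_comp xz _; exact: (pconcave_continuous_cbox k0 a0 rho0 rhoK qc nNx).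
  by rewrite subrr normr0; under eq_fun do rewrite -VE.
- by apply: (integrable_bounded (K := `|2 * (C * `|P|)|)).
- apply: aeW => x m _ /=; rewrite lee_fin normr_id; apply: (le_trans (ler_normB _ _)).
  by rewrite (ger0_norm (V0 _)) (ger0_norm (V0 _)) mulr_natl mulr2n; exact: lerD.
rewrite integral0 => /fine_cvgP[fin /cvgr_lt/(_ _ e0) cv].
have [m [fm em]] := filter_ex (filterI fin cv).
have [_] := Hz m; apply; rewrite IE.
by rewrite -[leLHS]fineK// lee_fin ltW.
Unshelve. all: by end_near. Qed.

(** Tonelli and a translation move the average from [g], which is only bounded and measurable, onto
    the weight, where [weight_shift_L1] controls it. *)
Lemma wint_cube_avg_le (g : 'rV[R]_n -> R) (B e : R) : measurable_fun setT g ->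
  (forall x, 0 <= g x <= B) -> 0 < e ->
  \forall eta \near 0^'+, wi (fun x => p x * cube_avg eta g x) <= wi (fun x => p x * g x) + e.
Proof.
move=> mg gB e0.
have g0 x : 0 <= g x by have /andP[] := gB x.
have gN x : `|g x| <= B by rewrite ger0_norm//; have /andP[] := gB x.
have B0 : 0 <= B by exact: le_trans (gN 0).
have e'0 : 0 < e / (B + 1) by rewrite divr_gt0// ltr_wpDl.
near=> eta.
have eta0 : 0 < eta by near: eta; exact: nbhs_right_gt.
have sh z : cube eta z -> (\int[lebesgue_rV]_x `|V (x - z)%R - V x|%:E <= (e / (B + 1))%:E)%E.
  by move: z; near: eta; exact: weight_shift_L1.
have bp : wbounded a b p.
  by split; [exact: continuous_measurable_rV|exists P => x Kx; rewrite ger0_norm// pP].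
have bg : wbounded a b g by split => //; exists B.
have bavg : wbounded a b (cube_avg eta g).
  split; last by exists B => x _; exact: cube_avg_le.
  by apply: continuous_measurable_rV; apply: lipschitz_continuous; exact: (cube_avg_lip eta0 mg gN).
have mQ : measurable (cube eta : set 'rV[R]_n) by exact: measurable_cbox.
have Qoo : (lebesgue_rV (cube eta : set 'rV[R]_n) < +oo)%E by exact: lebesgue_rV_cbox_lty.
have vol0 : 0 < cube_vol (n := n) eta by exact: cube_vol_gt0.
pose Phi (xz : 'rV[R]_n * 'rV[R]_n) : \bar R := (V xz.1 * (\1_(cube eta) xz.2 * g (xz.1 + xz.2)))%:E.
have I0 (z : 'rV[R]_n) : 0 <= (\1_(cube eta) z : R) by [].
have Phi0 xz : (0 <= Phi xz)%E by rewrite lee_fin !mulr_ge0.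
have mPhi : measurable_fun setT Phi.
  apply/measurable_EFinP; apply: measurable_funM; first exact: (measurableT_comp mV).
  have mI : measurable_fun setT (\1_(cube eta) : 'rV[R]_n -> R) by exact: measurable_indic.
  apply: measurable_funM; first exact: (measurableT_comp mI).
  apply: (measurableT_comp mg); apply: measurable_fun_rVP => i.
  under eq_fun do rewrite mxE.
  by apply: measurable_funD; apply: (measurableT_comp (measurable_coord i)).
have bR : wbounded a b (fun x => p x * g x) by exact: wboundedM.
rewrite -(ler_pM2l vol0) -lee_fin.
have -> : ((cube_vol (n := n) eta * wi (fun x => p x * cube_avg eta g x))%:E =
    \int[lebesgue_rV]_x \int[lebesgue_rV]_z Phi (x, z))%E.
  rewrite EFinM -(integral_wint mW W0 WC WK); last exact: wboundedM.
  rewrite -ge0_integralZl//; last 3 first.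
  - by apply/measurable_EFinP; apply: measurable_funM => //; apply: measurable_funM; [exact: bp.1|exact: bavg.1].
  - move=> x _; rewrite lee_fin mulr_ge0// mulr_ge0// /cube_avg mulr_ge0 ?invr_ge0 ?(ltW vol0)//.
    exact: Rintegral_ge0.
  - by rewrite lee_fin ltW.
  apply: eq_integral => x _; rewrite -EFinM /cube_avg.
  transitivity ((V x)%:E * \int[lebesgue_rV]_z (\1_(cube eta) z * g (x + z)%R)%:E)%E.
    rewrite (_ : cube_vol (n := n) eta * _ = V x * \int[lebesgue_rV]_(z in cube eta) g (x + z)); last first.
      by rewrite /V; field; exact: lt0r_neq0.
    rewrite EFinM; congr (_ * _)%E; rewrite /Rintegral fineK; last first.
      exact: integrable_fin_num (integrable_cube eta mg gN x).
    rewrite integral_mkcond; apply: eq_integral => z _; rewrite patchE indicE.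
    by case: ifPn => _; rewrite ?mul1r ?mul0r.
  rewrite -ge0_integralZl//.
  - by apply/measurable_EFinP; apply: measurable_funM => //; exact: measurable_shiftr.
  - by move=> z _; rewrite lee_fin mulr_ge0.
  - by rewrite lee_fin.
have -> : (\int[lebesgue_rV]_x \int[lebesgue_rV]_z Phi (x, z) = \int[lebesgue_rV]_z \int[lebesgue_rV]_x Phi (x, z))%E.
  exact: (@fubini_tonelli _ _ _ _ _ (lebesgue_rV_rec R n) (lebesgue_rV_rec R n) Phi mPhi Phi0).
have inner z : (\int[lebesgue_rV]_x Phi (x, z) <=
    (\1_(cube eta) z * (wi (fun x => p x * g x) + e))%:E)%E.
  rewrite /Phi/=; rewrite [in leRHS]indicE indicE; case: (boolP (z \in _)) => [|_]; last first.
    by rewrite mul0r integral0_eq// => x _; rewrite mul0r mulr0.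
  rewrite inE => Qz; rewrite mul1r.
  have mVz : measurable_fun setT (fun x : 'rV[R]_n => V (x - z)).
    by apply: (measurableT_comp mV); exact: measurable_rV_shift.
  have -> : (\int[lebesgue_rV]_x (V x * (1 * g (x + z)%R))%:E =
      \int[lebesgue_rV]_x (V (x - z)%R * g x)%:E)%E.
    rewrite -[RHS](ge0_integral_rV_shift z).
    - by apply: eq_integral => x _; rewrite addrK mul1r.
    - by apply/measurable_EFinP; exact: measurable_funM.
    - by move=> x; rewrite lee_fin mulr_ge0.
  apply: (@le_trans _ _ (\int[lebesgue_rV]_x ((W x * (p x * g x))%:E + B%:E * `|V (x - z)%R - V x|%:E))%E).
    apply: ge0_le_integral => //.
    - by move=> x _; rewrite lee_fin mulr_ge0.
    - by apply/measurable_EFinP; exact: measurable_funM.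
    - apply: emeasurable_funD; first by apply/measurable_EFinP; apply: measurable_funM => //; exact: bR.1.
      apply: measurable_funeM; apply/measurable_EFinP; apply: measurableT_comp => //.
      exact: measurable_funB.
    move=> x _; rewrite -EFinM -EFinD lee_fin.
    rewrite (_ : W x * (p x * g x) = V x * g x) /V ?mulrA// -/(V x) -/(V (x - z)).
    rewrite -lerBlDl -mulrBl; apply: (le_trans (ler_norm _)); rewrite normrM mulrC.
    by apply: ler_wpM2r.
  rewrite ge0_integralD//; last 4 first.
  - by move=> x _; rewrite lee_fin !mulr_ge0.
  - by apply/measurable_EFinP; apply: measurable_funM => //; exact: bR.1.
  - by move=> x _; rewrite mule_ge0// lee_fin.
  - apply: measurable_funeM; apply/measurable_EFinP; apply: measurableT_comp => //.
    exact: measurable_funB.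
  rewrite (integral_wint mW W0 WC WK bR) [leRHS]EFinD leeD2l//.
  rewrite ge0_integralZl//; last first.
    by apply/measurable_EFinP; apply: measurableT_comp => //; exact: measurable_funB.
  apply: (@le_trans _ _ (B%:E * (e / (B + 1))%:E)%E); first by apply: lee_wpmul2l; [rewrite lee_fin|exact: sh].
  rewrite -EFinM lee_fin mulrA ler_pdivrMr ?ltr_wpDl//.
  by rewrite mulrDr mulr1 mulrC lerDl ltW.
apply: (@le_trans _ _ (\int[lebesgue_rV]_z (\1_(cube eta) z * (wi (fun x => (p x * g x)%R) + e))%:E)%E).
  apply: ge0_le_integral => //.
  - by move=> z _; exact: integral_ge0.
  - exact: (@measurable_fun_fubini_tonelli_G _ _ _ _ _ (lebesgue_rV_rec R n) Phi).
  by apply/measurable_EFinP; apply: measurable_funM.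
have we0 : 0 <= wi (fun x => p x * g x) + e.
  by apply: addr_ge0; [apply: (wint_ge0 W0) => x _; exact: mulr_ge0|exact: ltW].
under eq_integral do rewrite EFinM.
rewrite ge0_integralZr//; last first.
  by apply/measurable_EFinP.
by rewrite integral_indic// setIT /cube_vol EFinM fineK// lebesgue_rV_cbox_fin.
Unshelve. all: by end_near. Qed.

End weighted_average.

(** * The variance inequality for bounded Lipschitz functions *)

Section lipschitz_poincare.
Context {R : realType} {n : nat}.
Variables (k : nat) (a b C : R) (rho : 'rV[R]_n -> R).
Hypotheses (k1 : (1 < k)%N) (a0 : 0 < a) (rho0 : forall x, 0 <= rho x) (rhoC : forall x, rho x <= C)
  (rhoK : forall x, ~ cbox a b x -> rho x = 0) (qc : quasi_pconcave k rho)
  (rho_mid : forall y y', orthant R n y -> orthant R n y' ->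
    rho (vpow k y) * rho (vpow k y') <= rho (vpow k (vmid y y')) ^+ 2).

Local Notation W := (weight rho).
Local Notation wi := (wint a b W).
Let k0 : (0 < k)%N. Proof. exact: ltnW. Qed.
Let mW : measurable_fun setT W. Proof. exact: (measurable_weight k0 a0 rho0 rhoK qc). Qed.
Let W0 x : 0 <= W x. Proof. exact: weight_ge0. Qed.
Let WC x : W x <= C. Proof. exact: weight_leC. Qed.
Let WK x : ~ cbox a b x -> W x = 0. Proof. exact: weightK. Qed.
Let wD := @wintD R n a b C W mW W0 WC.
Let wZ := @wintZ R n a b C W mW W0 WC.
Let wc := @wint_cst R n a b C W mW W0 WC.
Let wle := @wint_le R n a b C W mW W0 WC.

Lemma wint_abs_le f (e : R) : wbounded a b f -> (forall x, cbox a b x -> `|f x| <= e) ->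
  `|wi f| <= e * wi (fun=> 1).
Proof.
move=> bf fe; rewrite ler_norml -mulNr -!wc; apply/andP; split.
  by apply: wle => //; [exact: wbounded_cst|move=> x /fe; rewrite ler_norml => /andP[]].
by apply: wle => //; [exact: wbounded_cst|move=> x /fe; rewrite ler_norml => /andP[]].
Qed.

Lemma wint_variance_smooth (F : 'rV[R]_n -> R) (G : 'I_n -> 'rV[R]_n -> R) (C1 : R) :
  wbounded a b F -> (forall i, wbounded a b (G i)) -> 0 <= C1 ->
  (forall y y', orthant R n y -> orthant R n y' ->
    cbox a b (vpow k y) -> cbox a b (vpow k y') ->
    F (vpow k y) - F (vpow k y') <=
    \sum_(i < n) 2 * (k%:R * vpow k (vmid y y') ord0 i * G i (vpow k (vmid y y'))) * reldiff y y' i +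
    C1 * \sum_(i < n) reldiff y y' i ^+ 2) ->
  k.-1%:R * (wi (fun x => F x ^+ 2) - wi F ^+ 2 / wi (fun=> 1)) <= wi (wgrad k G).
Proof.
move=> bF bG C10 FT; set I := wi (fun=> 1).
have [_ [B FB]] := bF.
have Fle := wint_abs_le bF FB; rewrite -/I in Fle.
(* When I = 0 the quotient is 0 by convention, and c I = wi F still holds since the weighted mean is
   then 0 as well. *)
pose c := wi F / I.
have cI : c * I = wi F.
  rewrite /c; have [I0|I0] := eqVneq I 0; last by rewrite mulfVK.
  by move: Fle; rewrite I0 !mulr0 normr_le0 => /eqP ->.
have bFc : wbounded a b (fun x => F x + - c) by apply: wboundedD => //; exact: wbounded_cst.
have F0 : wi (fun x => F x + - c) = 0.
  by rewrite (wD bF (wbounded_cst a b (- c))) (wc (- c)) -/I mulNr cI subrr.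
have FT' : forall y y', orthant R n y -> orthant R n y' ->
    cbox a b (vpow k y) -> cbox a b (vpow k y') ->
    (F (vpow k y) + - c) - (F (vpow k y') + - c) <=
    \sum_(i < n) 2 * (k%:R * vpow k (vmid y y') ord0 i * G i (vpow k (vmid y y'))) * reldiff y y' i +
    C1 * \sum_(i < n) reldiff y y' i ^+ 2.
  by move=> y y' y0 y'0 Ky Ky'; rewrite opprD addrACA subrr addr0; exact: FT.
have := wint_poincare_smooth k1 a0 rho0 rhoC rhoK qc rho_mid bFc bG C10 FT' F0.
suff -> : wi (fun x => (F x + - c) ^+ 2) = wi (fun x => F x ^+ 2) - wi F ^+ 2 / I by [].
have b1 := wboundedX 2 bF; have b2 := wboundedZ (- (2 * c)) bF.
have b3 : wbounded a b (fun _ : 'rV[R]_n => c ^+ 2) by exact: wbounded_cst.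
transitivity (wi (fun x => F x ^+ 2 + (- (2 * c) * F x + c ^+ 2))).
  by congr wint; apply/funext => x; ring.
rewrite (wD b1 (wboundedD b2 b3)) (wD b2 b3) wZ// wc -/I.
rewrite (_ : wi F ^+ 2 / I = c * wi F); last by rewrite /c; ring.
by rewrite -cI; ring.
Qed.

(** Apply the smooth case to cube averages of F. They are uniformly close to F, which controls the
    variance; Jensen and [wint_cube_avg_le] control the gradient term. *)
Lemma wint_poincare_lipschitz (F : 'rV[R]_n -> R) (L B : R) :
  (forall x y, `|F x - F y| <= L * `|x - y|) -> (forall x, `|F x| <= B) ->
  k.-1%:R * (wi (fun x => F x ^+ 2) - wi F ^+ 2 / wi (fun=> 1)) <=
  k%:R ^+ 2 * \sum_(i < n) wi (fun x => x ord0 i ^+ 2 * gpartial F i x ^+ 2).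
Proof.
move=> lipF FB; set I := wi (fun=> 1).
have I0 : 0 <= I by apply: (wint_ge0 W0).
have B0 : 0 <= B by exact: le_trans (FB 0).
have bF : wbounded a b F.
  by split; [apply: continuous_measurable_rV; exact: lipschitz_continuous lipF|exists B => x _; exact: FB].
have mg i := measurable_gpartial lipF i; have gL i x := gpartial_le lipF i x.
have bg i : wbounded a b (gpartial F i) by split => //; exists `|L| => x _; exact: gL.
have bx i := @wbounded_coord R n a b i.
have bxg i (g : 'rV[R]_n -> R) : wbounded a b g -> wbounded a b (fun x => x ord0 i ^+ 2 * g x).
  by move=> bgg; apply: wboundedM => //; exact: wboundedX.
set S := \sum_(i < n) _.
apply/ler_addgt0Pr => e e0.
(* Total error in units of e': k^2 for each of the n gradient terms, and k - 1 for the variance. *)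
pose D := k%:R ^+ 2 * n%:R + k.-1%:R : R.
have D0 : 0 < D + 1 by rewrite ltr_wpDl// addr_ge0// mulr_ge0// sqr_ge0.
pose e' := e / (D + 1).
have e'0 : 0 < e' by exact: divr_gt0.
suff H : k.-1%:R * (wi (fun x => F x ^+ 2) - wi F ^+ 2 / I) <= k%:R ^+ 2 * S + D * e'.
  apply: (le_trans H); rewrite lerD2l /e' mulrA ler_pdivrMr//.
  by rewrite mulrDr mulr1 [D * e]mulrC lerDl ltW.
(* The second moment and the squared mean each contribute 2 B |L| eta I. *)
pose E := 4 * B * `|L| * I.
have E1 : 0 < E + 1 by rewrite ltr_wpDl// !mulr_ge0.
near (0 : R)^'+ => eta.
have eta0 : 0 < eta by near: eta; exact: nbhs_right_gt.
have eE : E * eta <= e'.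
  have : eta <= e' / (E + 1) by near: eta; apply: nbhs_right_le; exact: divr_gt0.
  by rewrite ler_pdivlMr// mulrDr mulr1 mulrC; have := eta0; lra.
have avg i : wi (fun x => x ord0 i ^+ 2 * cube_avg eta (fun y => gpartial F i y ^+ 2) x) <=
    wi (fun x => x ord0 i ^+ 2 * gpartial F i x ^+ 2) + e'.
  move: i; near: eta; apply: filter_forall => i.
  apply: (@wint_cube_avg_le R n k a b C (b ^+ 2) rho (fun x => x ord0 i ^+ 2) k0 a0 rho0 rhoC rhoK qc _ _ _
    (fun y => gpartial F i y ^+ 2) (`|L| ^+ 2)) => //.
  - by move=> x; exact: sqr_ge0.
  - move=> x Kx; have /andP[ax xb] := Kx i.
    have x0 : 0 <= x ord0 i by exact: le_trans (ltW a0) ax.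
    by rewrite ler_pXn2r ?nnegrE// (le_trans x0).
  - move=> x; under eq_fun do rewrite expr2.
    by apply: cvgM; exact: coord_continuous.
  - exact: measurable_funX.
  - by move=> x; rewrite sqr_ge0/= -[leLHS]real_normK ?num_real// ler_pXn2r ?nnegrE// gL.
pose Fe := cube_avg eta F; pose Ge i := cube_avg eta (gpartial F i).
have FeB x : `|Fe x| <= B by exact: cube_avg_le bF.1 FB x.
have bavg (g : 'rV[R]_n -> R) (M : R) : measurable_fun setT g -> (forall x, `|g x| <= M) ->
    wbounded a b (cube_avg eta g).
  move=> mgg gM; split; last by exists M => x _; exact: cube_avg_le.
  by apply: continuous_measurable_rV; apply: lipschitz_continuous; exact: (cube_avg_lip eta0 mgg gM).
have bFe : wbounded a b Fe by exact: bavg bF.1 FB.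
have bGe i : wbounded a b (Ge i) by exact: bavg (mg i) (gL i).
have [C1 C10 FT] := @taylor_midpoint R n k a b Fe Ge `|L| (n%:R ^+ 2 * avg_lip L (n := n) eta) k0 a0
  (fun i x => cube_avg_le eta0 (mg i) (gL i) x) (fun x d D => @cube_avg_taylor R n F L B eta lipF FB eta0 x d D).
have := wint_variance_smooth bFe bGe C10 FT; rewrite -/I.
have FeF x : `|Fe x - F x| <= `|L| * eta.
  apply: (@cube_avg_cst_dist R n eta eta0 F B bF.1 FB) => z Qz; apply: (le_trans (lipF _ _)).
  rewrite addrC addKr; apply: (@le_trans _ _ (`|L| * `|z|)); first by rewrite ler_wpM2r// ler_norm.
  by rewrite ler_wpM2l// norm_cube// ltW.
have bFeF : wbounded a b (fun x => Fe x + - F x).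
  by apply: wboundedD => //; have := wboundedZ (-1) bF; under eq_fun do rewrite mulN1r.
have wN : wi (fun x => - F x) = - wi F.
  by rewrite -mulN1r -wZ//; congr wint; apply/funext => x; rewrite mulN1r.
have bFN : wbounded a b (fun x => - F x).
  by have := wboundedZ (-1) bF; under eq_fun do rewrite mulN1r.
have d1 : `|wi Fe - wi F| <= `|L| * eta * I.
  by rewrite -wN -wD//; apply: wint_abs_le.
have d2 : `|wi Fe + wi F| <= 2 * B * I.
  rewrite -wD//; apply: wint_abs_le; first exact: wboundedD.
  by move=> x _; apply: (le_trans (ler_normD _ _)); rewrite mulr_natl mulr2n lerD.
have h1 : wi (fun x => F x ^+ 2) <= wi (fun x => Fe x ^+ 2) + 2 * B * `|L| * eta * I.
  rewrite -[X in _ + X]wc -wD; [|exact: wboundedX|exact: wbounded_cst].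
  apply: wle; [exact: wboundedX|by apply: wboundedD; [exact: wboundedX|exact: wbounded_cst]|].
  move=> x _; rewrite -lerBlDl.
  rewrite (_ : F x ^+ 2 - Fe x ^+ 2 = - (F x + Fe x) * (Fe x - F x)); last by ring.
  apply: (le_trans (ler_norm _)); rewrite normrM normrN.
  rewrite (_ : 2 * B * `|L| * eta = 2 * B * (`|L| * eta)); last by ring.
  apply: ler_pM => //; apply: (le_trans (ler_normD _ _)).
  by rewrite mulr_natl mulr2n lerD.
have h2 : wi Fe ^+ 2 / I <= wi F ^+ 2 / I + 2 * B * `|L| * eta * I.
  have [I00|I00] := eqVneq I 0; first by rewrite I00 invr0 !mulr0 addr0.
  have Igt : 0 < I by rewrite lt_def I00.
  rewrite -lerBlDl -mulrBl ler_pdivrMr//.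
  rewrite subr_sqr; apply: (le_trans (ler_norm _)); rewrite normrM.
  rewrite (_ : 2 * B * `|L| * eta * I * I = `|L| * eta * I * (2 * B * I)); last by ring.
  exact: ler_pM.
have h3 : wi (wgrad k Ge) <= k%:R ^+ 2 * (S + n%:R * e').
  apply: (@le_trans _ _ (wi (fun x => k%:R ^+ 2 * \sum_(i < n) x ord0 i ^+ 2 * cube_avg eta (fun y => gpartial F i y ^+ 2) x))).
    have bav i : wbounded a b (cube_avg eta (fun y => gpartial F i y ^+ 2)).
      apply: (bavg _ (`|L| ^+ 2)); first exact: measurable_funX.
      by move=> x; rewrite normrX ler_pXn2r ?nnegrE// gL.
    apply: wle.
    - exact: wbounded_wgrad.
    - apply: wboundedZ; apply: wbounded_sum => i; exact: bxg.
    move=> x Kx; rewrite /wgrad mulr_sumr; apply: ler_sum => i _.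
    rewrite exprMn exprMn -mulrA; apply: ler_wpM2l; first exact: sqr_ge0.
    apply: ler_wpM2l; first exact: sqr_ge0.
    exact: (@cube_avg_sqr R n eta eta0 _ `|L| (mg i) (gL i)).
  have bav i : wbounded a b (fun x => x ord0 i ^+ 2 * cube_avg eta (fun y => gpartial F i y ^+ 2) x).
    apply: bxg; apply: (bavg _ (`|L| ^+ 2)); first exact: measurable_funX.
    by move=> x; rewrite normrX ler_pXn2r ?nnegrE// gL.
  rewrite wZ; last exact: wbounded_sum.
  apply: ler_wpM2l; first exact: sqr_ge0.
  rewrite (@wint_sum R n a b C W mW W0 WC)//.
  apply: (le_trans (ler_sum _ (fun i _ => avg i))).
  by rewrite big_split/= sumr_const card_ord mulr_natl.
have kr0 : 0 <= k.-1%:R :> R by [].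
have h4 : k.-1%:R * (wi (fun x => F x ^+ 2) - wi F ^+ 2 / I) <=
   k.-1%:R * (wi (fun x => Fe x ^+ 2) - wi Fe ^+ 2 / I) + k.-1%:R * e'.
  rewrite -mulrDr; apply: ler_wpM2l => //.
  have : E * eta = 2 * B * `|L| * eta * I + 2 * B * `|L| * eta * I by rewrite /E; ring.
  move: h1 h2 eE; move: (wi Fe ^+ 2 / I) (wi F ^+ 2 / I) (2 * B * _ * _ * _) (E * eta) (wi _) (wi _).
  by move=> *; lra.
move=> h5; apply: (le_trans h4); rewrite /D mulrDl addrA lerD2r.
by apply: (le_trans h5); apply: (le_trans h3); rewrite mulrDr mulrA.
Unshelve. all: by end_near. Qed.

End lipschitz_poincare.

(** * Truncations and the passage to the limit *)

Section locally_lipschitz.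
Context {R : realType} {n : nat}.

Lemma compact_cbox (a b : R) : compact (cbox a b : set 'rV[R]_n).
Proof.
have := @rV_compact R n (fun=> `[a, b]%classic) (fun=> @segment_compact R a b).
by congr compact; apply/seteqP; split => x h i; have := h i; rewrite /= in_itv.
Qed.

Lemma locally_lipschitz_ball (A : set 'rV[R]_n) (f : 'rV[R]_n -> R) x :
  locally_lipschitz_on A f -> A x -> exists C r : R, [/\ 0 <= C, 0 < r &
    forall y z, A y -> A z -> `|x - y| < r -> `|x - z| < r -> `|f y - f z| <= C * `|y - z|].
Proof.
move=> lf Ax; have [U Ux lU] := lf x Ax.
have [r /= r0 rU] : nbhs_ball x U by exact/nbhs_ballP.
(* [lipschitz] provides the bound for every constant beyond M0, hence the added 1. *)
have [M0 [_ MP]] := lU; pose M := M0 + 1.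
have Mf := MP M (ltr_pwDr ltr01 (lexx M0)).
exists `|M|, r; split => // y z Ay Az xy xz.
have Uy : U y by apply: rU; rewrite -ball_normE.
have Uz : U z by apply: rU; rewrite -ball_normE.
apply: (le_trans (Mf (y, z) _)); first by split; split.
by rewrite ler_wpM2r// ler_norm.
Qed.

(** Pairs violating the bound with constant m cluster at some (x, y) by compactness. If x = y this
    contradicts the local bound; otherwise the distances stay away from 0 while the differences of f
    stay bounded. *)
Lemma locally_lipschitz_cbox (A : set 'rV[R]_n) (f : 'rV[R]_n -> R) (a b : R) :
  locally_lipschitz_on A f -> cbox a b `<=` A ->
  exists2 L : R, 0 <= L & forall x y, cbox a b x -> cbox a b y -> `|f x - f y| <= L * `|x - y|.
Proof.
move=> lf KA; apply: contrapT => nL.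
have /choice[p_ Hp] : forall m : nat, exists p : 'rV[R]_n * 'rV[R]_n,
    [/\ cbox a b p.1, cbox a b p.2 & m%:R * `|p.1 - p.2| < `|f p.1 - f p.2|].
  move=> m; apply: contrapT => np; apply: nL; exists m%:R => // x y Kx Ky.
  by rewrite leNgt; apply/negP => h; apply: np; exists (x, y).
have cK := compact_setX (@compact_cbox a b) (@compact_cbox a b).
have [|[x y] [[/= Kx Ky] clxy]] := cK (p_ @ \oo) _.
  by exists 0%N => // m _ /=; have [h1 h2 _] := Hp m.
have [Cx [rx [Cx0 rx0 Hx]]] := locally_lipschitz_ball lf (KA _ Kx).
have [Cy [ry [Cy0 ry0 Hy]]] := locally_lipschitz_ball lf (KA _ Ky).
have freq (r T : R) : 0 < r -> exists m : nat,
    [/\ T <= m%:R, `|x - (p_ m).1| < r & `|y - (p_ m).2| < r].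
  move=> r0; have nB : nbhs (x, y) (ball x r `*` ball y r).
    by exists (ball x r, ball y r) => //=; split; exact: nbhsx_ballx.
  pose N := Num.truncn (`|T| + 1).
  have TN m : (N <= m)%N -> T <= m%:R.
    move=> Nm; apply: (le_trans (ler_norm _)).
    have := truncnS_gt (`|T| + 1); rewrite -/N -natr1 => h.
    have : N%:R <= m%:R :> R by rewrite ler_nat.
    by lra.
  have FA : (p_ @ \oo) [set q | exists2 m, (N <= m)%N & q = p_ m].
    by exists N => // m /= Nm; exists m.
  have [q [[m Nm ->] [/=]]] := clxy _ _ FA nB.
  by rewrite -!ball_normE => h1 h2; exists m; split => //; exact: TN.
have [xy|xy] := eqVneq x y.
  have [m [Tm xm ym]] := freq _ Cx rx0.
  have [K1 K2] := Hp m; apply/negP; rewrite -leNgt.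
  apply: (le_trans (Hx _ _ (KA _ K1) (KA _ K2) xm _)); first by rewrite xy.
  by rewrite ler_wpM2r.
have d0 : 0 < `|x - y| by rewrite normr_gt0 subr_eq0.
set d := `|x - y| in d0.
(* With r <= d / 4 the nearby points stay d / 2 apart, and r <= rx, ry keeps them where f is
   controlled. *)
pose r := Num.min (d / 4) (Num.min rx ry).
have r0 : 0 < r by rewrite /r !lt_min rx0 ry0 divr_gt0.
have [rd rrx rry] : [/\ r <= d / 4, r <= rx & r <= ry].
  by have := lexx r; rewrite {2}/r !le_min => /and3P.
pose T := Cx * r + `|f x - f y| + Cy * r.
have T0 : 0 <= T by rewrite /T !addr_ge0// mulr_ge0// ltW.
have [m [Tm xm ym]] := freq _ (T / (d / 2)) r0.
have [K1 K2] := Hp m; apply/negP; rewrite -leNgt.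
set u := (p_ m).1 in xm K1 *; set v := (p_ m).2 in ym K2 *.
have h1 : `|f u - f v| <= T.
  rewrite (_ : f u - f v = (f u - f x) + (f x - f y) + (f y - f v)); last by ring.
  apply: (le_trans (ler_normD _ _)); apply: lerD; last first.
    have := Hy _ _ (KA _ Ky) (KA _ K2); rewrite subrr normr0 => /(_ ry0 (lt_le_trans ym rry)) h.
    by apply: (le_trans h); rewrite ler_wpM2l// ltW.
  apply: (le_trans (ler_normD _ _)); apply: lerD => //.
  have := Hx _ _ (KA _ Kx) (KA _ K1); rewrite subrr normr0 => /(_ rx0 (lt_le_trans xm rrx)) h.
  by rewrite distrC; apply: (le_trans h); rewrite ler_wpM2l// ltW.
have h2 : d / 2 <= `|u - v|.
  have : d <= `|x - u| + `|u - v| + `|y - v|.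
    rewrite /d (_ : x - y = (x - u) + (u - v) + (v - y)); last by rewrite !addrA !subrK.
    apply: (le_trans (ler_normD _ _)); apply: lerD; last by rewrite distrC.
    exact: ler_normD.
  by move: xm ym rd; move: `|x - u| `|y - v| `|u - v| => *; lra.
apply: (le_trans h1); have d20 : 0 < d / 2 by rewrite divr_gt0.
move: Tm; rewrite ler_pdivrMr// => Tm; apply: (le_trans Tm).
by rewrite ler_wpM2l.
Qed.

End locally_lipschitz.

(** * Clamping to a box *)

Section clamp.
Context {R : realType} {n : nat}.
Variables (a b : R).
Hypothesis ab : a <= b.

(** A 1-Lipschitz retraction onto the box: f composed with it is a bounded, globally Lipschitz
    extension of f from the box. *)
Definition clamp (x : 'rV[R]_n) : 'rV[R]_n := \row_i Num.max a (Num.min b (x ord0 i)).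

Lemma clamp_cbox x : cbox a b (clamp x).
Proof. by move=> i; rewrite mxE le_max lexx/= ge_max ab ge_min lexx. Qed.

Lemma clamp_id x : cbox a b x -> clamp x = x.
Proof.
move=> Kx; apply/rowP => i; rewrite mxE; have /andP[ax xb] := Kx i.
by rewrite (min_idPr xb) (max_idPr ax).
Qed.

Lemma normr_max_min_dist (s t : R) :
  `|Num.max a (Num.min b s) - Num.max a (Num.min b t)| <= `|s - t|.
Proof.
wlog st : s t / s <= t.
  by move=> H; have [/H//|/ltW/H] := leP s t; rewrite distrC [X in _ <= X -> _]distrC.
rewrite [leRHS]distrC [leRHS]ger0_norm ?subr_ge0//.
by rewrite ler_norml; case: (leP b s); case: (leP b t); case: (leP a b) ab => //;
   case: (leP a s); case: (leP a t) => *; apply/andP; split; lra.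
Qed.

Lemma clamp_lipschitz x y : `|clamp x - clamp y| <= `|x - y|.
Proof.
rewrite [leLHS]mx_normrE; apply/bigmax_leP; split=> // -[i j] _ /=.
rewrite ord1 !mxE; apply: (le_trans (normr_max_min_dist _ _)).
rewrite [leRHS]mx_normrE (le_trans _ (le_bigmax _ (fun ij : 'I_1 * 'I_n => `|(x - y) ij.1 ij.2|) (ord0, j)))//=.
by rewrite !mxE.
Qed.

Variables (f : 'rV[R]_n -> R) (L : R).
Hypotheses (L0 : 0 <= L)
  (fL : forall x y, cbox a b x -> cbox a b y -> `|f x - f y| <= L * `|x - y|).

Lemma comp_clamp_lipschitz x y : `|(f \o clamp) x - (f \o clamp) y| <= L * `|x - y|.
Proof.
apply: (le_trans (fL (clamp_cbox x) (clamp_cbox y))).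
by rewrite ler_wpM2l// clamp_lipschitz.
Qed.

Lemma comp_clamp_bounded x : `|(f \o clamp) x| <= `|f (clamp 0)| + L * (b - a).
Proof.
rewrite -lerBlDl; apply: (le_trans (lerB_dist _ _)).
apply: (le_trans (fL (clamp_cbox x) (clamp_cbox 0))); rewrite ler_wpM2l//.
rewrite [leLHS]mx_normrE; apply/bigmax_leP; split=> [|[i j] _ /=]; first by rewrite subr_ge0.
have := clamp_cbox x j; have := clamp_cbox 0 j.
have -> : (clamp x - clamp 0) i j = clamp x ord0 j - clamp 0 ord0 j by rewrite (ord1 i) [LHS]mxE [X in _ + X]mxE.
move: (clamp x ord0 j) (clamp 0 ord0 j) => s t /andP[h1 h2] /andP[h3 h4].
by rewrite ler_norml; apply/andP; split; lra.
Qed.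

Lemma partial_comp_clamp i (x : 'rV[R]_n) : (forall j, a < x ord0 j < b) ->
  partial i (f \o clamp) x = partial i f x.
Proof.
move=> xab; apply: near_eq_derive.
have : \forall y \near x, forall j : 'I_n, a < (y : 'rV[R]_n) ord0 j < b.
  apply: (@filter_forall _ 'I_n (fun j (y : 'rV[R]_n) => is_true (a < y ord0 j < b)) (nbhs x) (nbhs_filter x)) => j.
  have /andP[h1 h2] := xab j.
  have o1 : nbhs x [set y : 'rV[R]_n | a < y ord0 j].
    by apply: (@coord_continuous _ _ _ ord0 j x [set y | a < y]); exact: lt_nbhsr.
  have o2 : nbhs x [set y : 'rV[R]_n | y ord0 j < b].
    by apply: (@coord_continuous _ _ _ ord0 j x [set y | y < b]); exact: lt_nbhsl.
  by apply: filterS (filterI o1 o2) => y [/= -> ->].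
apply: filterS => y yab /=; rewrite clamp_id// => j.
by have /andP[h1 h2] := yab j; rewrite !ltW.
Qed.

End clamp.

(** * Truncated densities *)

Section truncated_density.
Context {R : realType} {n : nat}.
Variables (k : nat) (phi : 'rV[R]_n -> \bar R).
Hypotheses (k0 : (0 < k)%N) (phi_gtNy : forall x, orthant R n x -> (-oo < phi x)%E)
  (phi_convex : p_convex k%:R^-1 phi).

Lemma p_convex_vpow y y' (t : R) : orthant R n y -> orthant R n y' -> 0 <= t <= 1 ->
  (phi (vpow k (t *: y + (1 - t) *: y')%R) <= t%:E * phi (vpow k y) + (1 - t)%:E * phi (vpow k y'))%E.
Proof.
have E z : orthant R n z -> vpow k z = \row_i (z ord0 i `^ (k%:R^-1)^-1).
  by move=> z0; apply/rowP => i; rewrite !mxE invrK powR_mulrn// ltW.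
move=> y0 y'0 t01; rewrite !E//; last exact: orthant_convex.
exact: phi_convex.
Qed.

(* [min (exp (- phi)) (exp j)] cut off outside the box [[1/(j+1), j+1]^n]. *)
Definition trunc_density (j : nat) (x : 'rV[R]_n) : R :=
  if x \in (cbox j.+1%:R^-1 j.+1%:R : set 'rV[R]_n) then
    if phi x is r%:E then expR (- Num.max r (- j%:R)) else 0
  else 0.

Lemma trunc_density_ge0 j x : 0 <= trunc_density j x.
Proof. by rewrite /trunc_density; case: ifP => // _; case: (phi x) => // r; exact: expR_ge0. Qed.

Lemma trunc_density_le j x : trunc_density j x <= expR j%:R.
Proof.
rewrite /trunc_density; case: ifP => _; last exact: expR_ge0.
case: (phi x) => [r||]; [|exact: expR_ge0|exact: expR_ge0].
by rewrite ler_expR lerNl le_max lexx orbT.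
Qed.

Lemma trunc_density_out j x : ~ cbox j.+1%:R^-1 j.+1%:R x -> trunc_density j x = 0.
Proof. by move=> nx; rewrite /trunc_density memNset. Qed.

Lemma trunc_density_in j x : cbox j.+1%:R^-1 j.+1%:R x ->
  trunc_density j x = if phi x is r%:E then expR (- Num.max r (- j%:R)) else 0.
Proof. by move=> Kx; rewrite /trunc_density mem_set. Qed.

Lemma cbox_succ_orthant j : cbox j.+1%:R^-1 j.+1%:R `<=` orthant R n.
Proof. by move=> x Kx i; have /andP[h _] := Kx i; rewrite (lt_le_trans _ h)// invr_gt0. Qed.

(** Convexity bounds phi by a finite value and [phi_gtNy] excludes -oo, so phi is real at the
    intermediate point; a maximum with a constant stays convex. *)
Lemma p_convex_max_le j y y' (t : R) r r' : orthant R n y -> orthant R n y' -> 0 <= t <= 1 ->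
  phi (vpow k y) = r%:E -> phi (vpow k y') = r'%:E ->
  exists2 s, phi (vpow k (t *: y + (1 - t) *: y')) = s%:E &
    Num.max s (- j%:R) <= t * Num.max r (- j%:R) + (1 - t) * Num.max r' (- j%:R).
Proof.
move=> y0 y'0 t01 ry ry'.
have := p_convex_vpow y0 y'0 t01; rewrite ry ry' -!EFinM -EFinD.
have := phi_gtNy (vpow_orthant k (orthant_convex y0 y'0 t01)).
case: (phi _) => [s _ sle||//]; last by rewrite leNgt ltry.
exists s => //; move: sle; rewrite lee_fin => sle.
have /andP[t0 t1] := t01.
have m1 : r <= Num.max r (- j%:R) by rewrite le_max lexx.
have m2 : - j%:R <= Num.max r (- j%:R) by rewrite le_max lexx orbT.
have m3 : r' <= Num.max r' (- j%:R) by rewrite le_max lexx.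
have m4 : - j%:R <= Num.max r' (- j%:R) by rewrite le_max lexx orbT.
move: (- j%:R) (Num.max r _) (Num.max r' _) m1 m2 m3 m4 => w p q m1 m2 m3 m4.
rewrite ge_max; apply/andP; split; first by apply: (le_trans sle); nra.
by nra.
Qed.

Lemma trunc_density_quasi_pconcave j : quasi_pconcave k (trunc_density j).
Proof.
move=> y y' t y0 y'0 t01.
have [Ky|nK] := pselect (cbox j.+1%:R^-1 j.+1%:R (vpow k y)); last first.
  by rewrite (trunc_density_out nK) (le_trans _ (trunc_density_ge0 _ _))// ge_min lexx.
have [Ky'|nK] := pselect (cbox j.+1%:R^-1 j.+1%:R (vpow k y')); last first.
  by rewrite (trunc_density_out nK) (le_trans _ (trunc_density_ge0 _ _))// ge_min lexx orbT.
rewrite (trunc_density_in Ky) (trunc_density_in Ky') (trunc_density_in (vpow_cbox k0 t01 y0 y'0 Ky Ky')).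
have P0 z : 0 <= (if phi z is r%:E then expR (- Num.max r (- j%:R)) else 0 : R).
  by case: (phi z) => // r; exact: expR_ge0.
case ry : (phi (vpow k y)) => [r||]; try by rewrite (le_trans _ (P0 _))// ge_min lexx.
case ry' : (phi (vpow k y')) => [r'||]; try by rewrite (le_trans _ (P0 _))// ge_min lexx orbT.
have [s -> sle] := p_convex_max_le j y0 y'0 t01 ry ry'.
have /andP[t0 t1] := t01.
move: (Num.max s _) (Num.max r _) (Num.max r' _) sle => p q w sle.
rewrite ge_min !ler_expR !lerN2; have [qw|/ltW wq] := leP q w; apply/orP; [right|left]; nra.
Qed.

Lemma trunc_density_midpoint j y y' : orthant R n y -> orthant R n y' ->
  trunc_density j (vpow k y) * trunc_density j (vpow k y') <= trunc_density j (vpow k (vmid y y')) ^+ 2.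
Proof.
move=> y0 y'0.
have [Ky|nK] := pselect (cbox j.+1%:R^-1 j.+1%:R (vpow k y)); last first.
  by rewrite (trunc_density_out nK) mul0r sqr_ge0.
have [Ky'|nK] := pselect (cbox j.+1%:R^-1 j.+1%:R (vpow k y')); last first.
  by rewrite (trunc_density_out nK) mulr0 sqr_ge0.
have t01 : 0 <= (2^-1 : R) <= 1 by rewrite invr_ge0 ler0n invf_le1 ?ler1n.
rewrite vmidE (trunc_density_in Ky) (trunc_density_in Ky') (trunc_density_in (vpow_cbox k0 t01 y0 y'0 Ky Ky')).
case ry : (phi (vpow k y)) => [r||]; try by rewrite mul0r sqr_ge0.
case ry' : (phi (vpow k y')) => [r'||]; try by rewrite mulr0 sqr_ge0.
have [s -> sle] := p_convex_max_le j y0 y'0 t01 ry ry'.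
move: (Num.max s _) (Num.max r _) (Num.max r' _) sle => p q w sle.
by rewrite -expRD -expRM_natl ler_expR; lra.
Qed.

Lemma trunc_density_le_expeR j x : orthant R n x ->
  ((trunc_density j x)%:E <= expeR (- phi x))%E.
Proof.
move=> x0; have := phi_gtNy x0; rewrite /trunc_density.
case: ifP => _; last by move=> _; exact: expeR_ge0.
case: (phi x) => [r _ /=||//]; last by rewrite /= lexx.
by rewrite lee_fin ler_expR lerN2 le_max lexx.
Qed.

Lemma trunc_density_nondecreasing i j x : (i <= j)%N -> trunc_density i x <= trunc_density j x.
Proof.
move=> ij; have [Kx|nK] := pselect (cbox i.+1%:R^-1 i.+1%:R x); last first.
  by rewrite (trunc_density_out nK) trunc_density_ge0.
have Kj : cbox j.+1%:R^-1 j.+1%:R x.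
  move=> l; have /andP[h1 h2] := Kx l; apply/andP; split.
    by apply: le_trans h1; rewrite lef_pV2 ?posrE// ler_nat.
  by apply: (le_trans h2); rewrite ler_nat.
rewrite (trunc_density_in Kx) (trunc_density_in Kj); case: (phi x) => // r.
rewrite ler_expR lerN2 ge_max !le_max lexx/=.
by apply/orP; right; rewrite lerN2 ler_nat.
Qed.

Lemma trunc_density_eventually x : orthant R n x ->
  \forall j \near \oo, ((trunc_density j x)%:E = expeR (- phi x))%E.
Proof.
move=> x0.
have nK : \forall j \near \oo, cbox j.+1%:R^-1 j.+1%:R x.
  apply: filter_forall => i.
  have h1 := near_infty_natSinv_lt (PosNum (x0 i)).
  have h2 : \forall j \near \oo, x ord0 i <= j%:R :> R by exact: nbhs_infty_ger.
  apply: filterS2 h1 h2 => j /= h1 h2.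
  by rewrite (ltW h1)/= (le_trans h2)// ler_nat.
move: (phi_gtNy x0); case rx : (phi x) => [r||] // _; last first.
  by apply: filterS nK => j Kj; rewrite (trunc_density_in Kj) rx.
have nr : \forall j \near \oo, - r <= j%:R :> R by exact: nbhs_infty_ger.
apply: filterS2 nK nr => j Kj nr; rewrite (trunc_density_in Kj) rx /=.
by rewrite (max_idPl _)// lerNl.
Qed.

End truncated_density.

Section nonmeasurable_integral.
Local Open Scope ereal_scope.
Context d (T : measurableType d) (R : realType).
Variable mu : {measure set T -> \bar R}.

(* The integral of a nonnegative function is the supremum over the simple functions below it. *)
Lemma ge0_le_integral_subset (D E : set T) (f g : T -> \bar R) : D `<=` E ->
  (forall x, D x -> 0 <= f x) -> (forall x, E x -> 0 <= g x) -> (forall x, D x -> f x <= g x) ->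
  \int[mu]_(x in D) f x <= \int[mu]_(x in E) g x.
Proof.
move=> DE f0 g0 fg; rewrite ge0_integralE// ge0_integralE//=.
apply: le_ereal_sup => _ [h /= hf <-]; exists h => // x; apply: (le_trans (hf x)).
rewrite !patchE; case: ifPn => [|nD]; first by rewrite inE => Dx; rewrite mem_set ?fg//; exact: DE.
by case: ifPn => //; rewrite inE => Ex; exact: g0.
Qed.

(** The integrand may be nonmeasurable, so it is compared with the constant +oo, whose integral over
    a null set is 0. *)
Lemma ge0_integral_null_set (N : set T) (f : T -> \bar R) : measurable N -> mu N = 0 ->
  (forall x, N x -> 0 <= f x) -> \int[mu]_(x in N) f x = 0.
Proof.
move=> mN N0 f0; apply/eqP; rewrite eq_le; apply/andP; split; last exact: integral_ge0.
apply: (@le_trans _ _ (\int[mu]_(x in N) +oo)).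
  by apply: ge0_le_integral_subset => // x _; rewrite ?leey.
by rewrite integral_cst// N0 mule0.
Qed.

End nonmeasurable_integral.

(** * The measure on the orthant as a limit of weights *)

Section orthant_measure.
Context {R : realType} {n : nat}.
Variables (k : nat) (phi : 'rV[R]_n -> \bar R) (mu : {measure set 'rV[R]_n -> \bar R}).
Hypotheses (k1 : (1 < k)%N) (phi_gtNy : forall x, orthant R n x -> (-oo < phi x)%E)
  (phi_convex : p_convex k%:R^-1 phi)
  (mu_density : has_density_on (orthant R n) mu (fun x => expeR (- phi x)%E)).

Local Notation td := (trunc_density phi).
Local Notation W j := (weight (td j)).
Local Notation a j := (j.+1%:R^-1 : R).
Local Notation b j := (j.+1%:R : R).
Local Notation wi j := (wint (a j) (b j) (W j)).
Let k0 : (0 < k)%N. Proof. exact: ltnW. Qed.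
Let a0 j : 0 < a j. Proof. by rewrite invr_gt0. Qed.
Let td0 j : forall x, 0 <= td j x. Proof. exact: trunc_density_ge0. Qed.
Let tdC j : forall x, td j x <= expR j%:R. Proof. exact: trunc_density_le. Qed.
Let tdK j : forall x, ~ cbox (a j) (b j) x -> td j x = 0. Proof. by move=> x; exact: trunc_density_out. Qed.
Let tdq j : quasi_pconcave k (td j). Proof. exact: (trunc_density_quasi_pconcave k0 phi_gtNy phi_convex). Qed.
Let mW j : measurable_fun setT (W j). Proof. exact: (measurable_weight k0 (a0 j) (@td0 j) (@tdK j) (@tdq j)). Qed.
Let W0 j x : 0 <= W j x. Proof. by apply: weight_ge0; exact: td0. Qed.
Let WC j x : W j x <= expR j%:R. Proof. by apply: weight_leC; [exact: td0|exact: tdC]. Qed.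
Let WK j x : ~ cbox (a j) (b j) x -> W j x = 0. Proof. by apply: weightK; exact: tdK. Qed.

Let Z := \bigcup_j bad_set (td j).
(** Here all truncations agree with their Borel weights, so the density is a limit of Borel
    functions. The removed part of the orthant is null for Lebesgue measure and, through the
    density, for [mu]. *)
Definition good_set : set 'rV[R]_n := orthant R n `\` Z.
Local Notation D := good_set.
Definition orthant_density (x : 'rV[R]_n) : R := fine (expeR (- phi x)).
Local Notation dens := orthant_density.

Lemma measurable_orthant : measurable (orthant R n).
Proof.
rewrite (_ : orthant R n = \bigcap_(i in [set: 'I_n]) ((fun x : 'rV[R]_n => x ord0 i) @^-1` `]0, +oo[%classic)).
  apply: fin_bigcap_measurable => [|i _]; first exact: finite_finset.
  by rewrite -[X in measurable X]setTI; apply: measurable_coord => //; exact: measurable_itv.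
by apply/seteqP; split => x /= h i; have := h i; rewrite /= in_itv/= andbT//; apply.
Qed.

Let mZ : measurable Z /\ lebesgue_rV Z = 0%E.
Proof.
by apply: measure_countable_bigcup0 => j; [exact: measurable_bad_set|exact: lebesgue_bad_set].
Qed.

Lemma measurable_good_set : measurable D.
Proof. by apply: measurableD; [exact: measurable_orthant|exact: mZ.1]. Qed.

Let mOZ : measurable (orthant R n `&` Z).
Proof. by apply: measurableI; [exact: measurable_orthant|exact: mZ.1]. Qed.

Lemma measure_orthant_bad : mu (orthant R n `&` Z) = 0%E.
Proof.
rewrite mu_density//; apply: ge0_integral_null_set => //.
  by apply: (subset_measure0 _ mZ.1 _ mZ.2) => //; exact: subIsetr.
by move=> x _; exact: expeR_ge0.
Qed.

Lemma densE x : orthant R n x -> (dens x)%:E = expeR (- phi x).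
Proof. by move=> /phi_gtNy; rewrite /dens; case: (phi x). Qed.

Lemma dens_ge0 x : 0 <= dens x.
Proof. by rewrite fine_ge0// expeR_ge0. Qed.

Lemma good_setWE j x : D x -> W j x = td j x.
Proof. by move=> [_ nZ]; rewrite weightE// => h; apply: nZ; exists j. Qed.

Lemma good_setW_cvg x : D x -> W j x @[j --> \oo] --> dens x.
Proof.
move=> Dx; apply: cvg_near_cst.
apply: filterS (trunc_density_eventually phi_gtNy Dx.1) => j.
by rewrite -densE; [case=> <-; rewrite good_setWE|exact: Dx.1].
Qed.

Lemma good_setW_le j x : D x -> W j x <= dens x.
Proof.
move=> Dx; rewrite good_setWE// -lee_fin densE; last exact: Dx.1.
by apply: trunc_density_le_expeR => //; exact: Dx.1.
Qed.

Lemma measurable_dens : measurable_fun D dens.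
Proof.
apply: (@measurable_fun_cvg _ _ _ _ (fun j => W j)); last by move=> x; exact: good_setW_cvg.
by move=> j; apply: measurable_funTS; exact: mW.
Qed.

Lemma ge0_integral_orthant (g : 'rV[R]_n -> \bar R) : measurable_fun (orthant R n) g ->
  (forall x, orthant R n x -> 0 <= g x)%E ->
  (\int[mu]_(x in orthant R n) g x = \int[mu]_(x in D) g x)%E.
Proof.
move=> mg g0.
rewrite (ge0_negligible_integral mOZ measurable_orthant mg g0 measure_orthant_bad).
by rewrite setDIr setDv set0U.
Qed.

Lemma ge0_integral_good_set (h : 'rV[R]_n -> R) : measurable_fun D h -> (forall x, 0 <= h x) ->
  (\int[mu]_(x in D) (h x)%:E = \int[lebesgue_rV]_(x in D) (h x * dens x)%:E)%E.
Proof.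
move=> mh h0.
rewrite (@ge0_integral_density _ _ _ lebesgue_rV mu D dens (EFin \o h))//.
- exact: measurable_good_set.
- exact: measurable_dens.
- exact: dens_ge0.
- move=> A mA AD; rewrite mu_density//; last by move=> x /AD[].
  by apply: eq_integral => x; rewrite inE => /AD[x0 _]; rewrite densE.
- exact/measurable_EFinP.
Qed.

Lemma ge0_integral_W_le j (h : 'rV[R]_n -> R) : measurable_fun D h -> (forall x, 0 <= h x) ->
  (\int[lebesgue_rV]_(x in D) (h x * W j x)%:E <= \int[mu]_(x in D) (h x)%:E)%E.
Proof.
move=> mh h0; rewrite ge0_integral_good_set//; apply: ge0_le_integral_subset => // x Dx.
- by rewrite lee_fin mulr_ge0.
- by rewrite lee_fin mulr_ge0// dens_ge0.
- by rewrite lee_fin ler_wpM2l// good_setW_le.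
Qed.

Lemma ge0_integral_W_cvg (h : 'rV[R]_n -> R) : measurable_fun D h -> (forall x, 0 <= h x) ->
  (\int[lebesgue_rV]_(x in D) (h x * W j x)%:E @[j --> \oo] --> \int[mu]_(x in D) (h x)%:E)%E.
Proof.
move=> mh h0; rewrite ge0_integral_good_set//.
have L x : D x -> limn (fun j => (h x * W j x)%:E) = (h x * dens x)%:E.
  move=> Dx; apply/cvg_lim => //; apply: cvg_EFin; first exact: nearW.
  by apply: cvgM; [exact: cvg_cst|exact: good_setW_cvg].
have -> : (\int[lebesgue_rV]_(x in D) (h x * dens x)%:E =
    \int[lebesgue_rV]_(x in D) limn (fun j => (h x * W j x)%:E))%E.
  by apply: eq_integral => x; rewrite inE => /L.
apply: cvg_monotone_convergence => //.
- exact: measurable_good_set.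
- by move=> j; apply/measurable_EFinP; apply: measurable_funM => //; apply: measurable_funTS; exact: mW.
- by move=> j x _; rewrite lee_fin mulr_ge0.
- move=> x Dx i j ij; rewrite lee_fin ler_wpM2l// !good_setWE//.
  exact: trunc_density_nondecreasing.
Qed.

Lemma wint_good_set j (g : 'rV[R]_n -> R) : wbounded (a j) (b j) g ->
  (forall x, 0 <= g x) -> ((wi j g)%:E = \int[lebesgue_rV]_(x in D) (g x * W j x)%:E)%E.
Proof.
move=> bg g0; rewrite -(integral_wint (@mW j) (@W0 j) (@WC j) (@WK j) bg).
rewrite [RHS]integral_mkcond; apply: ge0_ae_eq_integral => //.
- by apply/measurable_EFinP; apply: measurable_funM => //; exact: bg.1.
- apply: (measurable_restrictT (fun x => (g x * W j x)%:E) measurable_good_set).1.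
  apply: measurable_funTS; apply/measurable_EFinP; apply: measurable_funM => //; exact: bg.1.
- by move=> x _; rewrite lee_fin mulr_ge0.
- by move=> x _; apply: erestrict_ge0 => y _; rewrite lee_fin mulr_ge0.
exists Z; split; [exact: mZ.1|exact: mZ.2|].
move=> x /= nx; apply: contrapT => nZ; apply: nx => _; rewrite patchE mulrC.
case: ifPn => // nD; rewrite WK ?mulr0// => Kx; move: nD; rewrite notin_setE; apply; split => //.
exact: (@cbox_succ_orthant R n j).
Qed.

Variable f : 'rV[R]_n -> R.
Hypothesis f_lip : locally_lipschitz_on (orthant R n) f.

Local Notation rhs i := (\int[mu]_(x in orthant R n) ((x ord0 i) ^+ 2 * `|partial i f x| ^+ 2)%:E)%E.

Lemma wint_variance_le j : exists F : 'rV[R]_n -> R,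
  [/\ wbounded (a j) (b j) F, forall x, cbox (a j) (b j) x -> F x = f x &
   (((wi j (fun x => F x ^+ 2) - wi j F ^+ 2 / wi j (fun=> 1)))%:E <=
    (k%:R ^+ 2 / (k%:R - 1))%:E * \sum_(i < n) rhs i)%E].
Proof.
(* The next larger box j + 1 is used for clamping: box j is then in its interior, where the clamped
   function has the same partial derivatives as f. *)
have KO := @cbox_succ_orthant R n j.+1.
have [L L0 fL] := locally_lipschitz_cbox f_lip KO.
have ab : a j.+1 <= b j.+1.
  by rewrite (@le_trans _ _ 1)// ?ler1n// invf_le1 ?ler1n.
pose F := f \o clamp (a j.+1) (b j.+1).
have lipF := comp_clamp_lipschitz ab L0 fL; have FB := comp_clamp_bounded ab L0 fL.
have in_int (x : 'rV[R]_n) i : cbox (a j) (b j) x -> a j.+1 < x ord0 i < b j.+1.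
  move=> /(_ i)/andP[h1 h2]; apply/andP; split.
    by apply: lt_le_trans h1; rewrite ltf_pV2 ?posrE// ltr_nat.
  by apply: (le_lt_trans h2); rewrite ltr_nat.
have Ff x : cbox (a j) (b j) x -> F x = f x.
  move=> Kx; rewrite /F/= clamp_id// => i.
  by have /andP[h1 h2] := in_int x i Kx; rewrite !ltW.
have pF i x : cbox (a j) (b j) x -> partial i F x = partial i f x.
  by move=> Kx; apply: partial_comp_clamp => // l; exact: in_int.
have bF : wbounded (a j) (b j) F.
  split; first by apply: continuous_measurable_rV; exact: lipschitz_continuous lipF.
  by exists (`|f (clamp (a j.+1) (b j.+1) 0)| + L * (b j.+1 - a j.+1)) => x _; exact: FB.
exists F; split => //.
have kk : 0 < k%:R - 1 :> R by rewrite subr_gt0 ltr1n.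
have kE : k.-1%:R = k%:R - 1 :> R by rewrite -subn1 natrB.
have := wint_poincare_lipschitz k1 (a0 j) (@td0 j) (@tdC j) (@tdK j) (@tdq j)
  (trunc_density_midpoint k0 phi_gtNy phi_convex j) lipF FB.
rewrite kE mulrC -ler_pdivlMr// => H.
apply: (@le_trans _ _ ((k%:R ^+ 2 / (k%:R - 1))%:E *
    (\sum_(i < n) wi j (fun x => x ord0 i ^+ 2 * gpartial F i x ^+ 2))%:E)%E).
  by rewrite -EFinM lee_fin [leRHS]mulrAC.
apply: lee_wpmul2l; first by rewrite lee_fin divr_ge0// ?sqr_ge0// ltW.
rewrite -sumEFin; apply: lee_sum => i _.
have bg : wbounded (a j) (b j) (fun x => x ord0 i ^+ 2 * gpartial F i x ^+ 2).
  apply: wboundedM; apply: wboundedX; first exact: wbounded_coord.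
  split; first exact: measurable_gpartial lipF i.
  by exists `|L| => x _; exact: gpartial_le lipF i x.
have g0 (x : 'rV[R]_n) : 0 <= x ord0 i ^+ 2 * gpartial F i x ^+ 2 by rewrite mulr_ge0 ?sqr_ge0.
pose h (x : 'rV[R]_n) : R := \1_(cbox (a j) (b j)) x * (x ord0 i ^+ 2 * gpartial F i x ^+ 2).
have h0 x : 0 <= h x by rewrite mulr_ge0.
have mh : measurable_fun D h.
  apply: measurable_funTS; apply: measurable_funM; last exact: bg.1.
  by apply: measurable_indic; exact: measurable_cbox.
rewrite wint_good_set//.
have -> : (\int[lebesgue_rV]_(x in D) (x ord0 i ^+ 2 * gpartial F i x ^+ 2 * W j x)%:E =
    \int[lebesgue_rV]_(x in D) (h x * W j x)%:E)%E.
  apply: eq_integral => x _; congr (_%:E); rewrite /h indicE.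
  by case: (boolP (x \in _)) => [_|]; [rewrite mul1r|rewrite notin_setE => nK; rewrite WK// !mulr0].
apply: (le_trans (ge0_integral_W_le j mh h0)).
(* This comparison allows [partial i f] to be nonmeasurable. *)
apply: ge0_le_integral_subset; first by move=> x [].
- by move=> x _; rewrite lee_fin.
- by move=> x _; rewrite lee_fin mulr_ge0// ?sqr_ge0// exprn_ge0.
move=> x _; rewrite lee_fin /h indicE; case: (boolP (x \in _)) => [|_]; last first.
  by rewrite mul0r mulr_ge0 ?sqr_ge0// exprn_ge0.
rewrite inE mul1r => Kx; rewrite ler_wpM2l ?sqr_ge0// real_normK ?num_real//.
(* Where the derivative fails to exist the left side is 0, below the square of any default value. *)
rewrite /gpartial; case: ifP => _; last by rewrite expr0n/= sqr_ge0.
by rewrite pF.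
Qed.

End orthant_measure.

Theorem theorem1p1 (R : realType) (n k : nat)
    (phi : 'rV[R]_n -> \bar R) (mu : {measure set 'rV[R]_n -> \bar R})
    (f : 'rV[R]_n -> R)
    (n_ge1 : (1 <= n)%N) (k_gt1 : (1 < k)%N)
    (phi_gtNy : forall x, orthant R n x -> (-oo < phi x)%E)
    (phi_convex : p_convex k%:R^-1 phi)
    (mu_density : has_density_on (orthant R n) mu (fun x => expeR (- phi x)%E))
    (f_lip : locally_lipschitz_on (orthant R n) f)
    (f_int : mu.-integrable (orthant R n) (EFin \o f))
    (f_mean0 : (\int[mu]_(x in orthant R n) (f x)%:E = 0)%E) :
  (\int[mu]_(x in orthant R n) ((f x) ^+ 2)%:E <=
   (k%:R ^+ 2 / (k%:R - 1))%:E *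
   \sum_(i < n) \int[mu]_(x in orthant R n)
      ((x ord0 i) ^+ 2 * `|partial i f x| ^+ 2)%:E)%E.
Proof.
set c := k%:R ^+ 2 / (k%:R - 1); set rhs := (\sum_(i < n) _)%E.
have c0 : 0 < c by rewrite divr_gt0 ?subr_gt0 ?ltr1n// exprn_gt0// ltr0n ltnW.
have rhs0 : (0 <= rhs)%E.
  by apply: sume_ge0 => i _; apply: integral_ge0 => x _; rewrite lee_fin mulr_ge0 ?sqr_ge0// exprn_ge0.
have mO := @measurable_orthant R n.
have mf : measurable_fun (orthant R n) f by apply/measurable_EFinP; exact: measurable_int f_int.
(* A null orthant is set aside because the masses [I j] serve as denominators below. *)
have [muO|muO] := eqVneq (mu (orthant R n)) 0%E.
  rewrite null_set_integral//; first by rewrite mule_ge0// lee_fin ltW.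
  by apply/measurable_EFinP; exact: measurable_funX.
have [/eqP ->|rhsfin] := boolP (rhs == +oo%E); first by rewrite gt0_muley// leey.
have {rhsfin} rhsfin : rhs \is a fin_num by rewrite ge0_fin_numE// lt_neqAle rhsfin leey.
pose D := good_set phi.
have mD : measurable D by exact: measurable_good_set.
have mfD : measurable_fun D f by apply: measurable_funS mf => // x [].
pose a (j : nat) : R := j.+1%:R^-1; pose b (j : nat) : R := j.+1%:R.
pose W j := weight (trunc_density phi j).
pose wi j := wint (a j) (b j) (W j).
have [F_ HF] := choice (wint_variance_le k_gt1 phi_gtNy phi_convex mu_density f_lip).
have wE (h : R -> R) j : measurable_fun setT h -> (forall t, 0 <= h t) ->
    wbounded (a j) (b j) (fun x => h (F_ j x)) ->
    ((wi j (fun x => h (F_ j x)))%:E = \int[lebesgue_rV]_(x in D) (h (f x) * W j x)%:E)%E.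
  move=> mh h0 bh; rewrite (wint_good_set k_gt1 phi_gtNy phi_convex bh)//.
  apply: eq_integral => x _; congr (_%:E).
  have [_ Ff _] := HF j.
  have [Kx|nK] := pselect (cbox (a j) (b j) x); first by rewrite Ff.
  by rewrite /W (weightK (@trunc_density_out _ _ phi j) nK) !mulr0.
(* Monotone convergence needs nonnegative integrands, so this is applied to t^2, to 1 and to the
   positive and negative parts of t. *)
have wcvg (h : R -> R) : measurable_fun setT h -> (forall t, 0 <= h t) ->
    (forall j, wbounded (a j) (b j) (fun x => h (F_ j x))) ->
    ((wi j (fun x => h (F_ j x)))%:E @[j --> \oo] --> \int[mu]_(x in orthant R n) (h (f x))%:E)%E.
  move=> mh h0 bh; have mhf : measurable_fun (orthant R n) (h \o f) by exact: measurableT_comp.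
  rewrite (ge0_integral_orthant mu_density); last 2 first.
  - exact/measurable_EFinP.
  - by move=> x _; rewrite lee_fin.
  under eq_fun do rewrite wE//.
  apply: (ge0_integral_W_cvg k_gt1 phi_gtNy phi_convex mu_density (h := h \o f)) => // [|x].
    by apply: measurable_funS mhf => // x [].
  exact: h0.
have bF j : wbounded (a j) (b j) (F_ j) by have [] := HF j.
have bpos j (s : R) : wbounded (a j) (b j) (fun x => Num.max (s * F_ j x) 0).
  have [mF [B FB]] := wboundedZ s (bF j); split; first exact: measurable_maxr.
  exists B => x Kx; rewrite ger0_norm ?le_max ?lexx ?orbT// ge_max.
  by rewrite (le_trans (ler_norm _) (FB _ Kx)) (le_trans (normr_ge0 _) (FB _ Kx)).
have mpos (s : R) : measurable_fun setT (fun t : R => Num.max (s * t) 0).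
  by apply: measurable_maxr => //; exact: measurable_funM.
have pos0 (s t : R) : 0 <= Num.max (s * t) 0 by rewrite le_max lexx orbT.
have cvg2 := wcvg (fun t => t ^+ 2) (exprn_measurable _) (@sqr_ge0 R) (fun j => wboundedX 2 (bF j)).
have cvg1 := wcvg (fun=> 1) (measurable_cst _) (fun=> ler01) (fun j => wbounded_cst _ _ 1).
have cvgp := wcvg _ (mpos 1) (pos0 1) (fun j => bpos j 1).
have cvgn := wcvg _ (mpos (-1)) (pos0 (-1)) (fun j => bpos j (-1)).
have posE : (\int[mu]_(x in orthant R n) (Num.max (1 * f x) 0)%:E =
    \int[mu]_(x in orthant R n) ((EFin \o f)^\+ x))%E.
  by apply: eq_integral => x _; rewrite funeposE/= mul1r EFin_max.
have negE : (\int[mu]_(x in orthant R n) (Num.max (-1 * f x) 0)%:E =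
    \int[mu]_(x in orthant R n) ((EFin \o f)^\- x))%E.
  by apply: eq_integral => x _; rewrite funenegE/= mulN1r EFin_max.
have pfin := integrable_pos_fin_num mO f_int; have nfin := integrable_neg_fin_num mO f_int.
have pn : (\int[mu]_(x in orthant R n) ((EFin \o f)^\+ x) = \int[mu]_(x in orthant R n) ((EFin \o f)^\- x))%E.
  have := f_mean0; rewrite integralE -(fineK pfin) -(fineK nfin) -EFinB => -[] /eqP.
  by rewrite subr_eq0 => /eqP ->.
pose m j := wi j (F_ j); pose I j := wi j (fun=> 1).
have W0 j x : 0 <= W j x by apply: weight_ge0; exact: trunc_density_ge0.
(* The means converge to the difference of the integrals of the two parts, which are finite and
   equal by [f_mean0]. *)
have mcvg : m j @[j --> \oo] --> (0 : R).
  have mE j : m j = wi j (fun x => Num.max (1 * F_ j x) 0) - wi j (fun x => Num.max (-1 * F_ j x) 0).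
    have k0 : (0 < k)%N by exact: ltnW.
    have a0 i : 0 < a i by rewrite invr_gt0.
    have mW : measurable_fun setT (W j).
      apply: (measurable_weight k0 (a0 j)); [exact: trunc_density_ge0| |].
        by move=> x; exact: trunc_density_out.
      exact: (trunc_density_quasi_pconcave k0 phi_gtNy phi_convex).
    have WC x : W j x <= expR j%:R by apply: weight_leC; [exact: trunc_density_ge0|exact: trunc_density_le].
    apply/esym/eqP; rewrite subr_eq; apply/eqP.
    rewrite /m /wi -(wintD mW (W0 j) WC (bF j) (bpos j (-1))); congr wint; apply/funext => x.
    by rewrite mul1r mulN1r; case: (leP (F_ j x) 0) => h; case: (leP (- F_ j x) 0) => h'; lra.
  rewrite -[X in _ --> X](subrr (fine (\int[mu]_(x in orthant R n) ((EFin \o f)^\+ x)))%E).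
  under eq_fun do rewrite mE.
  have p1 := cvgp; rewrite posE -(fineK pfin) in p1.
  have p2 := cvgn; rewrite negE -pn -(fineK pfin) in p2.
  by apply: cvgB; [exact: (fine_cvg p1)|exact: (fine_cvg p2)].
(* If all the masses vanished, their limit, the measure of the orthant, would be 0. *)
have [j0 I0] : exists j0, 0 < I j0.
  apply: contrapT => /forallNP nI; move: muO; apply/negP; rewrite negbK.
  have IE j : I j = 0.
    apply/eqP; rewrite eq_le; apply/andP; split; first by rewrite leNgt; apply/negP/nI.
    by apply: (wint_ge0 (W0 j)).
  have : (0%R%:E @[j --> \oo] --> \int[mu]_(x in orthant R n) 1%:E)%E.
    by move: cvg1; under eq_fun do rewrite -/(I _) IE.
  move=> h; rewrite -[mu _]mul1e -(integral_cst mu mO 1%E); apply/eqP.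
  by apply: (cvg_unique _ h) => //; exact: cvg_cst.
have Imono j : (j0 <= j)%N -> I j0 <= I j.
  move=> jj; rewrite -lee_fin.
  have e1 i := wE (fun=> 1) i (measurable_cst _) (fun=> ler01) (wbounded_cst _ _ 1).
  rewrite /I (e1 j0) (e1 j); apply: ge0_le_integral_subset; first exact: subset_refl.
  - by move=> x _; rewrite lee_fin mul1r; exact: W0.
  - by move=> x _; rewrite lee_fin mul1r; exact: W0.
  move=> x Dx; rewrite lee_fin !mul1r /W (good_setWE _ Dx) (good_setWE _ Dx).
  exact: trunc_density_nondecreasing.
apply/lee_addgt0Pr => e e0.
have mI : m j ^+ 2 / I j0 @[j --> \oo] --> (0 : R).
  rewrite -[X in _ --> X](mul0r (I j0)^-1) -[X in X * _](mulr0 0).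
  under eq_fun do rewrite expr2.
  by apply: cvgM; [exact: cvgM|exact: cvg_cst].
(* For j >= j0 the correction m_j^2 / I_j is at most m_j^2 / I_j0, which eventually drops below
   e. *)
have near_le : \forall j \near \oo, ((wi j (fun x => F_ j x ^+ 2))%:E <= c%:E * rhs + e%:E)%E.
  have /cvgr_lt/(_ _ e0) mIe := mI.
  near=> j.
  have [_ _] := HF j; rewrite EFinB leeBlDr// => h; apply: (le_trans h).
  rewrite leeD2l// lee_fin.
  have jj : (j0 <= j)%N by near: j; exact: nbhs_infty_ge.
  apply: (@le_trans _ _ (m j ^+ 2 / I j0)); last by apply: ltW; near: j.
  rewrite -/(wi j) -/(m j) -/(I j); apply: ler_wpM2l; first exact: sqr_ge0.
  have inv_le (x y : R) : 0 < x -> x <= y -> y^-1 <= x^-1.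
    by move=> x0 xy; rewrite lef_pV2 ?posrE// (lt_le_trans x0).
  exact: inv_le I0 (Imono _ jj).
(* The second moment is a limit in \bar R, so its finiteness is a consequence of the bound. *)
have -> : (\int[mu]_(x in orthant R n) (f x ^+ 2)%:E = limn (fun j => (wi j (fun x => F_ j x ^+ 2))%:E))%E.
  by apply/esym/cvg_lim => //; exact: cvg2.
apply: lime_le => //; apply/cvg_ex; eexists; exact: cvg2.
Unshelve. all: by end_near. Qed.
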